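(* Let $\mathcal{H}$ be an infinite-dimensional, separable complex Hilbert space. Then $$\mathcal{K}(\mathcal{H}) \cap \mathrm{Bal}(\mathcal{H}) = \mathcal{K}(\mathcal{H}) \cap \overline{\mathfrak{C}_{\mathfrak{E}}},$$ where $\overline{\mathfrak{C}_{\mathfrak{E}}}$ denotes the norm-closure in $\mathcal{B}(\mathcal{H})$ of the set of commutators of idempotents.
   Context: $\mathcal{B}(\mathcal{H})$ is the algebra of bounded linear operators on $\mathcal{H}$ with the operator norm and $\mathcal{K}(\mathcal{H})$ is the ideal of compact operators. $\mathfrak{E} := \{E \in \mathcal{B}(\mathcal{H}) : E^2 = E\}$ and $\mathfrak{C}_{\mathfrak{E}} := \{EF - FE : E, F \in \mathfrak{E}\}$ (the elements of $\mathfrak{C}_{\mathfrak{E}}$ approximating a compact operator need not be compact). Balanced operators: for $T \in \mathcal{B}(\mathcal{H})$ and an open set $\Omega \subseteq \mathbb{C}$ such that $\sigma(T)\cap\Omega$ is relatively closed and open in $\sigma(T)$, $\mathcal{H}(\Omega;T)$ denotes the range of the Riesz idempotent of $T$ corresponding to $\sigma(T)\cap\Omega$. $T - \alpha I$ is semi-Fredholm if its range is closed and $\min(\dim\ker(T-\alpha I), \dim\ker(T-\alpha I)^* ) < \infty$, in which case $\mathrm{Ind}(T-\alpha I) := \dim\ker(T-\alpha I) - \dim\ker(T-\alpha I)^*\in\mathbb{Z}\cup\{\pm\infty\}$. The operator $T$ is called balanced if: (i) $\sigma(T) = \sigma(-T)$; (ii) whenever $\Omega_1,\Omega_2\subseteq\mathbb{C}$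 are disjoint open sets with $\sigma(T)\subseteq\Omega_1\cup\Omega_2$, one has $\dim\mathcal{H}(\Omega_1;T) = \dim\mathcal{H}(-\Omega_1;T)$; (iii) for $\alpha\in\mathbb{C}$, $T-\alpha I$ is semi-Fredholm if and only if $T+\alpha I$ is semi-Fredholm, in which case $\mathrm{Ind}(T-\alpha I) = \mathrm{Ind}(T+\alpha I)$. $\mathrm{Bal}(\mathcal{H})$ denotes the set of balanced operators in $\mathcal{B}(\mathcal{H})$. *)

(* Defs.v *)
From HB Require Import structures.
From mathcomp Require Import all_boot all_order all_algebra sesquilinear.
From mathcomp Require Import complex.
From mathcomp Require Import all_classical all_reals all_analysis.
Import Order.TTheory GRing.Theory Num.Theory.
Import numFieldNormedType.Exports.

Set Implicit Arguments.
Unset Strict Implicit.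
Unset Printing Implicit Defensive.

Local Open Scope classical_set_scope.
Local Open Scope ring_scope.
Local Open Scope complex_scope.

(* A complex Hilbert space is a complete normed module H over R[i] with a      *)
(* positive definite Hermitian form ip (linear on the left, conjugate-linear   *)
(* on the right) such that ip x x = `|x| ^+ 2. Operators are plain functions   *)
(* H -> H; B(H) is the set bounded_op of the linear continuous ones.           *)

Section Dimension.
Context (R : realType) (H : completeNormedModType R[i]).
Implicit Type V : set H.

Definition lin_indep (n : nat) (v : 'I_n -> H) : Prop :=
  forall a : 'I_n -> R[i], \sum_(i < n) a i *: v i = 0 -> forall i, a i = 0.

(* Dimensions are natural numbers or +oo. For closed subspaces of a separable  *)
(* Hilbert space this is the Hilbert dimension, with aleph_0 read as +oo.      *)
Definition subspace_dim V : \bar R :=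
  ereal_sup [set n%:R%:E | n in
    [set n | exists2 v : 'I_n -> H, lin_indep v & forall i, V (v i)]].

Definition infinite_dimensional : Prop := subspace_dim [set: H] = +oo%E.

Definition separable_space : Prop := exists2 D : set H, countable D & dense D.

End Dimension.

Arguments infinite_dimensional {R} H.
Arguments separable_space {R} H.

Section Operators.
Context (R : realType) (H : completeNormedModType R[i]).
Implicit Types (T E F : H -> H) (z alpha : R[i]) (S : set (H -> H)).

Definition bounded_op : set (H -> H) := [set T | linear T /\ continuous T].

(* The norm of H takes values in R[i], hence the projection to R.              *)
Definition op_norm T : R :=
  sup [set complex.Re `|T x| | x in [set x : H | `|x| <= 1]].

Definition norm_closure S : set (H -> H) :=
  [set T | bounded_op T /\
    forall e : R, 0 < e -> exists2 A, S A & op_norm (T - A) < e].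

Definition compact_op : set (H -> H) :=
  [set T | bounded_op T /\
    compact (closure [set T x | x in [set x : H | `|x| <= 1]])].

Definition bounded_idempotent : set (H -> H) :=
  [set E | bounded_op E /\ E \o E = E].

Definition idempotent_commutator : set (H -> H) :=
  [set T | exists E F,
    [/\ bounded_idempotent E, bounded_idempotent F & T = (E \o F) - (F \o E)]].

Definition shift_op T alpha : H -> H := fun x => T x - alpha *: x.

Definition inverse_op T : set (H -> H) :=
  [set U | [/\ bounded_op U, U \o T = id & T \o U = id]].

Definition spectrum T : set R[i] :=
  [set z | ~ (inverse_op (shift_op T z) !=set0)].

(* (z I - T)^-1, meaningful for z outside the spectrum of T.                   *)
Definition resolvent T z : H -> H :=
  get (inverse_op (fun x => z *: x - T x)).

End Operators.

Arguments compact_op {R} H.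
Arguments idempotent_commutator {R} H.

Section Contours.
Context (R : realType).
Implicit Types (f : R[i] -> R[i]) (a b z : R[i]) (p : seq R[i])
  (G : seq (seq R[i])).

Definition segment_point a b (t : R) : R[i] := a + t%:C * (b - a).

Definition segment_integral f a b : R[i] :=
  let g t := f (segment_point a b t) in
  (b - a) *
  ((\int[lebesgue_measure]_(t in `[0%R, 1%R]) complex.Re (g t)) +i*
   (\int[lebesgue_measure]_(t in `[0%R, 1%R]) complex.Im (g t))).

(* A contour is a finite list of closed polygons, each given by its cyclic     *)
(* list of vertices.                                                           *)
Definition polygon_edges p : seq (R[i] * R[i]) := zip p (rot 1 p).

Definition contour_edges G : seq (R[i] * R[i]) :=
  flatten [seq polygon_edges p | p <- G].

Definition contour_support G : set R[i] :=
  [set z | exists2 e, e \in contour_edges G &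
     exists2 t : R, 0 <= t <= 1 & z = segment_point e.1 e.2 t].

(* (2 i pi)^-1 times the integral of f along G.                                *)
Definition contour_integral G f : R[i] :=
  (0 +i* (2 * pi))^-1 *
  \sum_(e <- contour_edges G) segment_integral f e.1 e.2.

Definition winding_number G a : R[i] :=
  contour_integral G (fun z => (z - a)^-1).

End Contours.

Section Balanced.
Context (R : realType) (H : completeNormedModType R[i]).
Context (ip : {dot H for (@Num.conj R[i])}).
Implicit Types (T E : H -> H) (Omega : set R[i]).

Definition separating_contour T Omega (G : seq (seq R[i])) : Prop :=
  [/\ contour_support G `&` spectrum T = set0,
      forall z, spectrum T z -> Omega z -> winding_number G z = 1
    & forall z, spectrum T z -> ~ Omega z -> winding_number G z = 0].

(* The Riesz idempotent of T for the clopen part spectrum T `&` Omega of the   *)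
(* spectrum: (2 i pi)^-1 times the integral of (z I - T)^-1 along a contour    *)
(* around it. The operator-valued integral is taken weakly; by Cauchy's        *)
(* theorem it does not depend on the contour.                                  *)
Definition riesz_idempotent T Omega : H -> H :=
  get [set E | exists2 G, separating_contour T Omega G &
    forall x y, ip (E x) y =
      contour_integral G (fun z => ip (resolvent T z x) y)].

Definition riesz_space Omega T : set H := range (riesz_idempotent T Omega).

Definition adjoint T : H -> H :=
  fun y => get [set z | forall x, ip (T x) y = ip x z].

Definition op_kernel T : set H := T @^-1` [set 0].

Definition semi_Fredholm T : Prop :=
  closed (range T) /\
  (Order.min (subspace_dim (op_kernel T)) (subspace_dim (op_kernel (adjoint T)))
     < +oo)%E.

Definition Fredholm_index T : \bar R :=
  (subspace_dim (op_kernel T) - subspace_dim (op_kernel (adjoint T)))%E.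

Definition balanced : set (H -> H) :=
  [set T | [/\ bounded_op T,
    spectrum T = spectrum (- T),
    forall Omega1 Omega2 : set R[i]^o,
      open Omega1 -> open Omega2 -> Omega1 `&` Omega2 = set0 ->
      spectrum T `<=` Omega1 `|` Omega2 ->
      subspace_dim (riesz_space Omega1 T) =
      subspace_dim (riesz_space [set - z | z in Omega1] T)
  & forall alpha : R[i],
      (semi_Fredholm (shift_op T alpha) <->
       semi_Fredholm (shift_op T (- alpha))) /\
      (semi_Fredholm (shift_op T alpha) ->
       Fredholm_index (shift_op T alpha) =
       Fredholm_index (shift_op T (- alpha)))]].

End Balanced.

(* Main.v *)
(* For a compact operator K both sides say that the generalized eigenspaces of K    *)
(* at l and - l have the same dimension for every l != 0.                           *)
(* Given d > 0, K is block triangular with respect to the span N of a maximal       *)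
(* orthonormal Schur basis with eigenvalues of modulus >= d and its orthogonal      *)
(* complement; the compression Kt of K to the complement has no eigenvalue of       *)
(* modulus >= d, whence a lower bound c |z| |x| <= |(z - Kt) x| for |z| >= d and,   *)
(* by averaging over roots of unity, iterates of Kt that decay faster than d^N.     *)
(* This turns spectral statements about K into statements about polynomials in a    *)
(* triangular matrix: Riesz idempotents are polynomials in K on N, plus possibly    *)
(* the complementary projection, so that balance is symmetry of the eigenvalues.    *)
(* If K is a limit of commutators C = EF - FE, put A = E - F and B = 1 - E - F;     *)
(* then C = BA and AC = - CA. Riesz idempotents of K at l and - l are limits of     *)
(* p(K) and p(- K) for polynomials p without constant term, and A exchanges p(C)    *)
(* and p(- C); were the rank at l the larger one, some x in the range at l would    *)
(* satisfy A p(C) x ~ 0 while C = BA is bounded below near x.                       *)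
(* Conversely, if the eigenvalues are symmetric, compress K to a finite even        *)
(* dimensional space containing N, in a basis where the compression is triangular,  *)
(* and move the diagonal slightly to distinct, nonzero, symmetric values: such a    *)
(* matrix is a commutator of idempotents, by 2 x 2 blocks.                          *)
Require Import Defs.
From HB Require Import structures.
From mathcomp Require Import all_boot all_order all_algebra sesquilinear spectral.
From mathcomp Require Import complex ring lra zify.
From mathcomp Require Import all_classical all_reals all_analysis.
Import Order.TTheory GRing.Theory Num.Theory.
Import numFieldNormedType.Exports.

Set Implicit Arguments.
Unset Strict Implicit.
Unset Printing Implicit Defensive.

Local Open Scope classical_set_scope.
Local Open Scope complex_scope.
Local Open Scope ring_scope.

(** Both sides are equivalent, for compact [K], to condition (S): the generalized eigenspaces of [K]
    at [l] and [- l] have the same dimension for every [l != 0]. The four implications are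
    [balanced_of_eigenspaces], [eigenspaces_of_balanced], [eigenspaces_of_closure] and
    [closure_of_eigenspaces].

    Balance and (S). For [alpha != 0], [K - alpha] is an invertible operator composed with a
    finite-rank perturbation of the identity, hence Fredholm of index 0 ([compact_shift_fredholm]);
    this gives the index condition. Expanding the resolvent under the Riesz integral shows
    ([riesz_space_dim]) that the Riesz space of a set with a separating contour is
    infinite-dimensional if the set contains 0, and otherwise has as dimension the number of
    eigenvalues in the set, with algebraic multiplicity. So symmetric eigenvalues give equal
    dimensions; conversely a small disc around [l], enclosed by an explicit square contour, isolates
    the multiplicity of [l].

    From commutators to (S). A commutator [C] of idempotents factors as [C = BA] with [AC = - CA]
    ([commutator_factor]), so [A] carries what [C] does at [l] to what it does at [- l], injectively
    where [C] is bounded below. The norms of [A] and [B] are not controlled as [C] tends to [K];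
    [polishP] makes [p(C)] so nearly idempotent that the defect beats these norms
    ([rank_le_of_closure]).

    From (S) to commutators. [K] is close to [P K] with [P] a finite-rank orthogonal projection, in
    a basis where the matrix of [K] is triangular with the large eigenvalues first and small
    diagonal entries after them ([triangular_section]). By (S) a small change of the diagonal makes
    it nonzero, without repetition and symmetric. Such a matrix is an invertible commutator of
    idempotents ([trig_commutator]), and invertibility lets the idempotents extend from the span to
    the whole space ([perturbed_section_commutator]).

    Both directions rest on the splitting of [K] into a triangular matrix and a tail without
    eigenvalues of modulus at least [d], whose powers decay faster than those of [d]
    ([tail_powers]). *)

Section RealNorm.
Context (R : realType).
Implicit Types (V : normedZmodType R[i]) (a b : R[i]).

(** Norms take values in the partially ordered field [R[i]]; their real parts live in [R], where
    [lra] and [nra] apply. *)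
Definition rn V (x : V) : R := complex.Re `|x|.

Lemma rnE V (x : V) : `|x| = (rn x)%:C.
Proof. by rewrite /rn RRe_real // normr_real. Qed.

Lemma le_rn V (x : V) (c : R) : (`|x| <= c%:C) = (rn x <= c).
Proof. by rewrite rnE lecR. Qed.

Lemma lt_rn V (x : V) (c : R) : (`|x| < c%:C) = (rn x < c).
Proof. by rewrite rnE ltcR. Qed.

Lemma rn_ge0 V (x : V) : 0 <= rn x.
Proof. by rewrite -ler0c -rnE normr_ge0. Qed.

Lemma rn_eq0 V (x : V) : (rn x == 0) = (x == 0).
Proof. by rewrite -(normr_eq0 x) rnE -(inj_eq (@complexI R)). Qed.

Lemma rn_gt0 V (x : V) : (0 < rn x) = (x != 0).
Proof. by rewrite lt_def rn_eq0 rn_ge0 andbT. Qed.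

Lemma rn0 V : rn (0 : V) = 0.
Proof. by apply/eqP; rewrite rn_eq0. Qed.

Lemma rnN V (x : V) : rn (- x) = rn x.
Proof. by rewrite /rn normrN. Qed.

Lemma rnD V (x y : V) : rn (x + y) <= rn x + rn y.
Proof. by rewrite -lecR rmorphD /= -!rnE ler_normD. Qed.

Lemma rnB V (x y : V) : rn (x - y) <= rn x + rn y.
Proof. by rewrite -(rnN y) rnD. Qed.

Lemma rnBC V (x y : V) : rn (x - y) = rn (y - x).
Proof. by rewrite -rnN opprB. Qed.

Lemma rn_sub_le V (x y : V) : rn x - rn y <= rn (x - y).
Proof. by rewrite lerBlDr; apply: le_trans (rnD _ _); rewrite subrK. Qed.

Lemma rn_dist_tri V (x y z : V) : rn (x - z) <= rn (x - y) + rn (y - z).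
Proof. by apply: le_trans (rnD _ _); rewrite addrA subrK. Qed.

Lemma rn_sum V I (r : seq I) (P : pred I) (F : I -> V) :
  rn (\sum_(i <- r | P i) F i) <= \sum_(i <- r | P i) rn (F i).
Proof.
elim/big_ind2: _ => [|x1 x2 y1 y2 h1 h2|i _]; rewrite ?rn0 //.
by apply: le_trans (rnD _ _) (lerD h1 h2).
Qed.

Lemma rnM a b : rn (a * b) = rn a * rn b.
Proof. by apply: (@complexI R); rewrite rmorphM /= -!rnE normrM. Qed.

Lemma rn1 : rn (1 : R[i]) = 1.
Proof. by apply: (@complexI R); rewrite -rnE normr1. Qed.

Lemma rnX a n : rn (a ^+ n) = rn a ^+ n.
Proof. by apply: (@complexI R); rewrite rmorphXn /= -!rnE normrX. Qed.

Lemma rnV a : rn (a^-1) = (rn a)^-1.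
Proof. by apply: (@complexI R); rewrite fmorphV /= -!rnE normfV. Qed.

Lemma rn_real (c : R) : rn (c%:C) = `|c|.
Proof.
apply: (@complexI R); rewrite -rnE.
by rewrite normc_def /= expr0n addr0 sqrtr_sqr.
Qed.

Lemma rn_nat n : rn (n%:R : R[i]) = n%:R.
Proof. by rewrite -(rmorph_nat (@real_complex_def R (Phant R))) rn_real normr_nat. Qed.

Lemma rn_conj a : rn (a^*) = rn a.
Proof. by rewrite /rn norm_conjC. Qed.

Lemma normRe_le_rn a : `|complex.Re a| <= rn a.
Proof.
rewrite /rn normc_def /= -sqrtr_sqr.
by rewrite ler_wsqrtr // lerDl sqr_ge0.
Qed.

Lemma normIm_le_rn a : `|complex.Im a| <= rn a.
Proof.
rewrite /rn normc_def /= -sqrtr_sqr.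
by rewrite ler_wsqrtr // lerDr sqr_ge0.
Qed.

Lemma rn_le_ReIm a : rn a <= `|complex.Re a| + `|complex.Im a|.
Proof.
rewrite [a in rn a]complexE; apply: le_trans (rnD _ _) _.
rewrite rnM !rn_real /= lerD2l.
suff -> : rn ('i%C : R[i]) = 1 by rewrite mul1r.
by rewrite /rn normc_def /= expr0n expr1n add0r sqrtr1.
Qed.

Lemma rnZ (V : normedModType R[i]) a (x : V) : rn (a *: x) = rn a * rn x.
Proof. by apply: (@complexI R); rewrite rmorphM /= -!rnE normrZ. Qed.

End RealNorm.

Section LinearProp.
Context (K : pzRingType) (V W : lmodType K) (T : V -> W) (hT : linear T).

(** Operators are bare functions with linearity as a hypothesis; packing them on demand gives access
    to the library of linear maps. *)
Definition lin_pack : {linear V -> W} :=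
  HB.pack T (GRing.isLinear.Build _ _ _ _ T hT).

Lemma linD x y : T (x + y) = T x + T y. Proof. exact: (linearD lin_pack). Qed.
Lemma linB x y : T (x - y) = T x - T y. Proof. exact: (linearB lin_pack). Qed.
Lemma linN x : T (- x) = - T x. Proof. exact: (linearN lin_pack). Qed.
Lemma lin0 : T 0 = 0. Proof. exact: (linear0 lin_pack). Qed.
Lemma linZ a x : T (a *: x) = a *: T x. Proof. exact: (linearZ_LR lin_pack). Qed.
Lemma lin_sum I (r : seq I) (P : pred I) (F : I -> V) :
  T (\sum_(i <- r | P i) F i) = \sum_(i <- r | P i) T (F i).
Proof. exact: (linear_sum lin_pack). Qed.
End LinearProp.

(** * Bounded linear maps with explicit constants *)

Section Bounded.
Context (R : realType).
Implicit Types V W X : normedModType R[i].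

Definition bdd V W (T : V -> W) : Prop :=
  linear T /\ exists2 c : R, 0 <= c & forall x, rn (T x) <= c * rn x.

Lemma bdd_lin V W (T : V -> W) : bdd T -> linear T.
Proof. by case. Qed.

Lemma bddP V W (T : V -> W) : bdd T <-> linear T /\ continuous T.
Proof.
split=> [[lT [c c0 hc]]|[lT cT]]; split=> //.
  apply/(@linear_bounded_continuous _ _ _ (lin_pack lT))/(linear_boundedP (lin_pack lT)).
  exists c%:C; split; first by rewrite complex_real.
  move=> r cr x /=; rewrite !rnE.
  apply: (@le_trans _ _ (c * rn x)%:C); first by rewrite lecR.
  by rewrite rmorphM /= ler_wpM2r ?lecR ?rn_ge0 // ltW.
have /linear_bounded_continuous/linear_boundedP := cT : continuous (lin_pack lT).
move=> /pinfty_ex_gt0 [M M0 hM].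
exists (rn M); first exact: rn_ge0.
by move=> x; rewrite -lecR rmorphM /= -!rnE ger0_norm ?(ltW M0) //.
Qed.

Lemma bdd_id V : bdd (@id V).
Proof. by split=> //; exists 1 => // x; rewrite mul1r. Qed.

Lemma bdd_comp V W X (S : W -> X) (T : V -> W) :
  bdd S -> bdd T -> bdd (S \o T).
Proof.
move=> [lS [c c0 hc]] [lT [d d0 hd]]; split.
  by move=> a u v /=; rewrite lT lS.
exists (c * d); first exact: mulr_ge0.
by move=> x /=; apply: le_trans (hc _) _; rewrite -mulrA ler_wpM2l.
Qed.

Lemma bdd_add V W (S T : V -> W) : bdd S -> bdd T -> bdd (S \+ T).
Proof.
move=> [lS [c c0 hc]] [lT [d d0 hd]]; split.
  by move=> a u v /=; rewrite lT lS scalerDr addrACA.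
exists (c + d); first exact: addr_ge0.
by move=> x /=; apply: le_trans (rnD _ _) _; rewrite mulrDl lerD.
Qed.

Lemma bdd_scale V W a (T : V -> W) : bdd T -> bdd (fun x => a *: T x).
Proof.
move=> [lT [d d0 hd]]; split.
  by move=> b u v /=; rewrite lT scalerDr !scalerA mulrC.
exists (rn a * d); first by rewrite mulr_ge0 // rn_ge0.
by move=> x /=; rewrite rnZ -mulrA ler_wpM2l // rn_ge0.
Qed.

Lemma bdd_opp V W (T : V -> W) : bdd T -> bdd (fun x => - T x).
Proof.
move=> /(bdd_scale (-1)).
by congr bdd; apply/funext => x; rewrite scaleN1r.
Qed.

Lemma bdd_sub V W (S T : V -> W) : bdd S -> bdd T -> bdd (S \- T).
Proof. by move=> hS /bdd_opp hT; exact: bdd_add. Qed.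

Lemma bdd0 V W : bdd (fun _ : V => 0 : W).
Proof.
split; first by move=> a u v; rewrite scaler0 add0r.
by exists 0 => // x; rewrite rn0 mul0r.
Qed.

Lemma bdd_sum V W I (r : seq I) (T : I -> V -> W) :
  (forall i, bdd (T i)) -> bdd (fun x => \sum_(i <- r) T i x).
Proof.
move=> hT; elim: r => [|i r IH].
  by under eq_fun do rewrite big_nil; exact: bdd0.
by under eq_fun do rewrite big_cons; exact: bdd_add.
Qed.

Lemma bdd_rank1 V W (f : V -> R[i]^o) (b : W) :
  bdd f -> bdd (fun x => f x *: b).
Proof.
move=> [lf [c c0 hc]]; split; first by move=> a u v; rewrite lf scalerDl -scalerA.
exists (c * rn b); first by rewrite mulr_ge0 // rn_ge0.
by move=> x; rewrite rnZ mulrAC ler_wpM2r // rn_ge0.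
Qed.

Lemma bdd_iter V (T : V -> V) n : bdd T -> bdd (iter n T).
Proof.
by move=> hT; elim: n => [|n IH]; [exact: bdd_id | exact: (bdd_comp hT IH)].
Qed.

Lemma bdd_gt0 V W (T : V -> W) : bdd T ->
  exists2 c : R, 0 < c & forall x, rn (T x) <= c * rn x.
Proof.
move=> [_ [c c0 hc]]; exists (c + 1); first by rewrite ltr_wpDl.
by move=> x; apply: le_trans (hc x) _; rewrite ler_wpM2r ?rn_ge0 // lerDl.
Qed.

End Bounded.

(** * Hilbert space geometry *)

Section Hilbert.
Context (R : realType) (H : completeNormedModType R[i]).
Context (ip : {dot H for (@Num.conj R[i])}).
Context (ip_norm : forall x : H, ip x x = `|x| ^+ 2).
Implicit Types (x y z : H) (a : R[i]).

Lemma ipC x y : ip x y = (ip y x)^*.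
Proof. by rewrite hermC /= expr0 mul1r. Qed.
Lemma ipDl x y z : ip (x + y) z = ip x z + ip y z. Proof. exact: linearDl. Qed.
Lemma ipBl x y z : ip (x - y) z = ip x z - ip y z. Proof. exact: linearBl. Qed.
Lemma ipNl x y : ip (- x) y = - ip x y. Proof. exact: linearNl. Qed.
Lemma ipZl a x y : ip (a *: x) y = a * ip x y. Proof. exact: linearZl_LR. Qed.
Lemma ip0l x : ip 0 x = 0. Proof. exact: linear0l. Qed.
Lemma ip_suml I (r : seq I) (P : pred I) (F : I -> H) y :
  ip (\sum_(i <- r | P i) F i) y = \sum_(i <- r | P i) ip (F i) y.
Proof. exact: linear_sumlz. Qed.
Lemma ipDr x y z : ip x (y + z) = ip x y + ip x z. Proof. exact: linearDr. Qed.
Lemma ipBr x y z : ip x (y - z) = ip x y - ip x z. Proof. exact: linearBr. Qed.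
Lemma ipNr x y : ip x (- y) = - ip x y. Proof. exact: linearNr. Qed.
Lemma ipZr a x y : ip x (a *: y) = a^* * ip x y. Proof. exact: linearZr_LR. Qed.
Lemma ip0r x : ip x 0 = 0. Proof. exact: linear0r. Qed.
Lemma ip_sumr I (r : seq I) (P : pred I) (F : I -> H) y :
  ip y (\sum_(i <- r | P i) F i) = \sum_(i <- r | P i) ip y (F i).
Proof. exact: linear_sumr. Qed.

Lemma ip_sq x : ip x x = (rn x ^+ 2)%:C.
Proof. by rewrite ip_norm rnE rmorphXn. Qed.

Lemma ip_eq0C x y : ip x y = 0 -> ip y x = 0.
Proof. by rewrite ipC => h; rewrite -[ip y x]conjCK h conjC0. Qed.

Lemma pythagoras x y : ip x y = 0 -> rn (x + y) ^+ 2 = rn x ^+ 2 + rn y ^+ 2.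
Proof.
move=> h; apply: (@complexI R); rewrite rmorphD /= -!ip_sq ipDl !ipDr h.
by rewrite (ip_eq0C h) addr0 add0r.
Qed.

Lemma parallelogram x y :
  rn (x + y) ^+ 2 + rn (x - y) ^+ 2 = 2 * rn x ^+ 2 + 2 * rn y ^+ 2.
Proof.
apply: (@complexI R); rewrite !rmorphD !(rmorphM _ 2) /= -!ip_sq.
rewrite !ipDl !ipDr !ipNl !ipNr rmorph_nat; ring.
Qed.

Lemma ip_project x y : y != 0 -> ip (x - (ip x y / ip y y) *: y) y = 0.
Proof.
by move=> y0; rewrite ipBl ipZl divfK ?subrr // ip_norm expf_eq0 normr_eq0.
Qed.

Lemma cauchy_schwarz x y : rn (ip x y) <= rn x * rn y.
Proof.
have [->|y0] := eqVneq y 0; first by rewrite ip0r !rn0 mulr0.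
have yp : 0 < rn y by rewrite rn_gt0.
set a := ip x y / ip y y.
have h : rn x ^+ 2 = rn (x - a *: y) ^+ 2 + rn (a *: y) ^+ 2.
  rewrite -pythagoras ?subrK // ipZr.
  by rewrite (ip_project x y0) mulr0.
have ha : rn a = rn (ip x y) / rn y ^+ 2.
  by rewrite rnM rnV ip_sq rn_real ger0_norm // sqr_ge0.
rewrite -(ler_pXn2r (_ : (0 < 2)%N)) ?nnegrE ?mulr_ge0 ?rn_ge0 // exprMn.
rewrite -ler_pdivrMr ?exprn_gt0 // h rnZ ha exprMn.
have -> : (rn (ip x y) / rn y ^+ 2) ^+ 2 * rn y ^+ 2 = rn (ip x y) ^+ 2 / rn y ^+ 2.
  by field; rewrite gt_eqF.
by rewrite lerDr sqr_ge0.
Qed.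

Lemma ip_all0 y : (forall x, ip x y = 0) -> y = 0.
Proof.
move=> /(_ y); rewrite ip_norm => /eqP.
by rewrite expf_eq0 normr_eq0 /= => /eqP.
Qed.

Lemma ip_inj x y : (forall z, ip x z = ip y z) -> x = y.
Proof.
move=> h; apply/eqP; rewrite -subr_eq0; apply/eqP/ip_all0 => z.
by rewrite ipC ipBl h subrr conjC0.
Qed.

Lemma bdd_ip y : bdd (fun x => ip x y : R[i]^o).
Proof.
split; first by move=> a u v; rewrite ipDl ipZl.
exists (rn y); first exact: rn_ge0.
by move=> x; rewrite mulrC cauchy_schwarz.
Qed.

Lemma complete_seq (u : nat -> H) :
  (forall e : R, 0 < e ->
     exists N, forall m n, (N <= m)%N -> (N <= n)%N -> rn (u m - u n) < e) ->
  exists l, forall e : R, 0 < e ->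
     exists N, forall n, (N <= n)%N -> rn (u n - l) < e.
Proof.
move=> hu.
have cu : cvg (u @ \oo).
  apply/cauchy_cvgP; apply: cauchy_exP => e e0.
  have er : e = (complex.Re e)%:C by rewrite RRe_real // gtr0_real.
  have [|N hN] := hu (complex.Re e); first by rewrite -ltcR -er.
  exists (u N); exists N => //= n /= Nn.
  by rewrite -ball_normE /= er lt_rn hN.
exists (lim (u @ \oo)) => e e0.
have /cvgrPdist_lt/(_ e%:C) := cu.
rewrite ltcR => /(_ e0) [N _ hN]; exists N => n Nn.
by rewrite rnBC -lt_rn; exact: hN.
Qed.

Lemma rn_le_lim (l : H) (c : R) :
  (forall e : R, 0 < e -> exists2 x : H, rn (x - l) < e & rn x <= c + e) -> rn l <= c.
Proof.
move=> h; rewrite leNgt; apply/negP => cl.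
have [|x h1 h2] := h ((rn l - c) / 2); first by rewrite divr_gt0 ?subr_gt0.
have := rn_sub_le l x; rewrite rnBC; lra.
Qed.

(** Partial sums of the Neumann series form a Cauchy sequence. Only solvability is recorded;
    injectivity comes from lower bounds where it is used. *)
Lemma neumann (S : H -> H) (q : R) : linear S -> 0 <= q -> q < 1 ->
  (forall x, rn (S x) <= q * rn x) -> forall y, exists x, x - S x = y.
Proof.
move=> lS q0 q1 hS y.
pose u := fix u n := if n is n'.+1 then y + S (u n') else 0.
have du n : rn (u n.+1 - u n) <= q ^+ n * rn y.
  elim: n => [|n IH]; first by rewrite /= (lin0 lS) addr0 subr0 expr0 mul1r.
  rewrite [u n.+2]/= [X in _ - X]/= opprD addrACA subrr add0r -(linB lS).
  by apply: le_trans (hS _) _; rewrite exprS -mulrA ler_wpM2l.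
have q1' : 0 < 1 - q by rewrite subr_gt0.
have dist m n : rn (u (m + n)%N - u m) <= q ^+ m * (rn y / (1 - q)).
  (* The extra factor [1 - q ^+ n], from the finite geometric sum, is what makes the induction on
     [n] close. *)
  suff : rn (u (m + n)%N - u m) <= q ^+ m * (rn y / (1 - q)) * (1 - q ^+ n).
    move/le_trans; apply; rewrite ler_piMr ?lerBlDr ?lerDl ?exprn_ge0 //.
    by rewrite !mulr_ge0 ?exprn_ge0 ?rn_ge0 // invr_ge0 ltW.
  elim: n => [|n IH]; first by rewrite addn0 subrr rn0 expr0 subrr mulr0.
  apply: le_trans (rn_dist_tri _ (u (m + n)%N) _) _; rewrite addnS.
  apply: le_trans (lerD (du _) IH) _.
  rewrite exprD exprS.
  have -> : q ^+ m * q ^+ n * rn y = q ^+ m * (rn y / (1 - q)) * (q ^+ n * (1 - q)).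
    by field; rewrite gt_eqF.
  rewrite -mulrDr ler_wpM2l //; last lra.
  by rewrite !mulr_ge0 ?exprn_ge0 ?rn_ge0 // invr_ge0 ltW.
have small (e : R) : 0 < e -> exists N, forall n, (N <= n)%N ->
    q ^+ n * (rn y / (1 - q)) < e.
  move=> e0; set c := rn y / (1 - q).
  have c0 : 0 <= c by rewrite /c mulr_ge0 ?rn_ge0 // invr_ge0 ltW.
  have : (fun n => q ^+ n * c) @ \oo --> (0 * c : R).
    by apply: cvgMl; apply: cvg_expr; rewrite ger0_norm.
  rewrite mul0r => /cvgrPdist_lt/(_ e e0) [N _ hN]; exists N => n Nn.
  have := hN n Nn; rewrite /= sub0r normrN; apply: le_lt_trans.
  exact: ler_norm.
have [l hl] : exists l, forall e : R, 0 < e ->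
     exists N, forall n, (N <= n)%N -> rn (u n - l) < e.
  apply: complete_seq => e e0; have [|N hN] := small (e / 2); first by rewrite divr_gt0.
  exists N => m n Nm Nn.
  apply: le_lt_trans (rn_dist_tri _ (u N) _) _; rewrite [e]splitr.
  apply: ltrD; first by rewrite -(subnKC Nm); apply: le_lt_trans (dist _ _) (hN _ _).
  by rewrite rnBC -(subnKC Nn); apply: le_lt_trans (dist _ _) (hN _ _).
exists l; apply/eqP; rewrite -subr_eq0 -rn_eq0 eq_le rn_ge0 andbT leNgt.
apply/negP => h0; have [|N hN] := hl (rn (l - S l - y) / 2); first by rewrite divr_gt0.
have h1 := hN N (leqnn N); have h2 := hN N.+1 (leqnSn N).
have : rn (l - S l - y) <= rn (u N.+1 - l) + rn (u N - l).
  rewrite -(rnN (u N.+1 - l)).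
  have -> : l - S l - y = - (u N.+1 - l) + S (u N - l).
    rewrite /= (linB lS) opprB opprD !addrA subrK.
    by rewrite addrAC.
  apply: le_trans (rnD _ _) _; rewrite lerD2l.
  by apply: le_trans (hS _) _; rewrite ler_piMl ?rn_ge0 // ltW.
lra.
Qed.
End Hilbert.

(** * The Riesz representation theorem and adjoints *)

Section Riesz.
Context (R : realType) (H : completeNormedModType R[i]).
Context (ip : {dot H for (@Num.conj R[i])}).
Context (ip_norm : forall x : H, ip x x = `|x| ^+ 2).
Implicit Types (x y z : H) (a : R[i]).

(** A norm-minimizing sequence in the hyperplane [f = 1] is Cauchy by the parallelogram law, because
    midpoints stay in the hyperplane and so have norm at least the infimum [d]. *)
Lemma riesz_minimizer (f : H -> R[i]^o) : bdd f -> (exists x, f x != 0) ->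
  exists v, f v = 1 /\ forall x, f x = 1 -> rn v <= rn x.
Proof.
move=> bf [x0 fx0]; have lf := bdd_lin bf; have [c c0 hc] := bdd_gt0 bf.
pose A := [set rn x | x in [set x | f x = 1]].
have A0 : A !=set0.
  by exists (rn ((f x0)^-1 *: x0)), ((f x0)^-1 *: x0) => //=; rewrite (linZ lf) /GRing.scale /= mulVf.
have lbA : has_inf A by split=> //; exists 0 => _ [x _ <-]; exact: rn_ge0.
set d := inf A.
have dA x : f x = 1 -> d <= rn x by move=> fx; apply: ge_inf; [case: lbA | exists x].
have d0 : 0 <= d by apply: lb_le_inf => // _ [x _ <-]; exact: rn_ge0.
have near_inf n : exists x, f x = 1 /\ rn x < d + n.+1%:R^-1.
  have [|_ [x fx <-] hx] := @inf_adherent _ A n.+1%:R^-1 _ lbA; first by rewrite invr_gt0.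
  by exists x.
have [u hu] := choice near_inf.
have fu n : f (u n) = 1 by case: (hu n).
have ru n : rn (u n) < d + n.+1%:R^-1 by case: (hu n).
have sqd N n : (N <= n)%N -> rn (u n) ^+ 2 <= d ^+ 2 + (2 * d + 1) / N.+1%:R.
  move=> Nn; set t : R := N.+1%:R^-1.
  have t0 : 0 < t by rewrite invr_gt0.
  have t1 : t <= 1 by rewrite invf_le1 // ler1n.
  have h : rn (u n) <= d + t.
    by apply: le_trans (ltW (ru n)) _; rewrite lerD2l lef_pV2 ?posrE // ler_nat.
  have : rn (u n) ^+ 2 <= (d + t) ^+ 2 by rewrite lerXn2r ?nnegrE ?rn_ge0 ?addr_ge0 // ltW.
  move/le_trans; apply; nra.
have dist N m n : (N <= m)%N -> (N <= n)%N ->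
    rn (u m - u n) ^+ 2 <= 4 * (2 * d + 1) / N.+1%:R.
  move=> Nm Nn; have h := parallelogram ip_norm (u m) (u n).
  have h4 : 4 * d ^+ 2 <= rn (u m + u n) ^+ 2.
    have /dA : f (2^-1 *: (u m + u n)) = 1.
      by rewrite (linZ lf) (linD lf) !fu /GRing.scale /=; field.
    rewrite rnZ rnV (_ : rn 2 = 2); last exact: rn_nat.
    move=> hd; have : 2 * d <= rn (u m + u n) by lra.
    have -> : 4 * d ^+ 2 = (2 * d) ^+ 2 by ring.
    by move=> h2; rewrite lerXn2r // ?nnegrE ?rn_ge0 // mulr_ge0.
  have := sqd _ _ Nm; have := sqd _ _ Nn.
  move: h h4; set A1 := rn _ ^+ 2; set A2 := rn _ ^+ 2; set A3 := rn _ ^+ 2.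
  set A4 := rn _ ^+ 2; set t := _^-1; set d2 := d ^+ 2. lra.
have arch (e : R) : 0 < e -> exists N, 4 * (2 * d + 1) / N.+1%:R < e.
  move=> e0; exists (Num.truncn (4 * (2 * d + 1) / e)).
  by rewrite ltr_pdivrMr // -ltr_pdivrMl // [_^-1 * _]mulrC truncnS_gt.
have [l hl] : exists l, forall e : R, 0 < e ->
     exists N, forall n, (N <= n)%N -> rn (u n - l) < e.
  apply: complete_seq => e e0.
  have [|N hN] := arch (e ^+ 2); first by rewrite exprn_gt0.
  exists N => m n Nm Nn; rewrite -(ltr_pXn2r (_ : (0 < 2)%N)) ?nnegrE ?rn_ge0 ?ltW //.
  exact: le_lt_trans (dist _ _ _ Nm Nn) hN.
exists l; split.
  apply/eqP; rewrite -subr_eq0 -rn_eq0 eq_le rn_ge0 andbT leNgt; apply/negP => h0.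
  have [|N hN] := hl (rn (f l - 1 : R[i]^o) / c); first by rewrite divr_gt0.
  have := hN N (leqnn N); rewrite ltr_pdivlMr // ltNge => /negP; apply.
  by rewrite rnBC mulrC -(fu N) -(linB lf).
move=> x fx; apply: le_trans (dA _ fx).
apply: rn_le_lim => e e0.
have [N hN] := hl e e0.
have [M hM] : exists M, forall n, (M <= n)%N -> n.+1%:R^-1 < e.
  exists (Num.truncn e^-1) => n Mn.
  rewrite -ltf_pV2 ?posrE ?invr_gt0 // invrK; apply: lt_le_trans (truncnS_gt _) _.
  by rewrite ler_nat ltnS.
exists (u (maxn M N)); first by apply: hN; rewrite leq_maxr.
apply: ltW; apply: lt_trans (ru _) _; rewrite ltrD2l; apply: hM; exact: leq_maxl.
Qed.

(** The shortest vector [v] with [f v = 1] is orthogonal to the kernel of [f]: otherwise subtracting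
    a projection onto a kernel vector would shorten it. *)
Lemma riesz_representation (f : H -> R[i]^o) : bdd f ->
  exists z, forall x, f x = ip x z.
Proof.
move=> bf; have lf := bdd_lin bf.
have [[x0 fx0]|h0] := pselect (exists x, f x != 0); last first.
  exists 0 => x; rewrite ip0r; apply/eqP/negPn/negP => h.
  by apply: h0; exists x.
have [v [fv1 vmin]] := riesz_minimizer bf (ex_intro (fun x => f x != 0) _ fx0).
have v0 : v != 0.
  by apply/eqP => v0; move/eqP: fv1; rewrite v0 (lin0 lf) eq_sym oner_eq0.
have orth w : f w = 0 -> ip w v = 0.
  move=> fw; have [->|w0] := eqVneq w 0; first exact: ip0l.
  set a := ip v w / ip w w; apply: ip_eq0C.
  have hu : ip (v - a *: w) (a *: w) = 0 by rewrite ipZr ip_project ?mulr0.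
  have hp := pythagoras ip_norm hu; rewrite subrK in hp.
  have : rn v <= rn (v - a *: w) by apply: vmin; rewrite (linB lf) (linZ lf) fw scaler0 subr0.
  move=> hv; have : rn v ^+ 2 <= rn (v - a *: w) ^+ 2 by rewrite lerXn2r ?nnegrE ?rn_ge0.
  rewrite hp gerDl => h; have : rn (a *: w) ^+ 2 == 0 by rewrite eq_le h sqr_ge0.
  rewrite expf_eq0 /= rn_eq0 scaler_eq0 (negPf w0) orbF mulf_eq0 invr_eq0.
  by rewrite ip_norm expf_eq0 normr_eq0 (negPf w0) orbF => /eqP.
have vv0 : ip v v != 0 by rewrite ip_norm expf_eq0 normr_eq0.
exists ((ip v v)^-1 *: v) => x.
have /orth : f (x - f x *: v) = 0.
  by rewrite (linB lf) (linZ lf) fv1 /GRing.scale /= mulr1 subrr.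
rewrite ipBl ipZl => /eqP; rewrite subr_eq0 => /eqP h.
by rewrite ipZr h fmorphV /= -(ipC ip v v) mulrCA mulVf ?mulr1.
Qed.

Lemma adjoint_exists (T : H -> H) : bdd T ->
  exists S, forall x y, ip (T x) y = ip x (S y).
Proof.
move=> bT; suff /choice [S hS] : forall y, exists z, forall x, ip (T x) y = ip x z.
  by exists S => x y; exact: hS.
move=> y; apply: (@riesz_representation (fun x => ip (T x) y)).
exact: (bdd_comp (bdd_ip ip_norm y) bT).
Qed.

Lemma adjointP (T : H -> H) x y : bdd T -> ip (T x) y = ip x (adjoint ip T y).
Proof.
move=> /adjoint_exists [S hS].
have /getPex : [set z | forall x, ip (T x) y = ip x z] !=set0.
  by exists (S y) => w; exact: hS.
exact.
Qed.

Lemma adjoint_kernelE (T : H -> H) y : bdd T ->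
  op_kernel (adjoint ip T) y <-> forall x, ip (T x) y = 0.
Proof.
move=> bT; split=> [h x|h]; first by rewrite adjointP // h ip0r.
by apply: (ip_all0 ip_norm) => x; rewrite -adjointP.
Qed.

Lemma bdd_adjoint (T S : H -> H) : bdd T ->
  (forall x y, ip (T x) y = ip x (S y)) -> bdd S.
Proof.
move=> bT hS; have [c c0 hc] := bdd_gt0 bT.
have inj x y : (forall z, ip z x = ip z y) -> x = y.
  move=> h; apply/eqP; rewrite -subr_eq0; apply/eqP/(ip_all0 ip_norm) => z.
  by rewrite ipBr h subrr.
split.
  move=> a u v; apply: inj => z.
  by rewrite -hS !ipDr !ipZr !hS.
exists c; first exact: ltW.
move=> y; have [->|Sy0] := eqVneq (S y) 0; first by rewrite rn0 mulr_ge0 ?rn_ge0 ?ltW.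
rewrite -(ler_pM2r (_ : 0 < rn (S y))) ?rn_gt0 // -expr2.
have -> : rn (S y) ^+ 2 = rn (ip (T (S y)) y).
  by rewrite hS ip_norm rnX /rn normr_id.
apply: le_trans (cauchy_schwarz ip_norm _ _) _.
by rewrite mulrAC ler_wpM2r ?rn_ge0.
Qed.

End Riesz.

(** * Orthonormal families and orthogonal projections onto their spans *)

Section Orthonormal.
Context (R : realType) (H : completeNormedModType R[i]).
Context (ip : {dot H for (@Num.conj R[i])}).
Context (ip_norm : forall x : H, ip x x = `|x| ^+ 2).
Implicit Types (x y z : H) (a : R[i]) (n : nat) (e f : nat -> H).

(** A family is a sequence of which only the first [n] terms matter, so that extending it changes
    neither its type nor its indices. *)
Definition orthonormal_family n e :=
  forall i j, (i < n)%N -> (j < n)%N -> ip (e i) (e j) = (i == j)%:R.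

Lemma orthonormal_family0 e : orthonormal_family 0 e. Proof. by []. Qed.

Definition comb n e (u : 'rV[R[i]]_n) : H := \sum_(i < n) u 0 i *: e i.
Definition coords n e x : 'rV[R[i]]_n := \row_i ip x (e i).
Definition oproj n e x : H := comb e (coords n e x).

Lemma comb_lin n e : linear (@comb n e).
Proof.
move=> a u v; rewrite /comb scaler_sumr -big_split /=; apply: eq_bigr => i _.
by rewrite !mxE scalerDl scalerA.
Qed.

Lemma coords_lin n e : linear (coords n e).
Proof. by move=> a u v; apply/rowP => i; rewrite !mxE ipDl ipZl. Qed.

Lemma ip_comb n e (u : 'rV_n) j : orthonormal_family n e -> 
  ip (comb e u) (e j) = \sum_(i < n) u 0 i * ip (e i) (e j).
Proof. by move=> he; rewrite ip_suml; apply: eq_bigr => i _; rewrite ipZl. Qed.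

Lemma coords_comb n e (u : 'rV_n) : orthonormal_family n e -> coords n e (comb e u) = u.
Proof.
move=> he; apply/rowP => j; rewrite mxE ip_comb // (bigD1 j) //= he // eqxx mulr1.
rewrite big1 ?addr0 // => i ij; rewrite he //.
by rewrite (_ : (_ == _) = false) ?mulr0 //; apply/negbTE.
Qed.

Lemma comb_delta n e (i : 'I_n) : comb e (delta_mx 0 i) = e i.
Proof.
rewrite /comb (bigD1 i) //= mxE !eqxx scale1r big1 ?addr0 // => j ji.
by rewrite mxE (negPf ji) andbF scale0r.
Qed.

Lemma oproj_comb n e (u : 'rV_n) : orthonormal_family n e -> oproj n e (comb e u) = comb e u.
Proof. by move=> he; rewrite /oproj coords_comb. Qed.

Lemma oproj_basis n e i : orthonormal_family n e -> (i < n)%N -> oproj n e (e i) = e i.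
Proof. by move=> he hi; rewrite -[in LHS](comb_delta e (Ordinal hi)) oproj_comb // comb_delta. Qed.

Lemma oprojE n e x : oproj n e x = \sum_(i < n) ip x (e i) *: e i.
Proof. by apply: eq_bigr => i _; rewrite mxE. Qed.

Lemma ip_sub_oproj n e x j : orthonormal_family n e -> (j < n)%N ->
  ip (x - oproj n e x) (e j) = 0.
Proof.
move=> he hj; have := coords_comb (coords n e x) he.
by move/rowP/(_ (Ordinal hj)); rewrite !mxE ipBl => ->; rewrite subrr.
Qed.

Lemma ip_orth_comb n e (u : 'rV_n) x :
  (forall j, (j < n)%N -> ip x (e j) = 0) -> ip x (comb e u) = 0.
Proof. by move=> hx; rewrite ip_sumr big1 // => i _; rewrite ipZr hx ?mulr0. Qed.

Lemma bdd_oproj n e : bdd (oproj n e).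
Proof.
have -> : oproj n e = fun x => \sum_(i < n) ip x (e i) *: e i by apply/funext => x; exact: oprojE.
by apply: bdd_sum => i; apply: bdd_rank1; exact: bdd_ip.
Qed.

Lemma oprojK n e x : orthonormal_family n e -> oproj n e (oproj n e x) = oproj n e x.
Proof. by move=> he; rewrite {2}/oproj oproj_comb. Qed.

Lemma rn_oproj_sq n e x : orthonormal_family n e ->
  rn x ^+ 2 = rn (x - oproj n e x) ^+ 2 + rn (oproj n e x) ^+ 2.
Proof.
move=> he; rewrite -(pythagoras ip_norm) ?subrK //.
by apply: (@ip_orth_comb n e (coords n e x)) => j hj; exact: ip_sub_oproj.
Qed.

Lemma rn_oproj n e x : orthonormal_family n e -> rn (oproj n e x) <= rn x.
Proof.
move=> he; rewrite -(ler_pXn2r (_ : (0 < 2)%N)) ?nnegrE ?rn_ge0 //.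
by rewrite (rn_oproj_sq x he) lerDr sqr_ge0.
Qed.

Lemma rn_sub_oproj n e x : orthonormal_family n e -> rn (x - oproj n e x) <= rn x.
Proof.
move=> he; rewrite -(ler_pXn2r (_ : (0 < 2)%N)) ?nnegrE ?rn_ge0 //.
by rewrite (rn_oproj_sq x he) lerDl sqr_ge0.
Qed.

Lemma oproj_best n e x (u : 'rV_n) : orthonormal_family n e ->
  rn (x - oproj n e x) <= rn (x - comb e u).
Proof.
move=> he; rewrite -(ler_pXn2r (_ : (0 < 2)%N)) ?nnegrE ?rn_ge0 //.
have -> : x - comb e u = (x - oproj n e x) + (comb e (coords n e x - u)).
  by rewrite (linB (@comb_lin n e)) addrA subrK.
rewrite [leRHS](pythagoras ip_norm) ?lerDl ?sqr_ge0 //.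
by apply: ip_orth_comb => j hj; exact: ip_sub_oproj.
Qed.

Lemma rn_comb_sq n e (u : 'rV_n) : orthonormal_family n e ->
  rn (comb e u) ^+ 2 = \sum_(i < n) rn (u 0 i) ^+ 2.
Proof.
move=> he; apply: (@complexI R); rewrite -(ip_sq ip_norm) ip_sumr rmorph_sum /=.
apply: eq_bigr => i _; rewrite ipZr; have := coords_comb u he.
move/rowP/(_ i); rewrite mxE => ->; rewrite rmorphXn /= -rnE.
by rewrite normCK mulrC.
Qed.

Lemma orthonormal_family_rn n e i : orthonormal_family n e -> (i < n)%N -> rn (e i) = 1.
Proof.
move=> he hi; have := he i i hi hi; rewrite eqxx (ip_sq ip_norm) => /(@complexI R) h.
by apply/eqP; rewrite -(@pexpr_eq1 _ _ 2) ?rn_ge0 ?h.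
Qed.

Lemma orthonormal_rcons n e x : orthonormal_family n e -> rn x = 1 ->
  (forall j, (j < n)%N -> ip x (e j) = 0) ->
  orthonormal_family n.+1 (fun i => if i == n then x else e i).
Proof.
move=> he x1 hx i j; rewrite !ltnS /= => hi hj.
have [Ei|ni] := eqVneq i n; have [Ej|nj] := eqVneq j n.
- by rewrite Ei Ej eqxx (ip_sq ip_norm) x1 expr1n.
- by rewrite hx ?ltn_neqAle ?nj // Ei eq_sym (negPf nj).
- by rewrite (ip_eq0C (hx _ _)) ?ltn_neqAle ?ni // Ej (negPf ni).
- by rewrite he ?ltn_neqAle ?ni ?nj.
Qed.

Lemma comb_widen n m e f (u : 'rV_n) : (forall i, (i < n)%N -> f i = e i) ->
  (n <= m)%N -> exists v : 'rV_m, comb e u = comb f v.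
Proof.
move=> fe nm; rewrite -(subnKC nm).
exists (row_mx u 0); rewrite /comb big_split_ord /= [X in _ + X]big1 ?addr0.
  by apply: eq_bigr => i _; rewrite row_mxEl fe.
by move=> i _; rewrite row_mxEr mxE scale0r.
Qed.

Lemma gram_schmidt n e (s : seq H) : orthonormal_family n e ->
  exists m f, [/\ (n <= m)%N, orthonormal_family m f,
    forall i, (i < n)%N -> f i = e i &
    forall y, y \in s -> exists u : 'rV_m, y = comb f u].
Proof.
move=> he; elim: s => [|y s [m [f [nm hf fe hs]]]]; first by exists n, e.
have [y0|y0] := eqVneq (y - oproj m f y) 0.
  exists m, f; split=> // z; rewrite inE => /orP[/eqP ->|]; last exact: hs.
  by exists (coords m f y); apply/eqP; rewrite -subr_eq0 y0.
set r := y - oproj m f y in y0; set x := ((rn r)^-1)%:C *: r.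
have r0 : 0 < rn r by rewrite rn_gt0.
have x1 : rn x = 1.
  by rewrite rnZ rn_real ger0_norm ?invr_ge0 ?rn_ge0 // mulVf ?gt_eqF.
have hx j : (j < m)%N -> ip x (f j) = 0 by move=> hj; rewrite ipZl ip_sub_oproj ?mulr0.
pose g := fun i => if i == m then x else f i.
have gf i : (i < m)%N -> g i = f i by move=> hi; rewrite /g ltn_eqF.
exists m.+1, g; split; first exact: leqW.
- exact: orthonormal_rcons.
- by move=> i hi; rewrite gf ?fe // (leq_trans hi).
move=> z; rewrite inE => /orP[/eqP ->|/hs [u ->]]; last exact: comb_widen.
have [v hv] := comb_widen (coords m f y) gf (leqnSn m).
exists (v + (rn r)%:C *: delta_mx 0 ord_max).
rewrite addrC (comb_lin g) comb_delta /= {1}/g eqxx -hv /x scalerA -rmorphM /=.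
by rewrite mulfV ?gt_eqF // scale1r subrK.
Qed.

(** With [k > n] independent vectors, the [k] by [n] matrix of their inner products with [e] has a
    nonzero left kernel vector; the corresponding combination is orthogonal to [e]. *)
Lemma infinite_orthogonal n e : infinite_dimensional H -> orthonormal_family n e ->
  exists x, rn x = 1 /\ forall j, (j < n)%N -> ip x (e j) = 0.
Proof.
move=> Hinf he.
have [k [v vi nk]] : exists k, exists2 v : 'I_k -> H, lin_indep v & (n < k)%N.
  apply: contrapT => h.
  suff : (subspace_dim [set: H] <= n%:R%:E)%E by rewrite Hinf leye_eq.
  apply: ge_ereal_sup => _ [k [v vi _] <-]; rewrite lee_fin ler_nat leqNgt.
  by apply/negP => nk; apply: h; exists k, v.
pose A := \matrix_(i < k, j < n) ip (v i) (e j).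
have /rowV0Pn [a /sub_kermxP aA a0] : kermx A != 0.
  rewrite -mxrank_eq0 mxrank_ker subn_eq0 -ltnNge.
  exact: leq_ltn_trans (rank_leq_col A) nk.
pose w := \sum_(i < k) a 0 i *: v i.
have w0 : w != 0.
  apply: contra a0 => /eqP w0; apply/eqP/rowP => i.
  by rewrite mxE; apply: (vi (fun i => a 0 i)).
exists (((rn w)^-1)%:C *: w); split.
  by rewrite rnZ rn_real ger0_norm ?invr_ge0 ?rn_ge0 // mulVf // rn_eq0.
move=> j hj; rewrite ipZl ip_suml; move/rowP/(_ (Ordinal hj)): aA.
rewrite !mxE => h; rewrite (_ : \sum_i _ = 0) ?mulr0 // -[RHS]h.
by apply: eq_bigr => i _; rewrite ipZl mxE.
Qed.

End Orthonormal.

(** * Dimensions of subspaces as matrix ranks *)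

Section Dimension.
Context (R : realType) (H : completeNormedModType R[i]).

(** The bridge between the supremum in [subspace_dim] and linear algebra: an independent family in
    [V] pulls back to a row-free matrix below [A], and a row base of [A] attains the bound. *)
Lemma subspace_dim_image m n (A : 'M[R[i]]_(m, n)) (L : 'rV[R[i]]_n -> H) (V : set H) :
  linear L -> (forall u : 'rV_n, (u <= A)%MS -> L u = 0 -> u = 0) ->
  (forall x, V x <-> exists2 u : 'rV_n, (u <= A)%MS & x = L u) ->
  subspace_dim V = (\rank A)%:R%:E.
Proof.
move=> lL iL VE; apply/eqP; rewrite eq_le; apply/andP; split.
  apply: ge_ereal_sup => _ [k [v vi Vv] <-]; rewrite lee_fin ler_nat.
  have /choice [u hu] : forall i, exists u : 'rV_n, (u <= A)%MS /\ v i = L u.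
    by move=> i; have /VE [u uA vu] := Vv i; exists u.
  pose W := \matrix_i u i.
  have WA : (W <= A)%MS by apply/row_subP => i; rewrite rowK; case: (hu i).
  suff /eqP <- : row_free W by exact: mxrankS.
  apply/row_freeP; apply: contrapT => h.
  have : kermx W != 0.
    apply/negP => /eqP k0; apply: h; apply/row_freeP.
    by rewrite -kermx_eq0 k0.
  move=> /rowV0Pn [a /sub_kermxP aW /negP a0]; apply: a0.
  apply/eqP/rowP => i; rewrite mxE; apply: (vi (fun i => a 0 i)).
  transitivity (L (a *m W)); last by rewrite aW (lin0 lL).
  rewrite mulmx_sum_row (lin_sum lL); apply: eq_bigr => j _.
  by rewrite (linZ lL) rowK; case: (hu j) => _ ->.
apply: ereal_sup_ubound; exists (\rank A) => //=.
exists (fun i => L (row i (row_base A))).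
  move=> a /= sa i.
  have sb : \sum_i a i *: row i (row_base A) = (\row_i a i) *m row_base A.
    by rewrite mulmx_sum_row; apply: eq_bigr => j _; rewrite mxE.
  have : \row_i a i = 0 :> 'rV_(\rank A).
    apply: (row_free_inj (row_base_free A)); rewrite mul0mx -sb.
    apply: iL; first by rewrite sb; apply: submx_trans (submxMl _ _) _; rewrite eq_row_base.
    by rewrite (lin_sum lL) -[RHS]sa; apply: eq_bigr => j _; rewrite (linZ lL).
  by move/rowP/(_ i); rewrite !mxE.
move=> i; apply/VE; exists (row i (row_base A)) => //.
by rewrite -(eq_row_base A) row_sub.
Qed.

Lemma subspace_dim_pinfty (V : set H) :
  (forall k, exists2 v : 'I_k -> H, lin_indep v & forall i, V (v i)) ->
  subspace_dim V = +oo%E.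
Proof.
move=> h; apply/eqP; rewrite -leye_eq leNgt; apply/negP => hlt.
have [k hk] : exists k : nat, (subspace_dim V < k%:R%:E)%E.
  have ge0 : (0 <= subspace_dim V)%E.
    by apply: ereal_sup_ubound; exists 0%N => //; exact: h.
  exists (Num.truncn (fine (subspace_dim V))).+1.
  by rewrite -[ltLHS]fineK ?ge0_fin_numE // lte_fin truncnS_gt.
suff : (k%:R%:E <= subspace_dim V)%E by rewrite leNgt hk.
by apply: ereal_sup_ubound; exists k => //; exact: h.
Qed.

End Dimension.

(** * Finite-rank approximation of compact operators *)

Section Compact.
Context (R : realType) (H : completeNormedModType R[i]).
Context (ip : {dot H for (@Num.conj R[i])}).
Context (ip_norm : forall x : H, ip x x = `|x| ^+ 2).
Context (K : H -> H) (cK : compact_op H K).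

Lemma compact_bdd : bdd K.
Proof. by case: cK => /bddP. Qed.

Lemma compact_net (e : R) : 0 < e -> exists s : seq H,
  forall x, rn x <= 1 -> exists2 y, y \in s & rn (K x - y) < e.
Proof.
move=> e0; have [_] := cK; rewrite compact_cover => hc.
pose f (y : H) : set H := ball y (e%:C).
have e0' : 0 < e%:C by rewrite ltcR.
have [|y _|D _ hD] := hc H setT (fun y => (f y)^°).
- by move=> y _; exact: open_interior.
- by exists y => //; apply: nbhsx_ballx.
exists (finmap.enum_fset D) => x x1.
have : closure [set K x | x in [set x | `|x| <= 1]] (K x).
  by apply: subset_closure; exists x => //=; rewrite -[1]/(1%:C) le_rn.
move/hD => [y /= yD /interior_subset]; rewrite /f -ball_normE /= lt_rn => h.
by exists y => //; rewrite rnBC.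
Qed.

(** Gram-Schmidt applied to a finite [d]-net of the image of the unit ball: the orthogonal
    projection is the best approximation from the span, hence at least as good as the nearest net
    point. *)
Lemma compact_approx n (e : nat -> H) (d : R) : orthonormal_family ip n e -> 0 < d ->
  exists m f, [/\ (n <= m)%N, orthonormal_family ip m f,
    forall i, (i < n)%N -> f i = e i &
    forall x, rn (K x - oproj ip m f (K x)) <= d * rn x].
Proof.
move=> he d0; have [s hs] := compact_net d0.
have [m [f [nm hf fe hy]]] := gram_schmidt ip_norm s he.
exists m, f; split=> // x.
have lK := bdd_lin compact_bdd.
have lP := bdd_lin (bdd_oproj ip_norm m f).
have [->|x0] := eqVneq x 0; first by rewrite (lin0 lK) (lin0 lP) subr0 !rn0 mulr0.
have rx : 0 < rn x by rewrite rn_gt0.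
set t := (rn x)^-1; have t0 : 0 < t by rewrite invr_gt0.
have [|y ys hyx] := hs (t%:C *: x).
  by rewrite rnZ rn_real gtr0_norm // mulVf ?gt_eqF.
have [u yu] := hy y ys.
rewrite -ler_pdivrMr // mulrC -/t -{1}(gtr0_norm t0) -rn_real -rnZ scalerBr -(linZ lP) -(linZ lK).
by apply: le_trans (oproj_best ip_norm _ u hf) _; rewrite -yu ltW.
Qed.

End Compact.

(** * Invertible operators times finite-rank perturbations of the identity *)

Section FiniteRankPerturbation.
Context (R : realType) (H : completeNormedModType R[i]).
Context (ip : {dot H for (@Num.conj R[i])}).
Context (ip_norm : forall x : H, ip x x = `|x| ^+ 2).
Implicit Types (x y z : H) (m : nat) (a b : nat -> H).

(** The matrix by which [one_plus] acts on the coordinates against [a] ([coords_one_plus]). Kernel,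
    range and invertibility of [one_plus] are read off from it. *)
Definition gram m a b : 'M[R[i]]_m := 1%:M + \matrix_(i, j) ip (b i) (a j).

Definition one_plus m a b x : H := x + comb b (coords ip m a x).

Lemma coords_comb_gram m a b (u : 'rV_m) : coords ip m a (comb b u) = u *m gram m a b - u.
Proof.
rewrite /gram mulmxDr mulmx1 addrC addKr; apply/rowP => j; rewrite !mxE ip_suml.
by apply: eq_bigr => i _; rewrite ipZl mxE.
Qed.

Lemma coords_one_plus m a b x :
  coords ip m a (one_plus m a b x) = coords ip m a x *m gram m a b.
Proof. by rewrite /one_plus (linD (coords_lin ip m a)) coords_comb_gram addrCA subrr addr0. Qed.

Lemma one_plus_solve m a b x (u : 'rV_m) : coords ip m a x = u *m gram m a b ->
  one_plus m a b (x - comb b u) = x.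
Proof.
move=> h; rewrite /one_plus (linB (coords_lin ip m a)) h coords_comb_gram opprB.
by rewrite addrCA subrr addr0 subrK.
Qed.

(** A kernel vector [z] equals [- comb b u] with [u] its coordinates, and [u] lies in the left
    kernel of [gram]. The injection [J] allows [V] to be the kernel of the adjoint, which is
    transported by the inverse of the adjoint of [G]. *)
Lemma dim_ker_one_plus m a b (J : H -> H) (V : set H) :
  linear J -> injective J ->
  (forall y, V y <-> exists2 z, one_plus m a b z = 0 & y = J z) ->
  subspace_dim V = (m - \rank (gram m a b))%:R%:E.
Proof.
move=> lJ iJ VE; rewrite -mxrank_ker.
have lL : linear (fun u : 'rV_m => J (- comb b u)).
  by move=> c u v; rewrite comb_lin opprD -scalerN lJ.
have caL (u : 'rV_m) : (u <= kermx (gram m a b))%MS -> coords ip m a (- comb b u) = u.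
  by move=> /sub_kermxP h; rewrite (linN (coords_lin ip m a)) coords_comb_gram h sub0r opprK.
apply: (subspace_dim_image lL).
  move=> u hu; rewrite -[RHS](lin0 lJ) => /iJ h.
  by rewrite -(caL u hu) h (lin0 (coords_lin ip m a)).
move=> y; split=> [/VE [z Wz yz]|[u hu ->]].
  exists (coords ip m a z); last by rewrite yz; congr J; apply/eqP; rewrite -subr_eq0 opprK -Wz.
  by apply/sub_kermxP; rewrite -coords_one_plus Wz (lin0 (coords_lin ip m a)).
apply/VE; exists (- comb b u) => //.
by rewrite /one_plus caL // addNr.
Qed.

Lemma gram_adjoint m a b : gram m b a = map_mx Num.conj (gram m a b)^T.
Proof.
apply/matrixP => i j; rewrite !mxE rmorphD /= -(ipC ip); congr (_ + _).
by rewrite eq_sym rmorph_nat.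
Qed.

(** Exchanging [a] and [b] passes to the adjoint; the equality of ranks is the reason why the
    Fredholm index is 0. *)
Lemma rank_gram_adjoint m a b : \rank (gram m b a) = \rank (gram m a b).
Proof. by rewrite gram_adjoint mxrank_map mxrank_tr. Qed.

Lemma bdd_comb_coords m a b : bdd (fun x => comb b (coords ip m a x)).
Proof.
have -> : (fun x => comb b (coords ip m a x)) = fun x => \sum_(i < m) ip x (a i) *: b i.
  by apply/funext => x; apply: eq_bigr => i _; rewrite mxE.
by apply: bdd_sum => i; apply: bdd_rank1; exact: bdd_ip.
Qed.

Context (T G Gi : H -> H) (m : nat) (a b : nat -> H).
Context (bG : bdd G) (bGi : bdd Gi) (GiK : cancel Gi G) (GK : cancel G Gi).
Context (TE : forall x, T x = G (one_plus m a b x)).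

Let lG := bdd_lin bG.
Let lGi := bdd_lin bGi.

Lemma perturbation_bdd : bdd T.
Proof.
have -> : T = G \o (id \+ (fun x => comb b (coords ip m a x))) by apply/funext => x; exact: TE.
by apply: bdd_comp => //; apply: bdd_add; [exact: bdd_id|exact: bdd_comb_coords].
Qed.

Lemma perturbation_dim_ker : subspace_dim (op_kernel T) = (m - \rank (gram m a b))%:R%:E.
Proof.
apply: (@dim_ker_one_plus m a b id) => // y; split=> [Ty|[z Wz ->]].
  by exists y => //; rewrite -[LHS]GK -TE Ty (lin0 lGi).
by rewrite /op_kernel /= TE Wz (lin0 lG).
Qed.

Lemma perturbation_dim_ker_adjoint :
  subspace_dim (op_kernel (adjoint ip T)) = (m - \rank (gram m a b))%:R%:E.
Proof.
have [Gs hGs] := adjoint_exists ip_norm bG.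
have [Gis hGis] := adjoint_exists ip_norm bGi.
have inj x y : (forall z, ip z x = ip z y) -> x = y.
  move=> h; apply/eqP; rewrite -subr_eq0; apply/eqP/(ip_all0 ip_norm) => z.
  by rewrite ipBr h subrr.
have GsK : cancel Gs Gis by move=> y; apply: inj => z; rewrite -hGis -hGs GiK.
have GisK : cancel Gis Gs by move=> y; apply: inj => z; rewrite -hGs -hGis GK.
rewrite -rank_gram_adjoint; apply: (@dim_ker_one_plus m b a Gis).
- exact: (bdd_lin (bdd_adjoint ip_norm bGi hGis)).
- exact: can_inj GisK.
have key x z : ip (one_plus m a b x) z = ip x (one_plus m b a z).
  rewrite ipDl ipDr ip_suml ip_sumr; congr (_ + _); apply: eq_bigr => i _.
  by rewrite !mxE ipZl ipZr -(ipC ip) mulrC.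
move=> y; split.
  move=> /(adjoint_kernelE ip_norm _ perturbation_bdd) h; exists (Gs y); last by rewrite GsK.
  by apply: inj => x; rewrite ip0r -key -hGs -TE.
move=> [z Wz ->]; apply/(adjoint_kernelE ip_norm _ perturbation_bdd) => x.
by rewrite TE hGs GisK key Wz ip0r.
Qed.

Lemma perturbation_rangeE y :
  range T y <-> (coords ip m a (Gi y) <= gram m a b)%MS.
Proof.
split=> [[x _ <-]|/submxP [u hu]].
  by rewrite TE GK coords_one_plus submxMl.
exists (Gi y - comb b u) => //.
by rewrite TE one_plus_solve // GiK.
Qed.

(** The range is the common zero set of finitely many bounded functionals, one for each column of
    the cokernel matrix of [gram]. *)
Lemma perturbation_closed_range : closed (range T).
Proof.
pose C := cokermx (gram m a b).
pose phi (j : 'I_m) y : R[i]^o := (coords ip m a (Gi y) *m C) 0 j.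
have bphi j : bdd (phi j).
  have -> : phi j = fun y => \sum_(i < m) (C i j *: (ip (Gi y) (a i) : R[i]^o)).
    by apply/funext => y; rewrite /phi mxE; apply: eq_bigr => i _; rewrite !mxE mulrC.
  apply: bdd_sum => i; apply: bdd_scale.
  exact: (bdd_comp (bdd_ip ip_norm (a i)) bGi).
have rE y : range T y <-> forall j, phi j y = 0.
  split=> [/perturbation_rangeE|h].
    by rewrite submxE => /eqP h j; rewrite /phi h mxE.
  by apply/perturbation_rangeE; rewrite submxE; apply/eqP/rowP => j; rewrite -/C [LHS]h mxE.
move=> y cy; apply/rE => j; have [c c0 hc] := bdd_gt0 (bphi j).
apply/eqP; rewrite -rn_eq0 eq_le rn_ge0 andbT leNgt; apply/negP => h0.
have e0 : 0 < (rn (phi j y) / c)%:C by rewrite ltcR divr_gt0.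
have [z [/rE Tz]] := cy _ (nbhsx_ballx y _ e0).
rewrite -ball_normE /= lt_rn ltr_pdivlMr // ltNge => /negP; apply.
by rewrite mulrC; apply: le_trans (hc _); rewrite (linB (bdd_lin (bphi j))) Tz subr0.
Qed.

(** Fredholm alternative: an injective [T] has a zero kernel, so the square matrix [gram] is
    invertible and the inverse of [T] can be written down. *)
Lemma perturbation_inverse : injective T ->
  exists U, [/\ bdd U, cancel T U & cancel U T].
Proof.
move=> iT.
have kM0 : kermx (gram m a b) = 0.
  apply/eqP; rewrite -mxrank_eq0 mxrank_ker.
  have := perturbation_dim_ker.
  have -> : subspace_dim (op_kernel T) = 0%:R%:E.
    rewrite (_ : op_kernel T = [set 0]).
      apply/eqP; rewrite eq_le; apply/andP; split; last first.
        apply: ereal_sup_ubound; exists 0%N => //; exists (fun _ => 0) => //.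
        by move=> c _ [].
      apply: ge_ereal_sup => _ [[|k] [v vi vV] <-] //.
      have := vi (fun i => (i == ord0)%:R).
      rewrite big1 => [/(_ erefl ord0)/eqP|i _]; first by rewrite oner_eq0.
      by rewrite vV scaler0.
    apply/seteqP; split=> [x Tx|x ->]; last exact: (lin0 (bdd_lin perturbation_bdd)).
    by apply: iT; rewrite Tx (lin0 (bdd_lin perturbation_bdd)).
  by move=> [/eqP]; rewrite eqr_nat eq_sym.
have uM : gram m a b \in unitmx by rewrite -row_free_unit -kermx_eq0 kM0.
pose U y := Gi y - comb b (coords ip m a (Gi y) *m invmx (gram m a b)).
have TU : cancel U T.
  by move=> y; rewrite TE /U one_plus_solve ?GiK // mulmxKV.
exists U; split=> //; last by move=> x; apply: iT; rewrite TU.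
apply: bdd_sub => //.
pose C := invmx (gram m a b).
have -> : (fun y => comb b (coords ip m a (Gi y) *m invmx (gram m a b))) =
  fun y => \sum_(j < m) (\sum_(i < m) C i j *: (ip (Gi y) (a i) : R[i]^o)) *: b j.
  apply/funext => y; apply: eq_bigr => j _; congr (_ *: _).
  by rewrite mxE; apply: eq_bigr => i _; rewrite !mxE mulrC.
apply: bdd_sum => j; apply: bdd_rank1; apply: bdd_sum => i; apply: bdd_scale.
exact: (bdd_comp (bdd_ip ip_norm (a i)) bGi).
Qed.

End FiniteRankPerturbation.

(** * Fredholm theory of compact perturbations of scalars *)

Section Fredholm.
Context (R : realType) (H : completeNormedModType R[i]).
Context (ip : {dot H for (@Num.conj R[i])}).
Context (ip_norm : forall x : H, ip x x = `|x| ^+ 2).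
Context (K : H -> H) (cK : compact_op H K) (alpha : R[i]) (alpha0 : alpha != 0).

Let bK := compact_bdd cK.
Let lK := bdd_lin bK.

(** Choose a finite-rank projection [P] with [K - P K] of norm at most half of [rn alpha]. Then
    [G = (K - P K) - alpha] is invertible by the Neumann series and [K - alpha = G (1 + Gi P K)];
    the coefficients of [P K x] are inner products of [x] with images under the adjoint of [K]. *)
Lemma compact_shift_form : exists G Gi m a b,
  [/\ bdd G, bdd Gi, cancel Gi G, cancel G Gi &
      forall x, shift_op K alpha x = G (one_plus ip m a b x)].
Proof.
have ra : 0 < rn alpha by rewrite rn_gt0.
have he := orthonormal_family0 ip (fun _ => 0).
have [m [f [_ hf _ hP]]] := compact_approx ip_norm cK he (divr_gt0 ra (ltr0n _ 2)).
set P := oproj ip m f in hP.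
have bP : bdd P by exact: bdd_oproj.
have lP := bdd_lin bP.
pose G x := (K x - P (K x)) - alpha *: x.
have bG : bdd G.
  by apply: bdd_sub; [apply: bdd_sub => //; exact: (bdd_comp bP bK)|apply: bdd_scale; exact: bdd_id].
have lG := bdd_lin bG.
have lowG x : rn alpha / 2 * rn x <= rn (G x).
  have := rn_sub_le (alpha *: x) (K x - P (K x)).
  rewrite rnBC rnZ => h; apply: le_trans h; have := hP x; lra.
have iG : injective G.
  move=> x y Gxy; apply/eqP; rewrite -subr_eq0 -rn_eq0 eq_le rn_ge0 andbT.
  have := lowG (x - y); rewrite (linB lG) Gxy subrr rn0.
  by rewrite pmulr_rle0 // divr_gt0.
have sG y : exists x, G x = y.
  have bS : bdd (fun x => alpha^-1 *: (K x - P (K x))).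
    by apply: bdd_scale; apply: bdd_sub => //; exact: (bdd_comp bP bK).
  have [||x|x hx] := @neumann _ _ _ 2^-1 (bdd_lin bS) _ _ _ (- alpha^-1 *: y).
  - by rewrite invr_ge0.
  - by rewrite invf_lt1 // ltr1n.
  - rewrite rnZ rnV mulrC ler_pdivrMr //; apply: le_trans (hP x) _; lra.
  exists x; rewrite /G; have -> : alpha *: x = (K x - P (K x)) - y.
    rewrite -[x in LHS](subrK (alpha^-1 *: (K x - P (K x)))) hx scalerDr !scalerA.
    by rewrite mulrN mulfV // scaleN1r scale1r addrC.
  by rewrite subKr.
have [Gi GiK] := choice sG.
have GK : cancel G Gi by move=> x; apply: iG; rewrite GiK.
have bGi : bdd Gi.
  split; first by move=> c u v; apply: iG; rewrite lG !GiK.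
  exists (2 / rn alpha); first by rewrite divr_ge0 // ltW.
  move=> y; have := lowG (Gi y); rewrite GiK => h.
  by rewrite -ler_pdivrMl ?divr_gt0 // invf_div mulrC -[X in X <= _]mulrC.
have [Ks hKs] := adjoint_exists ip_norm bK.
exists G, Gi, m, (fun i => Ks (f i)), (fun i => Gi (f i)); split=> // x.
rewrite /one_plus (linD lG) /comb (lin_sum lG) /G /shift_op.
have -> : \sum_(i < m) G (coords ip m (fun i0 => Ks (f i0)) x 0 i *: Gi (f i)) = P (K x).
  rewrite /P oprojE; apply: eq_bigr => i _.
  by rewrite (linZ lG) GiK mxE hKs.
by rewrite addrAC subrK.
Qed.

(** This settles the index condition of balance at every nonzero [alpha], since [- alpha] is then
    nonzero too. *)
Lemma compact_shift_fredholm : semi_Fredholm ip (shift_op K alpha) /\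
  Fredholm_index ip (shift_op K alpha) = 0%E.
Proof.
have [G [Gi [m [a [b [bG bGi GiK GK TE]]]]]] := compact_shift_form.
have d1 : subspace_dim (op_kernel (shift_op K alpha)) = (m - \rank (gram ip m a b))%:R%:E by exact: (perturbation_dim_ker bG bGi GK TE).
have d2 := perturbation_dim_ker_adjoint ip_norm bG bGi GiK GK TE.
split; last by rewrite /Fredholm_index d1 d2 subee.
split; first exact: (perturbation_closed_range ip_norm bGi GiK GK TE).
by rewrite d1 d2 minxx ltry.
Qed.

Lemma compact_shift_inverse : injective (shift_op K alpha) ->
  exists U, [/\ bdd U, cancel (shift_op K alpha) U & cancel U (shift_op K alpha)].
Proof.
have [G [Gi [m [a [b [bG bGi GiK GK TE]]]]]] := compact_shift_form.
exact: (perturbation_inverse ip_norm bG bGi GiK GK TE).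
Qed.

End Fredholm.

(** * Iterates of an operator bounded below on circles *)

Section LeastBound.
Context (R : realType) (V W : normedModType R[i]).

Lemma least_bound (T : V -> W) : bdd T -> exists y : R, [/\ 0 <= y,
  forall x, rn (T x) <= y * rn x &
  forall c, 0 <= c -> (forall x, rn (T x) <= c * rn x) -> y <= c].
Proof.
move=> [lT [c0 c00 hc0]].
pose S := [set c : R | 0 <= c /\ forall x, rn (T x) <= c * rn x].
have Si : has_inf S by split; [exists c0 | exists 0 => c []].
exists (inf S); split.
- by apply: lb_le_inf; [case: Si | move=> c []].
- move=> x; have [->|x0] := eqVneq x 0; first by rewrite (lin0 lT) !rn0 mulr0.
  rewrite -ler_pdivrMr ?rn_gt0 //; apply: lb_le_inf; first by case: Si.
  by move=> c [_ hc]; rewrite ler_pdivrMr ?rn_gt0.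
- by move=> c h1 h2; apply: ge_inf => //; case: Si.
Qed.
End LeastBound.


Ltac vector_ring ipn := apply: (ip_inj ipn) => ?; rewrite ?(ipDl, ipNl, ipZl, ip0l); ring.

Section SpectralRadius.
Context (R : realType) (H : completeNormedModType R[i]).
Context (ip : {dot H for (@Num.conj R[i])}).
Context (ip_norm : forall x : H, ip x x = `|x| ^+ 2).
Context (K : H -> H) (bK : bdd K) (c d : R) (c0 : 0 < c) (d0 : 0 < d).
Context (low : forall z, d <= rn z -> forall x, c * rn z * rn x <= rn (z *: x - K x)).

Lemma square_difference (Y : H -> H) (v : R[i]) x : linear Y ->
  let D := fun x => v ^+ 2 *: x - Y (Y x) in
  let P := fun x => v *: x + Y x in
  let M := fun x => v *: x - Y x in
  [/\ M (M (P (P x))) = D (D x), P (P (M (M x))) = D (D x) &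
   v *: Y (P (P x)) - v *: Y (M (M x)) = (4 * v ^+ 2) *: Y (Y x)].
Proof.
move=> lY D P M; rewrite /D /P /M.
by split; rewrite !(linN lY, linD lY, linZ lY); vector_ring ip_norm.
Qed.

Let sub_iter n z x := z *: x - iter n K x.

(* Averaging over the two square roots of z halves the constant: with v ^+ 2 = z, *)
(* 4 z Y^2 = v Y (v + Y)^2 - v Y (v - Y)^2.                                      *)
Lemma iterate_bound k z : d ^+ (2 ^ k) <= rn z -> forall x,
  rn z * rn (iter (2 ^ k) K x) <=
  ((c^-1 + 1) / c / 2 ^+ k) * rn (sub_iter (2 ^ k) z (sub_iter (2 ^ k) z x)).
Proof.
elim: k z => [|k IH] z hz x.
  rewrite expn0 expr1 in hz; rewrite /sub_iter expn0 /= expr0 divr1.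
  have zp : 0 < rn z by apply: lt_le_trans hz.
  have h1 := low hz x; have h2 := low hz (z *: x - K x).
  have h3 : rn (K x) <= rn z * rn x + rn (z *: x - K x).
    rewrite -rnZ -{1}[K x](subKr (z *: x)); exact: rnB.
  have h4 : rn (K x) <= (c^-1 + 1) * rn (z *: x - K x).
    apply: le_trans h3 _; rewrite mulrDl mul1r lerD2r -(ler_pM2l c0) mulrA.
    by rewrite [leRHS]mulrA mulfV ?gt_eqF // mul1r.
  apply: (@le_trans _ _ (rn z * ((c^-1 + 1) * rn (z *: x - K x)))); first by rewrite ler_wpM2l // ltW.
  have -> : (c^-1 + 1) / c * rn (z *: (z *: x - K x) - K (z *: x - K x)) =
     (c^-1 + 1) * (rn (z *: (z *: x - K x) - K (z *: x - K x)) / c) by rewrite mulrAC mulrA.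
  rewrite mulrCA ler_pM2l ?addr_gt0 ?invr_gt0 //.
  by rewrite ler_pdivlMr // mulrC mulrA.
pose v := sqrtC z; have vz : v ^+ 2 = z by exact: sqrtCK.
have rz : rn z = rn v ^+ 2 by rewrite -vz rnX.
have hv : d ^+ (2 ^ k) <= rn v.
  rewrite -(ler_pXn2r (_ : (0 < 2)%N)) ?nnegrE ?rn_ge0 ?exprn_ge0 ?(ltW d0) // -rz.
  by rewrite -exprM -expnSr.
rewrite /sub_iter in IH *; set Y := iter (2 ^ k) K in IH.
have lY : linear Y by exact: (bdd_lin (bdd_iter _ bK)).
have YY y : iter (2 ^ k.+1) K y = Y (Y y) by rewrite expnS mul2n -addnn iterD.
pose P y := v *: y + Y y; pose M y := v *: y - Y y; pose D y := z *: y - Y (Y y).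
have [E1 E2 E3] : [/\ M (M (P (P x))) = D (D x), P (P (M (M x))) = D (D x) &
   v *: Y (P (P x)) - v *: Y (M (M x)) = (4 * z) *: Y (Y x)].
  by rewrite /D -vz; exact: square_difference.
set Q1 := P (P x) in E1 E3; set Q2 := M (M x) in E2 E3.
have h1 := IH v hv Q1; rewrite -/(M Q1) -/(M (M Q1)) E1 in h1.
have hvN : d ^+ (2 ^ k) <= rn (- v) by rewrite rnN.
have h2 := IH (- v) hvN Q2; rewrite rnN in h2.
have EN y : - v *: y - Y y = - P y by rewrite scaleNr opprD.
have PN y : P (- y) = - P y by rewrite /P (linN lY) scalerN opprD.
rewrite !EN PN opprK E2 in h2.
rewrite !YY -/(D x) -/(D (D x)); set DD := rn (D (D x)) in h1 h2 *.
have : rn ((4 * z) *: Y (Y x)) <= rn v * rn (Y Q1) + rn v * rn (Y Q2).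
  by rewrite -E3 -!rnZ; exact: rnB.
rewrite rnZ rnM (_ : rn 4 = 4); last exact: rn_nat.
have -> : (c^-1 + 1) / c / 2 ^+ k.+1 = (c^-1 + 1) / c / 2 ^+ k / 2.
  by rewrite exprS invfM [2^-1 * _]mulrC mulrA.
set e := (c^-1 + 1) / c / 2 ^+ k in h1 h2 *.
move=> h; have -> : e / 2 * DD = (e * DD) / 2 by rewrite mulrAC.
move: h h1 h2; set s := rn (Y (Y x)); set a1 := rn v * _; set a2 := rn v * _; set ed := e * DD.
rewrite -mulrA; set zs := rn z * s; lra.
Qed.

(** Let [y] be the norm of [K^N], with [N = 2 ^ k]. If [y >= d ^+ N], then [iterate_bound] at
    [z = y], together with the trivial bound [4 y^2] for [(y - K^N)^2] and a [k] making the averaged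
    constant at most 1/8, gives the bound [y / 2] for [K^N], against the minimality of [y]. *)
Lemma spectral_radius_lt : exists N th, [/\ (0 < N)%N, 0 <= th, th < 1 &
  forall x, rn (iter N K x) <= th * d ^+ N * rn x].
Proof.
set C := (c^-1 + 1) / c.
have [k hk] : exists k : nat, 8 * C <= 2 ^+ k.
  exists (Num.truncn (8 * C)).+1; apply: ltW; apply: lt_le_trans (truncnS_gt _) _.
  by rewrite -natrX ler_nat ltnW // ltn_expl.
have dN : 0 < d ^+ (2 ^ k) by rewrite exprn_gt0.
have lY : linear (iter (2 ^ k) K) by exact: (bdd_lin (bdd_iter _ bK)).
have [y [y0 hy ymin]] := least_bound (bdd_iter (2 ^ k) bK).
have [yd|dy] := ltP y (d ^+ (2 ^ k)).
  exists (2 ^ k)%N, (y / d ^+ (2 ^ k)); split.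
  - by rewrite expn_gt0.
  - by rewrite divr_ge0 // ltW.
  - by rewrite ltr_pdivrMr // mul1r.
  - by move=> x; rewrite divfK ?gt_eqF.
have yp : 0 < y by apply: lt_le_trans dy.
suff : y <= y / 2 by lra.
apply: ymin; first by rewrite divr_ge0.
move=> x.
have yr : rn y%:C = y by rewrite rn_real ger0_norm.
have := @iterate_bound k y%:C; rewrite yr => /(_ dy x) /=; rewrite -/C.
set D := fun x => y%:C *: x - iter (2 ^ k) K x; rewrite /sub_iter -/(D x) -/(D (D x)) => h.
have hD w : rn (D w) <= 2 * y * rn w.
  apply: le_trans (rnB _ _) _; rewrite rnZ yr; have := hy w; lra.
have h2 : rn (D (D x)) <= 4 * y ^+ 2 * rn x.
  apply: le_trans (hD _) _; have := hD x.
  rewrite -(ler_pM2l (_ : 0 < 2 * y)) ?mulr_gt0 // => /le_trans; apply.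
  by rewrite le_eqVlt; apply/orP; left; apply/eqP; ring.
have C8 : C / 2 ^+ k <= 8^-1 by rewrite ler_pdivrMr ?exprn_gt0 // mulrC -ler_pdivrMr ?invr_gt0 // invrK mulrC.
have Ck : 0 <= C / 2 ^+ k.
  by rewrite divr_ge0 ?exprn_ge0 // mulr_ge0 ?addr_ge0 ?invr_ge0 // ltW.
rewrite -(ler_pM2l yp); apply: le_trans h _.
apply: (@le_trans _ _ (8^-1 * (4 * y ^+ 2 * rn x))).
  by apply: ler_pM => //; exact: rn_ge0.
by rewrite le_eqVlt; apply/orP; left; apply/eqP; field.
Qed.

End SpectralRadius.

(** * A uniform lower bound outside a disc without eigenvalues *)

Section CompactLowerBound.
Context (R : realType) (H : completeNormedModType R[i]).
Context (ip : {dot H for (@Num.conj R[i])}).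
Context (ip_norm : forall x : H, ip x x = `|x| ^+ 2).
Context (K : H -> H) (cK : compact_op H K).

Let bK := compact_bdd cK.
Let lK := bdd_lin bK.

(** A cluster point in the compact product of a real square, for the real and imaginary parts of
    [z], and the closure of the image of the unit ball. *)
Lemma compact_cluster (r : R) (z : nat -> R[i]) (x : nat -> H) :
  (forall k, rn (z k) <= r) -> (forall k, rn (x k) <= 1) ->
  exists w y, forall e N, 0 < e ->
    exists2 k, (N <= k)%N & rn (z k - w) < e /\ rn (K (x k) - y) < e.
Proof.
move=> hz hx.
have [_ cB] := cK; set S := closure _ in cB.
have cP : compact ((`[- r, r] `*` `[- r, r]) `*` S).
  by apply: compact_setX => //; apply: compact_setX; exact: segment_compact.
pose p k := ((complex.Re (z k), complex.Im (z k)), K (x k)).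
have [|[[a b] y] [_ cl]] := cP (p @ \oo) _.
  exists 0%N => // k _; split.
    split; rewrite /= in_itv /= -ler_norml.
      exact: le_trans (normRe_le_rn _) (hz k).
    exact: le_trans (normIm_le_rn _) (hz k).
  by apply: subset_closure; exists (x k) => //=; rewrite -[1]/(1%:C) le_rn.
exists (a +i* b)%C, y => e N e0.
pose A := [set p k | k in [set k | (N <= k)%N]].
have FA : (p @ \oo) A by exists N => // k /= Nk; exists k.
have e2 : 0 < e / 2 by rewrite divr_gt0.
have ec : 0 < e%:C by rewrite ltcR.
have VB : nbhs ((a, b), y) ((ball a (e / 2) `*` ball b (e / 2)) `*` ball y (e%:C)).
  exists (ball a (e / 2) `*` ball b (e / 2), ball y (e%:C)) => //; split=> /=.
    by exists (ball a (e / 2), ball b (e / 2)) => //; split=> /=; exact: nbhsx_ballx.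
  exact: nbhsx_ballx.
have [_ [[k Nk <-] [[/= Ba Bb] By]]] := cl _ _ FA VB.
exists k => //; split; last by move: By; rewrite -ball_normE /= lt_rn rnBC.
apply: le_lt_trans (rn_le_ReIm _) _.
move: Ba Bb; rewrite -!ball_normE /= distrC => Ba; rewrite distrC => Bb.
rewrite [e]splitr; apply: ltrD.
  by rewrite raddfB.
by rewrite raddfB.
Qed.

(** Otherwise there are [z k] and unit vectors [x k] with relative defect tending to 0. A cluster
    point [(w, y)] of [(z k, K (x k))] satisfies [K y = w y] with [rn w >= d], so [y = 0]; but
    [K (x k)] is close to [z k *: x k], of norm at least [d]. *)
Lemma compact_lower_bound (d : R) : 0 < d ->
  (forall z x, d <= rn z -> K x = z *: x -> x = 0) ->
  exists2 c : R, 0 < c & forall z, d <= rn z -> forall x, c * rn z * rn x <= rn (z *: x - K x).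
Proof.
move=> d0 noev; have [C C0 hC] := bdd_gt0 bK.
apply: contrapT => hn.
(* Starting at [k.+2] keeps the defect below half of [rn (z k)], which bounds all [z k] by
   [2 * C]. *)
have bad (k : nat) : exists zx : R[i] * H, [/\ d <= rn zx.1, rn zx.2 = 1 &
    rn (zx.1 *: zx.2 - K zx.2) < rn zx.1 / k.+2%:R].
  apply: contrapT => hk; apply: hn; exists k.+2%:R^-1; first by rewrite invr_gt0.
  move=> z dz x; rewrite leNgt; apply/negP => hx; apply: hk.
  have x0 : x != 0.
    apply/eqP => x0; move: hx; rewrite x0 rn0 mulr0 scaler0 (lin0 lK) subr0 rn0.
    by rewrite ltxx.
  have rx : 0 < rn x by rewrite rn_gt0.
  have rt : rn ((rn x)^-1)%:C = (rn x)^-1 by rewrite rn_real gtr0_norm ?invr_gt0.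
  exists (z, ((rn x)^-1)%:C *: x); split=> //=.
    by rewrite rnZ rt mulVf ?gt_eqF.
  rewrite (linZ lK) scalerA [z * _]mulrC -scalerA -scalerBr rnZ rt.
  by rewrite mulrC ltr_pdivrMr // [rn z / _]mulrC.
have [zx hzx] := choice bad.
pose z k := (zx k).1; pose x k := (zx k).2.
have hz k : d <= rn (z k) by case: (hzx k).
have hx k : rn (x k) = 1 by case: (hzx k).
have hr k : rn (z k *: x k - K (x k)) < rn (z k) / k.+2%:R by case: (hzx k).
have zC k : rn (z k) <= 2 * C.
  have h1 := hC (x k); rewrite hx mulr1 in h1.
  have h2 := rn_sub_le (z k *: x k) (K (x k)); rewrite rnZ hx mulr1 in h2.
  have h3 : rn (z k) / k.+2%:R <= rn (z k) / 2.
    by rewrite ler_wpM2l ?rn_ge0 // lef_pV2 ?posrE // ler_nat.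
  have h4 := lt_le_trans (hr k) h3; move: h1 h2 h4.
  set p := rn (z k); set q := rn (K _); set s := rn (_ - _); lra.
have hr' k : rn (z k *: x k - K (x k)) <= 2 * C / k.+2%:R.
  by apply: le_trans (ltW (hr k)) _; rewrite ler_wpM2r ?invr_ge0.
have [w [y hwy]] := @compact_cluster (2 * C) z x zC (fun k => eq_ind_r (fun t => t <= 1) (lexx 1) (hx k)).
have close (e : R) : 0 < e -> exists k, [/\ rn (z k - w) < e, rn (K (x k) - y) < e &
    rn (z k *: x k - K (x k)) < e].
  move=> e0; pose N := Num.truncn (2 * C / e).
  have [k Nk [h1 h2]] := hwy e N e0; exists k; split=> //.
  apply: le_lt_trans (hr' k) _; rewrite ltr_pdivrMr // -ltr_pdivrMl // [_^-1 * _]mulrC.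
  by apply: lt_le_trans (truncnS_gt _) _; rewrite ler_nat ltnS (leq_trans Nk).
have dw : d <= rn w.
  apply/ler_addgt0Pr => e e0; have [k [h1 _ _]] := close e e0.
  have := rn_sub_le (z k) w; have := hz k; have := rnBC (z k) w; lra.
have Ky : K y = w *: y.
  apply/eqP; rewrite -subr_eq0 -rn_eq0 eq_le rn_ge0 andbT.
  apply/ler_addgt0Pr => e e0; rewrite add0r.
  pose D := 1 + C + 2 * C + C + rn y.
  have D0 : 0 < D by apply: ltr_wpDr; [exact: rn_ge0 | rewrite !addr_gt0 // mulr_gt0].
  have [|k [h1 h2 h3]] := close (e / D); first by rewrite divr_gt0.
  set t := e / D in h1 h2 h3.
  have -> : K y - w *: y = K (y - K (x k)) - K (z k *: x k - K (x k)) +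
      (z k *: (K (x k) - y) + (z k - w) *: y).
    rewrite !(linD lK, linN lK, linZ lK) !(scalerBl, scalerDl, scaleNr); vector_ring ip_norm.
  have -> : e = t * D by rewrite /t divfK ?gt_eqF.
  apply: le_trans (rnD _ _) _.
  have b1 : rn (K (y - K (x k)) - K (z k *: x k - K (x k))) <= C * t + C * t.
    apply: le_trans (rnB _ _) _; apply: lerD; apply: le_trans (hC _) _; rewrite ler_pM2l //.
      by rewrite rnBC ltW.
    exact: ltW.
  have b2 : rn (z k *: (K (x k) - y) + (z k - w) *: y) <= 2 * C * t + t * rn y.
    apply: le_trans (rnD _ _) _; rewrite !rnZ; apply: lerD.
      by apply: ler_pM; rewrite ?rn_ge0 // ltW.
    by rewrite ler_wpM2r ?rn_ge0 // ltW.
  apply: le_trans (lerD b1 b2) _; have : 0 < t by rewrite divr_gt0.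
  rewrite /D; set ry := rn y; nra.
have y0 := noev w y dw Ky.
have [k [_ h2 h3]] := close (d / 2) (divr_gt0 d0 (ltr0n _ 2)).
rewrite y0 subr0 in h2.
have := rn_sub_le (z k *: x k) (K (x k)); rewrite rnZ hx mulr1.
have := hz k; lra.
Qed.

End CompactLowerBound.

(** * Polynomials of an operator *)

Section OperatorPolynomial.
Context (K : fieldType) (V : lmodType K).
Implicit Types (T : V -> V) (p q : {poly K}) (x : V).

Definition papp T p x : V := \sum_(i < size p) p`_i *: iter i T x.

Lemma papp_widen T p x m : (size p <= m)%N -> papp T p x = \sum_(i < m) p`_i *: iter i T x.
Proof.
move=> pm; rewrite /papp (big_ord_widen m (fun i => p`_i *: iter i T x) pm).
rewrite big_mkcond; apply: eq_bigr => i _; case: ltnP => // h.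
by rewrite nth_default // scale0r.
Qed.

Lemma papp_linear T x : linear (fun p => papp T p x).
Proof.
move=> a p q; set m := maxn (size p) (size q).
rewrite !(@papp_widen T _ x m) ?leq_maxl ?leq_maxr //.
  rewrite scaler_sumr -big_split /=; apply: eq_bigr => i _.
  by rewrite coefD coefZ scalerDl scalerA.
apply: leq_trans (size_polyD _ _) _; rewrite geq_max leq_maxr andbT.
exact: leq_trans (size_scale_leq _ _) (leq_maxl _ _).
Qed.

Lemma papp0 T x : papp T 0 x = 0. Proof. exact: (lin0 (papp_linear T x)). Qed.
Lemma pappD T p q x : papp T (p + q) x = papp T p x + papp T q x.
Proof. exact: (linD (papp_linear T x)). Qed.
Lemma pappB T p q x : papp T (p - q) x = papp T p x - papp T q x.
Proof. exact: (linB (papp_linear T x)). Qed.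
Lemma pappN T p x : papp T (- p) x = - papp T p x.
Proof. exact: (linN (papp_linear T x)). Qed.
Lemma pappZ T a p x : papp T (a *: p) x = a *: papp T p x.
Proof. exact: (linZ (papp_linear T x)). Qed.

Lemma pappC T c x : papp T c%:P x = c *: x.
Proof. by rewrite (papp_widen _ _ (size_polyC_leq1 c)) big_ord1 coefC. Qed.

Lemma papp1 T x : papp T 1 x = x.
Proof. by rewrite pappC scale1r. Qed.

Lemma papp_mulX T p x : papp T (p * 'X) x = papp T p (T x).
Proof.
have hs : (size (p * 'X)%R <= (size p).+1)%N.
  by apply: leq_trans (size_polyMleq _ _) _; rewrite size_polyX addn2.
rewrite (papp_widen _ _ hs) big_ord_recl coefMX /= scale0r add0r.
by apply: eq_bigr => i _; rewrite coefMX /= -iterSr.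
Qed.

Lemma pappX T x : papp T 'X x = T x.
Proof. by rewrite -['X]mul1r papp_mulX papp1. Qed.

Lemma papp_intertwine S T1 T2 p x : linear S -> (forall y, S (T1 y) = T2 (S y)) ->
  S (papp T1 p x) = papp T2 p (S x).
Proof.
move=> lS h; rewrite /papp (lin_sum lS); apply: eq_bigr => i _; rewrite (linZ lS).
by congr (_ *: _); elim: (val i) => //= k IH; rewrite h IH.
Qed.

Section Linear.
Context (T : V -> V) (lT : linear T).

Lemma papp_lin p : linear (papp T p).
Proof.
have lI i : linear (iter i T) by elim: i => [|i IH] //= a u v /=; rewrite IH lT.
move=> a u v; rewrite /papp scaler_sumr -big_split /=; apply: eq_bigr => i _.
by rewrite lI scalerDr !scalerA mulrC.
Qed.

Lemma papp_comm p x : papp T p (T x) = T (papp T p x).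
Proof. by rewrite (papp_intertwine _ _ lT (fun _ => erefl)). Qed.

Lemma pappM p q x : papp T (p * q) x = papp T p (papp T q x).
Proof.
elim/poly_ind: p x => [|p c IH] x; first by rewrite mul0r !papp0.
rewrite mulrDl !pappD mulrAC !papp_mulX IH pappC mul_polyC pappZ.
by rewrite -papp_comm.
Qed.

Lemma pappMX p x : papp T ('X * p) x = T (papp T p x).
Proof. by rewrite pappM pappX. Qed.

Lemma papp_XsubC a x : papp T ('X - a%:P) x = T x - a *: x.
Proof. by rewrite pappB pappX pappC. Qed.

Lemma papp_Xn k x : papp T 'X^k x = iter k T x.
Proof. by elim: k => [|k IH]; rewrite ?expr0 ?papp1 // exprS pappMX IH. Qed.

Lemma papp_dvd p q x : p %| q -> papp T p x = 0 -> papp T q x = 0.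
Proof. by move=> /dvdpP [r ->] h; rewrite pappM h (lin0 (papp_lin r)). Qed.

Lemma papp_anticommute S p x : linear S -> (forall y, S (T y) = - T (S y)) ->
  S (papp T p x) = papp T (p \Po (- 'X)) (S x).
Proof.
move=> lS h; elim/poly_ind: p x => [|p c IH] x.
  by rewrite comp_poly0 !papp0 (lin0 lS).
rewrite comp_poly_MXaddC !pappD (linD lS) papp_mulX IH h !pappC (linZ lS).
by rewrite mulrN pappN papp_mulX (linN (papp_lin _)).
Qed.
End Linear.
End OperatorPolynomial.

Section PolynomialFacts.
Context (K : fieldType).
Implicit Types (p q : {poly K}) (s : seq K).

Lemma coprime_XsubC_prod (a : K) s n : a \notin s ->
  coprimep (('X - a%:P) ^+ n) (\prod_(b <- s) ('X - b%:P) ^+ n).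
Proof.
elim: s => [|b s IH]; first by rewrite big_nil coprimep1.
rewrite inE negb_or big_cons => /andP[ab /IH h].
rewrite coprimepMr h andbT coprimep_expl ?coprimep_expr //.
by rewrite coprimep_XsubC root_XsubC eq_sym.
Qed.

Lemma dvd_prod_XsubC s n p : uniq s ->
  (forall a, a \in s -> ('X - a%:P) ^+ n %| p) -> \prod_(a <- s) ('X - a%:P) ^+ n %| p.
Proof.
elim: s => [|a s IH] /=; first by rewrite big_nil dvd1p.
move=> /andP[na us] h; rewrite big_cons Gauss_dvdp; last exact: coprime_XsubC_prod.
rewrite h ?mem_head // IH // => b bs; apply: h; by rewrite inE bs orbT.
Qed.

(** Chinese remainder theorem, by induction with a Bezout identity. With [w] an indicator function,
    the polynomial obtained yields a spectral projection when applied to an operator. *)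
Lemma chinese_poly s n (w : K -> K) : uniq s ->
  exists q, forall a, a \in s -> ('X - a%:P) ^+ n %| q - (w a)%:P.
Proof.
elim: s => [|a s IH] /=; first by exists 0.
move=> /andP[na us]; have [q hq] := IH us.
have /Bezout_eq1_coprimepP [[u v] /= uv] := coprime_XsubC_prod n na.
set r := \prod_(b <- s) _ in uv; set l := ('X - a%:P) ^+ n in uv.
exists (q + ((w a)%:P - q) * (v * r)) => b; rewrite inE => /orP[/eqP ->|bs].
  have -> : q + ((w a)%:P - q) * (v * r) - (w a)%:P = (q - (w a)%:P) * u * l.
    have -> : v * r = 1 - u * l by rewrite -uv addrC addKr.
    by ring.
  by rewrite dvdp_mull.
have -> : q + ((w a)%:P - q) * (v * r) - (w b)%:P = (q - (w b)%:P) + ((w a)%:P - q) * v * r.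
  by ring.
apply: dvdp_add; first exact: hq.
rewrite dvdp_mull // /r (big_rem b) //= dvdp_mulr //.
Qed.

Lemma dvd_prod_undup s n : (size s <= n)%N ->
  \prod_(a <- s) ('X - a%:P) %| \prod_(a <- undup s) ('X - a%:P) ^+ n.
Proof.
move=> sn; rewrite -big_undup_iterop_count /=.
elim: (undup s) => [|a t IH]; first by rewrite !big_nil.
rewrite !big_cons dvdp_mul //.
rewrite -[iterop _ _ _ _]/(('X - a%:P) ^+ count_mem a s) dvdp_exp2l //.
exact: leq_trans (count_size _ _) sn.
Qed.

End PolynomialFacts.

Section OperatorPolynomialBounded.
Context (R : realType) (V : normedModType R[i]).

Lemma bdd_papp (T : V -> V) p : bdd T -> bdd (papp T p).
Proof.
by move=> bT; apply: bdd_sum => i; apply: bdd_scale; exact: bdd_iter.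
Qed.
End OperatorPolynomialBounded.

(** * Schur decomposition of a compact operator *)

Section Flag.
Context (R : realType) (H : completeNormedModType R[i]).
Context (ip : {dot H for (@Num.conj R[i])}).
Context (ip_norm : forall x : H, ip x x = `|x| ^+ 2).
Implicit Types (K : H -> H) (n : nat) (e : nat -> H) (d : R).

(* An orthonormal Schur basis e_0, .., e_(n-1) of a K-invariant subspace: K is    *)
(* triangular on it and its diagonal entries (eigenvalues) have modulus >= d.    *)
Definition schur_family K d n e : Prop :=
  [/\ orthonormal_family ip n e,
      forall i, (i < n)%N -> K (e i) = \sum_(j < i.+1) ip (K (e i)) (e j) *: e j
    & forall i, (i < n)%N -> d <= rn (ip (K (e i)) (e i))].

Definition ocompl n e (x : H) := x - oproj ip n e x.

(** Let [P K] be within [d / 2] of [K], with [P] of rank [m]. Each diagonal entry being at least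
    [d], every [P (e i)] has norm at least [d / (2 * C)]; but the sum of [rn (P (e i)) ^+ 2] equals
    the sum over [j < m] of the squared norms of the projections of [f j] onto the span of [e],
    hence is at most [m]. *)
Lemma schur_family_bound K d : compact_op H K -> 0 < d ->
  exists B : nat, forall n e, schur_family K d n e -> (n <= B)%N.
Proof.
move=> cK d0; have bK := compact_bdd cK; have [C C0 hC] := bdd_gt0 bK.
have [m [f [_ hf _ hP]]] := compact_approx ip_norm cK (orthonormal_family0 ip (fun _ => 0)) (divr_gt0 d0 (ltr0n _ 2)).
exists (Num.truncn (m%:R * (2 * C / d) ^+ 2)).+1 => n e [he hK hd].
have Pe i : (i < n)%N -> d / (2 * C) <= rn (oproj ip m f (e i)).
  move=> hi; rewrite ler_pdivrMr ?mulr_gt0 //.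
  set u := K (e i) in hK *; have rei := orthonormal_family_rn ip_norm he hi.
  have h1 : rn (ip (K (e i) - oproj ip m f (K (e i))) (e i)) <= d / 2.
    apply: le_trans (cauchy_schwarz ip_norm _ _) _; rewrite rei mulr1.
    by apply: le_trans (hP _) _; rewrite rei mulr1.
  have h2 : ip (oproj ip m f (K (e i))) (e i) = ip (oproj ip m f (K (e i))) (oproj ip m f (e i)).
    apply/eqP; rewrite -subr_eq0 -ipBr; apply/eqP/ip_eq0C.
    by apply: ip_orth_comb => j hj; exact: ip_sub_oproj.
  have h3 : rn (ip (oproj ip m f (K (e i))) (e i)) <= C * rn (oproj ip m f (e i)).
    rewrite h2; apply: le_trans (cauchy_schwarz ip_norm _ _) _.
    rewrite ler_wpM2r ?rn_ge0 //; apply: le_trans (rn_oproj ip_norm _ hf) _.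
    by apply: le_trans (hC _) _; rewrite rei mulr1.
  have := hd i hi; rewrite -[K (e i)](subrK (oproj ip m f (K (e i)))) ipDl => h4.
  have h5 := le_trans h4 (rnD _ _).
  set p := rn (oproj ip m f (e i)) in h3 *; nra.
have sumP : \sum_(i < n) rn (oproj ip m f (e i)) ^+ 2 <= m%:R.
  have -> : \sum_(i < n) rn (oproj ip m f (e i)) ^+ 2 =
      \sum_(j < m) rn (oproj ip n e (f j)) ^+ 2.
    transitivity (\sum_(i < n) \sum_(j < m) rn (ip (e i) (f j)) ^+ 2).
      apply: eq_bigr => i _; rewrite (rn_comb_sq ip_norm) //; apply: eq_bigr => j _.
      by rewrite mxE.
    rewrite exchange_big; apply: eq_bigr => j _; rewrite (rn_comb_sq ip_norm) //.
    by apply: eq_bigr => i _; rewrite mxE ipC rn_conj.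
  rewrite -[m in m%:R]card_ord -sumr_const; apply: ler_sum => j _.
  rewrite -[leRHS](expr1n _ 2) lerXn2r ?nnegrE ?rn_ge0 //.
  by apply: le_trans (rn_oproj ip_norm _ he) _; rewrite (orthonormal_family_rn ip_norm hf).
have : n%:R * (d / (2 * C)) ^+ 2 <= m%:R.
  apply: le_trans sumP; rewrite -[n in n%:R]card_ord mulr_natl -sumr_const.
  apply: ler_sum => i _; rewrite lerXn2r ?nnegrE ?rn_ge0 ?Pe //.
  by rewrite divr_ge0 ?mulr_ge0 // ltW.
have -> : d / (2 * C) = (2 * C / d)^-1 by rewrite invf_div.
rewrite exprVn ler_pdivrMr ?exprn_gt0 ?divr_gt0 ?mulr_gt0 // => h.
by rewrite -(ler_nat R); apply: le_trans h _; apply/ltW/truncnS_gt.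
Qed.

Lemma schur_family_extend K d n e z x : bdd K -> 0 < d -> schur_family K d n e ->
  d <= rn z -> ocompl n e (K x) = z *: x -> x != 0 ->
  exists e', schur_family K d n.+1 e'.
Proof.
move=> bK d0 [he hK hd] dz hx x0.
have lK := bdd_lin bK.
have z0 : z != 0 by rewrite -rn_gt0; apply: lt_le_trans dz.
have xo j : (j < n)%N -> ip x (e j) = 0.
  move=> hj; rewrite -[x]scale1r -(mulVf z0) -scalerA -hx ipZl.
  by rewrite ip_sub_oproj ?mulr0.
set y := ((rn x)^-1)%:C *: x.
have y1 : rn y = 1.
  by rewrite rnZ rn_real ger0_norm ?invr_ge0 ?rn_ge0 // mulVf ?rn_eq0.
have yo j : (j < n)%N -> ip y (e j) = 0 by move=> hj; rewrite ipZl xo ?mulr0.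
have Ky : K y = oproj ip n e (K y) + z *: y.
  rewrite /y (linZ lK) scalerA [z * _]mulrC -scalerA -hx /ocompl scalerBr.
  by rewrite (linZ (bdd_lin (bdd_oproj ip_norm n e))) addrC subrK.
have Kyy : ip (K y) y = z.
  rewrite Ky ipDl ipZl (ip_sq ip_norm) y1 expr1n mulr1.
  by rewrite (ip_eq0C (ip_orth_comb _ yo)) add0r.
exists (fun i => if i == n then y else e i); split.
- exact: orthonormal_rcons.
- move=> i; rewrite ltnS leq_eqVlt => /orP[/eqP ->|hi].
    rewrite eqxx {1}Ky big_ord_recr /= eqxx Kyy; congr (_ + _).
    rewrite oprojE; apply: eq_bigr => j _.
    by rewrite (ltn_eqF (ltn_ord j)).
  rewrite (ltn_eqF hi) {1}(hK i hi); apply: eq_bigr => j _.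
  by rewrite (ltn_eqF (leq_trans (ltn_ord j) hi)).
- move=> i; rewrite ltnS leq_eqVlt => /orP[/eqP ->|hi]; first by rewrite eqxx Kyy.
  by rewrite (ltn_eqF hi); exact: hd.
Qed.

(** A family of maximal length: an eigenvector of the compression for a further eigenvalue of
    modulus at least [d] could be appended. *)
Lemma schur_family_exists K d : compact_op H K -> 0 < d ->
  exists n e, schur_family K d n e /\
    forall z x, d <= rn z -> ocompl n e (K x) = z *: x -> x = 0.
Proof.
move=> cK d0; have bK := compact_bdd cK.
have [B hB] := schur_family_bound cK d0.
have ex0 : exists n, `[< exists e, schur_family K d n e >].
  by exists 0%N; apply/asboolP; exists (fun _ => 0); split.
have ub n : `[< exists e, schur_family K d n e >] -> (n <= B)%N.
  by move/asboolP => [e]; exact: hB.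
have [n /asboolP [e fe] nmax] := ex_maxnP ex0 ub.
exists n, e; split=> // z x dz hx; apply/eqP/negPn/negP => x0.
have [e' fe'] := schur_family_extend bK d0 fe dz hx x0.
have : (n.+1 <= n)%N by apply: nmax; apply/asboolP; exists e'.
by rewrite ltnn.
Qed.

End Flag.

Lemma compact_op_comp (R : realType) (H : completeNormedModType R[i]) (S K : H -> H) :
  bdd S -> compact_op H K -> compact_op H (S \o K).
Proof.
move=> bS [bK cK]; split.
  by apply/bddP; apply: bdd_comp => //; apply/bddP.
have cS : continuous S by case/bddP: bS.
have cSK : compact (S @` closure [set K x | x in [set x : H | `|x| <= 1]]).
  by apply: continuous_compact => //; exact: continuous_subspaceT.
apply: (subclosed_compact _ cSK); first exact: closed_closure.
rewrite [X in _ `<=` X](closure_id _).1; last by apply: compact_closed => //; exact: norm_hausdorff.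
apply: closure_subset => _ [x xB <-]; exists (K x) => //.
by apply: subset_closure; exists x.
Qed.

(** * The triangular part and the tail of a compact operator *)

Section Decomposition.
Context (R : realType) (H : completeNormedModType R[i]).
Context (ip : {dot H for (@Num.conj R[i])}).
Context (ip_norm : forall x : H, ip x x = `|x| ^+ 2).
Context (K : H -> H) (d : R) (cK : compact_op H K) (d0 : 0 < d).
Context (n : nat) (e : nat -> H) (fe : schur_family ip K d n e).
Context (noev : forall z x, d <= rn z -> ocompl ip n e (K x) = z *: x -> x = 0).

Let bK := compact_bdd cK.
Let lK := bdd_lin bK.
Let he : orthonormal_family ip n e. Proof. by case: fe. Qed.
Let hK i : (i < n)%N -> K (e i) = \sum_(j < i.+1) ip (K (e i)) (e j) *: e j.
Proof. by case: fe => _ h _; exact: h. Qed.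
Local Notation Q := (ocompl ip n e).

(** Since the span of [e] is invariant, [Q K] vanishes on it and coincides with the compression
    [Q K Q] ([tail_ocompl]). *)
Definition tail_op (x : H) := Q (K x).
Local Notation Kt := tail_op.
Definition diag_entry (i : nat) := ip (K (e i)) (e i).
Local Notation mu := diag_entry.

Let dmu i : (i < n)%N -> d <= rn (mu i).
Proof. by case: fe => _ _ h; exact: h. Qed.

Lemma bdd_ocompl : bdd Q.
Proof. by apply: bdd_sub; [exact: bdd_id | exact: bdd_oproj]. Qed.
Let lQ := bdd_lin bdd_ocompl.

Lemma ocompl_comb (u : 'rV_n) : Q (comb e u) = 0.
Proof. by rewrite /ocompl oproj_comb // subrr. Qed.

Lemma ocompl_basis i : (i < n)%N -> Q (e i) = 0.
Proof. by move=> hi; rewrite /ocompl oproj_basis // subrr. Qed.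

Lemma ocomplK x : Q (Q x) = Q x.
Proof.
rewrite {1}/ocompl (_ : oproj ip n e (Q x) = 0) ?subr0 //.
by rewrite /ocompl (linB (bdd_lin (bdd_oproj ip_norm n e))) oprojK // subrr.
Qed.

Lemma ocompl_eq0 x : Q x = 0 -> x = comb e (coords ip n e x).
Proof. by move/eqP; rewrite subr_eq0 => /eqP. Qed.

Lemma ocomplKe i : (i < n)%N -> Q (K (e i)) = 0.
Proof.
move=> hi; rewrite hK // (lin_sum lQ) big1 // => j _.
by rewrite (linZ lQ) ocompl_basis ?scaler0 // (leq_trans (ltn_ord j)).
Qed.

Lemma tail_comb (u : 'rV_n) : Kt (comb e u) = 0.
Proof.
rewrite /tail_op (lin_sum lK) (lin_sum lQ) big1 // => i _.
by rewrite (linZ lK) (linZ lQ) ocomplKe ?scaler0.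
Qed.

Lemma bdd_tail : bdd Kt.
Proof. exact: (bdd_comp bdd_ocompl bK). Qed.
Let lKt := bdd_lin bdd_tail.

Lemma tail_ocompl x : Kt (Q x) = Kt x.
Proof. by rewrite {1}/ocompl (linB lKt) /oproj tail_comb subr0. Qed.

Lemma ocompl_tail x : Q (Kt x) = Kt x.
Proof. exact: ocomplK. Qed.

Lemma ocompl_papp p x : Q (papp K p x) = papp Kt p (Q x).
Proof. by apply: papp_intertwine => // y; rewrite tail_ocompl. Qed.

Lemma tail_compact : compact_op H Kt.
Proof. exact: (compact_op_comp bdd_ocompl cK). Qed.

Lemma tail_lower_bound : exists2 c : R, 0 < c & forall z, d <= rn z ->
  forall x, c * rn z * rn x <= rn (z *: x - Kt x).
Proof. exact: (compact_lower_bound ip_norm tail_compact d0 noev). Qed.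

Lemma tail_powers : exists N th, [/\ (0 < N)%N, 0 <= th, th < 1 &
  forall x, rn (iter N Kt x) <= th * d ^+ N * rn x].
Proof.
have [c c0 low] := tail_lower_bound.
exact: (spectral_radius_lt ip_norm bdd_tail c0 d0 low).
Qed.

Lemma tail_shift_inverse z : d <= rn z ->
  exists U, [/\ bdd U, cancel (shift_op Kt z) U & cancel U (shift_op Kt z)].
Proof.
move=> dz; apply: (compact_shift_inverse ip_norm tail_compact).
  by rewrite -rn_gt0; apply: lt_le_trans dz.
move=> x y; rewrite /shift_op => h; apply/eqP; rewrite -subr_eq0; apply/eqP.
apply: (noev dz); rewrite -/(Kt _) (linB lKt) scalerBr.
move/eqP: h; rewrite subr_eq => /eqP ->.
by rewrite [Kt y - _]addrC addrAC addrK addrC.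
Qed.

Definition diag_seq := mkseq mu n.

Lemma mem_diag_seq a : a \in diag_seq -> d <= rn a.
Proof. by rewrite /diag_seq /mkseq => /mapP; case=> j; rewrite mem_iota => /andP[_ hj] ->; exact: dmu. Qed.

Lemma tail_poly_inverse (s : seq R[i]) : (forall a, a \in s -> d <= rn a) ->
  let W := papp Kt (\prod_(a <- s) ('X - a%:P)) in
  exists U, [/\ bdd U, cancel W U & cancel U W].
Proof.
elim: s => [|a s IH] hs W.
  exists id; split; first exact: bdd_id.
    by move=> x; rewrite /W big_nil papp1.
  by move=> x; rewrite /W big_nil papp1.
have [b bs|U [bU WU UW]] := IH; first by apply: hs; rewrite inE bs orbT.
have [|V [bV aV Va]] := @tail_shift_inverse a; first by apply: hs; rewrite mem_head.
have WE x : W x = shift_op Kt a (papp Kt (\prod_(a <- s) ('X - a%:P)) x).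
  by rewrite /W big_cons pappM // papp_XsubC.
exists (U \o V); split; first exact: bdd_comp.
  by move=> x /=; rewrite WE aV WU.
by move=> x /=; rewrite WE UW Va.
Qed.

Definition diag_poly := \prod_(a <- diag_seq) ('X - a%:P).
Local Notation chi := diag_poly.

(** Cayley-Hamilton for a triangular matrix: [K - mu k] sends [e k] into the span of the previous
    vectors, which the product of the first [k] factors kills. *)
Lemma diag_poly_basis i : (i < n)%N -> papp K chi (e i) = 0.
Proof.
move=> hi; rewrite /diag_poly /diag_seq /mkseq big_map -[n]subn0 -/(index_iota 0 n).
suff F k : (k <= n)%N -> forall i, (i < k)%N ->
    papp K (\prod_(0 <= j < k) ('X - (mu j)%:P)) (e i) = 0 by rewrite F.
elim: k {i hi} => [//|k IH] kn i; rewrite ltnS leq_eqVlt => /orP[/eqP -> |hi].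
  rewrite big_nat_recr //= pappM // papp_XsubC hK // big_ord_recr /= addrK.
  rewrite (lin_sum (papp_lin lK _)) big1 // => j _.
  by rewrite (linZ (papp_lin lK _)) IH ?scaler0 // ltnW.
rewrite big_nat_recr //= mulrC pappM // IH //; first exact: (lin0 (papp_lin lK _)).
exact: ltnW.
Qed.

Lemma diag_poly_comb (u : 'rV_n) : papp K chi (comb e u) = 0.
Proof.
rewrite (lin_sum (papp_lin lK _)) big1 // => i _.
by rewrite (linZ (papp_lin lK _)) diag_poly_basis ?scaler0.
Qed.

(* The complement: an idempotent commuting with K whose kernel is the span of e  *)
(* and on whose range K is similar to the tail operator.                         *)
Lemma complement_exists : exists L : H -> H,
  [/\ bdd L, forall x, Q (L (Q x)) = Q x &
      forall p x, papp K p (L x) = L (papp Kt p x)].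
Proof.
have [U [bU WU UW]] := tail_poly_inverse mem_diag_seq; rewrite -/diag_poly in WU UW.
have lU := bdd_lin bU.
have UKt x : U (Kt x) = Kt (U x).
  by rewrite -[x in LHS]UW -papp_comm // WU.
have UQ x : U (Q x) = Q (U x).
  rewrite -[x in LHS]UW (papp_intertwine (T2 := Kt)) ?WU // => y.
  by rewrite ocompl_tail tail_ocompl.
(* The witness is [chi(K)] after the inverse [U] of [chi(Kt)]. As [chi(K)] kills the span of [e], it
   does not see the difference between [Kt] and [K], whence the intertwining. *)
exists (fun x => papp K chi (U x)); split.
- exact: (bdd_comp (bdd_papp _ bK) bU).
- by move=> x; rewrite ocompl_papp -UQ ocomplK UW.
move=> p x; have KL y : papp K chi (U (Kt y)) = K (papp K chi (U y)).
  rewrite UKt -papp_comm // /tail_op {1}/ocompl (linB (papp_lin lK _)).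
  by rewrite diag_poly_comb subr0.
symmetry; apply: (@papp_intertwine _ _ (fun x => papp K chi (U x))) => //.
by move=> a u v; rewrite lU (papp_lin lK).
Qed.

(** The matrix of [p(K)] on the span of [e], acting on row vectors; products therefore appear in
    reverse order in [compressM]. *)
Definition compress p : 'M[R[i]]_n := \matrix_(i, j) ip (papp K p (e i)) (e j).

Lemma papp_basis p (i : 'I_n) : papp K p (e i) = comb e (row i (compress p)).
Proof.
rewrite [LHS]ocompl_eq0; last by rewrite ocompl_papp ocompl_basis // (lin0 (papp_lin lKt _)).
by congr comb; apply/rowP => j; rewrite !mxE.
Qed.

Lemma papp_comb p (u : 'rV_n) : papp K p (comb e u) = comb e (u *m compress p).
Proof.
rewrite {1}/comb (lin_sum (papp_lin lK _)) mulmx_sum_row (lin_sum (@comb_lin _ _ _ _)).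
apply: eq_bigr => i _.
by rewrite (linZ (papp_lin lK _)) papp_basis (linZ (@comb_lin _ _ _ _)).
Qed.

Lemma compressM p q : compress (p * q) = compress q *m compress p.
Proof.
apply/row_matrixP => i; rewrite row_mul.
have := papp_basis (p * q) i; rewrite pappM // papp_basis papp_comb => /(congr1 (coords ip n e)).
by rewrite !coords_comb.
Qed.

Lemma compress_linear : linear compress.
Proof. by move=> a p q; apply/matrixP => i j; rewrite !mxE papp_linear ipDl ipZl. Qed.

Lemma compress1 : compress 1 = 1%:M.
Proof. by apply/matrixP => i j; rewrite !mxE papp1 he. Qed.

Lemma compress_triangular p :
  (forall i j : 'I_n, (i < j)%N -> compress p i j = 0) /\ forall i, compress p i i = p.[mu i].
Proof.
have tX (i j : 'I_n) : (i < j)%N -> compress 'X i j = 0.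
  move=> ij; rewrite mxE pappX hK // ip_suml big1 // => k _.
  rewrite ipZl he ?(leq_trans (ltn_ord k)) // ltn_eqF ?mulr0 //.
  exact: leq_trans (ltn_ord k) ij.
elim/poly_ind: p => [|p c [IH1 IH2]].
  have -> : compress 0 = 0 by exact: (lin0 compress_linear).
  by split=> [i j _|i]; rewrite mxE ?horner0.
have E : compress (p * 'X + c%:P) = compress 'X *m compress p + c%:M.
  rewrite -compressM (linD compress_linear); congr (_ + _).
  by rewrite -alg_polyC (linZ compress_linear) compress1 scalemx1.
rewrite E; split=> [i j ij|i]; rewrite !mxE.
  rewrite big1 => [|k _]; first by rewrite -val_eqE (ltn_eqF ij) addr0.
  by case: (ltnP i k) => h; [rewrite tX ?mul0r | rewrite IH1 ?mulr0 // (leq_ltn_trans h)].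
rewrite (bigD1 i) //= big1 => [|k ki].
  rewrite addr0 eqxx IH2 hornerMXaddC mulrC; congr (_ * _ + _).
  by rewrite mxE pappX.
move: ki; rewrite -val_eqE neq_ltn => /orP[h|h]; last by rewrite tX ?mul0r.
by rewrite IH1 ?mulr0.
Qed.

End Decomposition.

(** In the rank factorization [A = C B], idempotence forces [B C = 1], of size the rank, and the
    trace is cyclic. *)
Lemma mxtrace_idempotent (F : fieldType) n (A : 'M[F]_n) : A *m A = A -> \tr A = (\rank A)%:R.
Proof.
move=> AA; rewrite -{1}(mulmx_base A) mxtrace_mulC.
suff -> : row_base A *m col_base A = 1%:M by rewrite mxtrace1.
apply: (row_full_inj (col_base_full A)); apply: (row_free_inj (row_base_free A)).
by rewrite mulmx1 mulmx_base mulmxA mulmx_base -mulmxA mulmx_base AA.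
Qed.

Lemma le_geometric (R : realType) (x B th : R) : 0 <= th -> th < 1 ->
  (forall q, x <= B * th ^+ q.+1) -> x <= 0.
Proof.
move=> t0 t1 h; rewrite leNgt; apply/negP => x0.
have : (fun n => B * th ^+ n) @ \oo --> (B * 0 : R).
  by apply: cvgMr; apply: cvg_expr; rewrite ger0_norm.
rewrite mulr0 => /cvgrPdist_lt/(_ x x0) [N _ hN].
have := hN N.+1 (leqnSn N); rewrite /= sub0r normrN ltNge => /negP; apply.
exact: le_trans (h N) (ler_norm _).
Qed.

(** * Spectrum, spectral projections and generalized eigenspaces *)

Section SpectralFacts.
Context (R : realType) (H : completeNormedModType R[i]).
Context (ip : {dot H for (@Num.conj R[i])}).
Context (ip_norm : forall x : H, ip x x = `|x| ^+ 2).
Context (K : H -> H) (d : R) (cK : compact_op H K) (d0 : 0 < d).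
Context (n : nat) (e : nat -> H) (fe : schur_family ip K d n e).
Context (noev : forall z x, d <= rn z -> ocompl ip n e (K x) = z *: x -> x = 0).

Let bK := compact_bdd cK.
Let lK := bdd_lin bK.
Let he : orthonormal_family ip n e. Proof. by case: fe. Qed.

Local Notation Q := (ocompl ip n e).
Local Notation Kt := (tail_op ip K n e).
Local Notation ds := (diag_seq ip K n e).
Local Notation chi := (diag_poly ip K n e).
Local Notation cmp := (compress ip K n e).
Let lKt : linear Kt := bdd_lin (bdd_tail ip_norm cK n e).

Lemma nth_diag_seq (i : 'I_n) : diag_entry ip K e i \in ds.
Proof. by apply: map_f; rewrite mem_iota add0n ltn_ord. Qed.

(** By the Fredholm alternative only injectivity of [K - z] matters. An eigenvector has zero
    component in the complement, as the tail has no such eigenvalue, so it lives in the span, where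
    a triangular matrix decides. *)
Lemma spectrum_compact z : d <= rn z -> spectrum K z <-> z \in ds.
Proof.
move=> dz; split=> [sz|].
  apply: contrapT => /negP nz; apply: sz.
  have [||U [bU UK KU]] := @compact_shift_inverse R H ip ip_norm K cK z _ _.
  - by rewrite -rn_gt0; apply: lt_le_trans dz.
  - move=> x y; rewrite /shift_op => h; apply/eqP; rewrite -subr_eq0; apply/eqP.
    set v := x - y; have Kv : K v = z *: v.
      rewrite /v (linB lK) scalerBr; move/eqP: h; rewrite subr_eq => /eqP ->.
      by rewrite [K y - _]addrC addrAC addrK addrC.
    have Qv : Q v = 0.
      apply: (noev dz); rewrite -/(Kt (Q v)) (tail_ocompl ip_norm cK fe) /tail_op Kv.
      exact: (linZ (bdd_lin (bdd_ocompl ip_norm n e))).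
    have vE : v = comb e (coords ip n e v) by exact: ocompl_eq0.
    set u := coords ip n e v in vE.
    have : u *m cmp ('X - z%:P) = 0.
      rewrite -(coords_comb (u *m _) he) -(papp_comb ip_norm cK fe) -vE papp_XsubC //.
      by rewrite Kv subrr (lin0 (coords_lin ip n e)).
    have [tr dg] := compress_triangular ip_norm cK fe ('X - z%:P).
    have uM : cmp ('X - z%:P) \in unitmx.
      rewrite unitmxE det_trig; last by apply/is_trig_mxP.
      rewrite unitfE prodf_seq_neq0; apply/allP => i _ /=.
      rewrite dg hornerXsubC subr_eq0; apply: contra nz => /eqP <-.
      exact: nth_diag_seq.
    by move/(congr1 (mulmx^~ (invmx (cmp ('X - z%:P))))); rewrite mulmxK // mul0mx vE => ->;
       rewrite (lin0 (@comb_lin _ _ _ _)).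
  exists U; split; first by apply/bddP.
    by apply/funext => x /=; rewrite UK.
  by apply/funext => x /=; rewrite KU.
rewrite /diag_seq /mkseq => /mapP; case=> j; rewrite mem_iota add0n => /andP[_ hj] zj.
pose i := Ordinal hj; rewrite -[j]/(val i) in zj.
have [tr dg] := compress_triangular ip_norm cK fe ('X - z%:P).
have : \det (cmp ('X - z%:P)) = 0.
  rewrite det_trig; last by apply/is_trig_mxP.
  by rewrite (bigD1 i) //= dg hornerXsubC -zj subrr mul0r.
move/eqP/det0P => [u u0 uM] [U [_ UK _]].
have : shift_op K z (comb e u) = 0.
  by rewrite /shift_op -papp_XsubC // (papp_comb ip_norm cK fe) uM (lin0 (@comb_lin _ _ _ _)).
move/(congr1 U); have E0 : U (shift_op K z 0) = 0 by exact: (congr1 (@^~ 0) UK).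
rewrite {1}/shift_op (lin0 lK) scaler0 subr0 in E0.
rewrite E0 -[U _]/((U \o shift_op K z) _) UK => /(congr1 (coords ip n e)).
rewrite coords_comb // (lin0 (coords_lin ip n e)) => uz.
by rewrite uz eqxx in u0.
Qed.

(** Suppose [K] has an inverse bounded by [C], and let [P K] be within [1 / (C * 2)] of [K]. A unit
    vector orthogonal to the finitely many vectors defining [P K] has [rn (K x) <= 1 / (C * 2)],
    whereas the inverse forces [1 <= C * rn (K x)]. *)
Lemma spectrum_zero : infinite_dimensional H -> spectrum K 0.
Proof.
move=> Hinf [U [bU UK KU]]; have {}bU : bdd U by apply/bddP.
have [C C0 hC] := bdd_gt0 bU.
have [m [f [_ hf _ hP]]] := compact_approx ip_norm cK he (divr_gt0 (ltr01 : 0 < 1 :> R) (mulr_gt0 C0 (ltr0n R 2))).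
have [Ks hKs] := adjoint_exists ip_norm bK.
have [m' [g [mm hg _ hy]]] := gram_schmidt ip_norm [seq Ks (f i) | i <- iota 0 m] (orthonormal_family0 ip f).
have [x [x1 xo]] := infinite_orthogonal Hinf hg.
have PKx : oproj ip m f (K x) = 0.
  rewrite oprojE big1 // => i _; rewrite hKs.
  have [|u ->] := hy (Ks (f i)); first by apply: map_f; rewrite mem_iota add0n ltn_ord.
  by rewrite ip_orth_comb ?scale0r.
have := hP x; rewrite PKx subr0 x1 mulr1 => h.
have xE : U (K x) = x.
  by rewrite -[RHS]/(id x) -UK /= /shift_op scale0r subr0.
have := hC (K x); rewrite xE x1 => h2.
have : 1 <= C * (1 / (C * 2)) by apply: le_trans h2 _; rewrite ler_pM2l.
have -> : C * (1 / (C * 2)) = 2^-1 by field; rewrite gt_eqF.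
by rewrite leNgt invf_lt1 ?ltr1n.
Qed.

Lemma dvd_diag_poly p : (forall a, a \in ds -> ('X - a%:P) ^+ n %| p) -> chi %| p.
Proof.
move=> hp; apply: (@dvdp_trans _ (\prod_(a <- undup ds) ('X - a%:P) ^+ n)).
  by apply: dvd_prod_undup; rewrite size_mkseq.
by apply: dvd_prod_XsubC; [exact: undup_uniq | move=> a; rewrite mem_undup; exact: hp].
Qed.

Lemma compress_dvd p : chi %| p -> cmp p = 0.
Proof.
move=> hp; apply/matrixP => i j; rewrite !mxE.
by rewrite (papp_dvd lK hp) ?ip0l // (diag_poly_basis cK fe).
Qed.

Lemma complement_comb (L : H -> H) x : (forall y, Q (L (Q y)) = Q y) ->
  x - L (Q x) = comb e (coords ip n e (x - L (Q x))).
Proof.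
by move=> QLQ; apply: ocompl_eq0; rewrite (linB (bdd_lin (bdd_ocompl ip_norm n e))) QLQ subrr.
Qed.

Section Weight.
Context (w : R[i] -> bool) (q : {poly R[i]}).
Context (hq : forall a, a \in ds -> ('X - a%:P) ^+ n %| q - ((w a)%:R)%:P).

(** At each diagonal value [q] is congruent to 0 or 1 to order [n], so [q ^+ 2 - q] is divisible by
    the annihilating polynomial [chi]. *)
Lemma compress_idempotent : cmp q *m cmp q = cmp q.
Proof.
rewrite -(compressM ip_norm cK fe); apply/eqP; rewrite -subr_eq0.
rewrite -(linB (compress_linear ip K n e)); apply/eqP/compress_dvd/dvd_diag_poly => a ha.
have -> : q * q - q = (q - ((w a)%:R)%:P) * (q + ((w a)%:R)%:P - 1).
  by case: (w a); rewrite ?mulr1n ?mulr0n /=; [rewrite polyC1|rewrite polyC0]; ring.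
by rewrite dvdp_mulr // hq.
Qed.

(** The rank of an idempotent is its trace, and the diagonal entries of this one are [q.[mu i]],
    that is [w (mu i)]. *)
Lemma rank_compress : \rank (cmp q) = count w ds.
Proof.
have /mxtrace_idempotent := compress_idempotent.
have -> : \tr (cmp q) = \sum_(i < n) (w (diag_entry ip K e i))%:R.
  apply: eq_bigr => i _; have [_ ->] := compress_triangular ip_norm cK fe q.
  have := hq (nth_diag_seq i).
  have n0 : (0 < n)%N by apply: leq_ltn_trans (ltn_ord i).
  move=> /(dvdp_trans (_ : 'X - _ %| _)) => h.
  have /h : 'X - (diag_entry ip K e i)%:P %| ('X - (diag_entry ip K e i)%:P) ^+ n.
    by rewrite -{1}['X - _]expr1 dvdp_exp2l.
  by rewrite dvdp_XsubCl rootE hornerD hornerN hornerC subr_eq0 => /eqP.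
rewrite -natr_sum => /eqP; rewrite eqr_nat => /eqP <-.
rewrite /diag_seq /mkseq count_map -sum1_count.
have -> : iota 0 n = index_iota 0 n by rewrite /index_iota subn0.
by rewrite big_mkord [RHS]big_mkcond; apply: eq_bigr => i _ /=; case: (w _).
Qed.

Lemma dim_weight_space (V : set H) :
  (forall x, V x <-> exists u : 'rV_n, x = papp K q (comb e u)) ->
  subspace_dim V = (count w ds)%:R%:E.
Proof.
move=> VE; rewrite -rank_compress; apply: (subspace_dim_image (@comb_lin _ _ n e)).
  by move=> u _ h; rewrite -(coords_comb u he) h (lin0 (coords_lin ip n e)).
move=> x; split=> [/VE [u ->]|[u /submxP [v ->] ->]].
  by exists (u *m cmp q); [exact: submxMl | rewrite (papp_comb ip_norm cK fe)].
by apply/VE; exists v; rewrite (papp_comb ip_norm cK fe).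
Qed.
End Weight.

Definition gen_eigenspace l : set H := [set x | exists k, papp K (('X - l%:P) ^+ k) x = 0].

(** The generalized eigenspace is the image of the span of [e] under [q(K)], where [q] is congruent
    to 1 at [l] and to 0 at the other diagonal values. A generalized eigenvector has no component in
    the complement, since the tail has no eigenvalue [l]. *)
Lemma dim_gen_eigenspace l : d <= rn l ->
  subspace_dim (gen_eigenspace l) = (count_mem l ds)%:R%:E.
Proof.
(* [l] is added to the list to cover the case in which it is not a diagonal value, with dimension
   0. *)
move=> dl; have [q hq] := chinese_poly n (fun a => (pred1 l a)%:R) (undup_uniq (l :: ds)).
have {}hq a : a \in l :: ds -> ('X - a%:P) ^+ n %| q - ((pred1 l a)%:R)%:P.
  by rewrite -mem_undup; exact: hq.
have hq' a : a \in ds -> ('X - a%:P) ^+ n %| q - ((pred1 l a)%:R)%:P.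
  by move=> h; apply: hq; rewrite inE h orbT.
apply: (dim_weight_space hq') => x; split; last first.
  move=> [u ->]; exists n; rewrite -pappM //; apply: (papp_dvd lK _ (diag_poly_comb cK fe u)).
  apply: dvd_diag_poly => a ha; have [->|al] := eqVneq a l; first by rewrite dvdp_mulr.
  by have := hq' a ha; rewrite /= (negPf al) mulr0n polyC0 subr0 => h; rewrite dvdp_mull.
move=> [k hk].
have Qx : Q x = 0.
  have : papp Kt (('X - l%:P) ^+ k) (Q x) = 0.
    by rewrite -(ocompl_papp ip_norm cK fe) hk (lin0 (bdd_lin (bdd_ocompl ip_norm n e))).
  elim: k {hk} => [|k IH]; first by rewrite expr0 papp1.
  rewrite exprS pappM // papp_XsubC // => /eqP; rewrite subr_eq0 => /eqP h.
  apply: IH; apply: (noev dl); rewrite -/(Kt _) h //.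
have xE := ocompl_eq0 Qx; set u := coords ip n e x in xE.
exists u; rewrite -xE; apply/eqP; rewrite eq_sym -subr_eq0 -{2}[x](papp1 K) -pappB; apply/eqP.
(* The vector [v = q(K) x - x] is killed by a power of ['X - l%:P] and by the product [r] over the
   other diagonal values; these are coprime, so [v = 0]. *)
set v := papp K _ x.
pose r := \prod_(a <- rem l (undup (l :: ds))) ('X - a%:P) ^+ n.
have lu : l \in undup (l :: ds) by rewrite mem_undup mem_head.
have rv : papp K r v = 0.
  rewrite /v -pappM // xE; apply: (papp_dvd lK _ (diag_poly_comb cK fe u)).
  apply: dvd_diag_poly => a ha; have [->|al] := eqVneq a l.
    by have := hq l (mem_head _ _); rewrite /= eqxx => h; rewrite dvdp_mull.
  have au : a \in undup (l :: ds) by rewrite mem_undup inE ha orbT.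
  have ar : a \in rem l (undup (l :: ds)) by rewrite (mem_rem_uniq _ (undup_uniq _)) inE al.
  by rewrite dvdp_mulr // /r (big_rem a ar) dvdp_mulr.
have kv : papp K (('X - l%:P) ^+ k) v = 0.
  by rewrite /v -pappM // mulrC pappM // hk (lin0 (papp_lin lK _)).
have cop : coprimep (('X - l%:P) ^+ k) r.
  case: (posnP n) => [n0|npos].
    rewrite /r big1 ?coprimep1 // => a _; by rewrite n0 expr0.
  apply: coprimep_expl; rewrite -(coprimep_pexpl _ _ npos); apply: coprime_XsubC_prod.
  by rewrite (mem_rem_uniq _ (undup_uniq _)) inE eqxx.
have [[a b] /= ab] := Bezout_eq1_coprimepP _ _ cop.
by rewrite -[v](papp1 K) -ab pappD !pappM // kv rv (lin0 (papp_lin lK a)) (lin0 (papp_lin lK b)) addr0.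
Qed.

Lemma count_diag_seq_opp :
  (forall l, l != 0 -> subspace_dim (gen_eigenspace l) = subspace_dim (gen_eigenspace (- l))) ->
  forall l, count_mem l ds = count_mem (- l) ds.
Proof.
move=> hl l; have [dl|ld] := leP d (rn l).
  have l0 : l != 0 by rewrite -rn_gt0; apply: lt_le_trans dl.
  have := hl l l0; rewrite !dim_gen_eigenspace ?rnN //.
  by move=> [/eqP]; rewrite eqr_nat => /eqP.
have nz a : rn a < d -> count_mem a ds = 0%N.
  move=> ha; apply/count_memPn/negP => /(mem_diag_seq fe); by rewrite leNgt ha.
by rewrite !nz ?rnN.
Qed.

End SpectralFacts.

(** * Contour integrals *)

Section UnitIntegral.
Context (R : realType).
Implicit Types (h phi : R -> R).

Local Notation int01 h := (\int[lebesgue_measure]_(t in `[0%R, 1%R]) h t).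

Definition unit_continuous h := forall t, 0 <= t <= 1 -> forall e : R, 0 < e ->
  exists2 d : R, 0 < d & forall s, 0 <= s <= 1 -> `|s - t| < d -> `|h s - h t| < e.

Definition unit_derivative phi h := forall t, 0 <= t <= 1 -> forall e : R, 0 < e ->
  exists2 d : R, 0 < d & forall s, `|s - t| < d -> `|phi s - phi t - (s - t) * h t| <= e * `|s - t|.

Lemma unit_continuous_within h : unit_continuous h -> {within `[0%R, 1%R], continuous h}.
Proof.
move=> ch; apply/subspace_continuousP => t; rewrite /= in_itv /= => t01.
apply/cvgrPdist_lt => e e0; have [d dp hd] := ch t t01 e e0.
rewrite near_withinE; near=> s => s01; rewrite distrC; apply: hd.
  by move: s01; rewrite /= in_itv.
by rewrite distrC; near: s; exists d.
Unshelve. all: by end_near. Qed.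

Lemma unit_integrable h : unit_continuous h ->
  lebesgue_measure.-integrable `[0%R, 1%R] (EFin \o h).
Proof.
move=> /unit_continuous_within; apply: continuous_compact_integrable.
exact: segment_compact.
Qed.

Lemma int01D f g : unit_continuous f -> unit_continuous g ->
  int01 (fun t => f t + g t) = int01 f + int01 g.
Proof. by move=> cf cg; rewrite RintegralD //; exact: unit_integrable. Qed.

Lemma int01Z c f : unit_continuous f -> int01 (fun t => c * f t) = c * int01 f.
Proof. by move=> cf; rewrite RintegralZl //; exact: unit_integrable. Qed.

Lemma int01_bound f M : unit_continuous f ->
  (forall t, 0 <= t <= 1 -> `|f t| <= M) -> `|int01 f| <= M.
Proof.
move=> cf hM; apply: le_trans (le_normr_Rintegral _ _) _ => //; first exact: unit_integrable.
have ca : unit_continuous (fun t => `|f t|).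
  move=> t t01 e e0; have [d d0 hd] := cf t t01 e e0; exists d => // s s01 st.
  exact: le_lt_trans (ler_dist_dist _ _) (hd s s01 st).
have -> : M = int01 (fun _ => M).
  by rewrite Rintegral_cst //= lebesgue_measure_itv /= lte01 oppr0 adde0 /= mulr1.
apply: le_Rintegral => //; first exact: unit_integrable.
  by apply: unit_integrable => t _ e e0; exists 1 => // s _ _; rewrite subrr normr0.
Qed.

Lemma unit_derivative_is_derive phi h (t : R) : unit_derivative phi h -> 0 <= t <= 1 ->
  is_derive t 1 phi (h t).
Proof.
move=> dh t01.
have cv : (fun s : R => s^-1 *: (phi (s *: 1 + t) - phi t)) @ 0^' --> h t.
  apply/cvgrPdist_le => e e0; have [d d0 hd] := dh t t01 e e0.
  near=> s; have s0 : s != 0 by near: s; exact: nbhs_dnbhs_neq.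
  have sd : `|s| < d.
    by near: s; apply: dnbhs0_lt.
  have := hd (s + t); rewrite addrK => /(_ sd).
  rewrite /GRing.scale /= mulr1 distrC => hs.
  rewrite -(ler_pM2r (_ : 0 < `|s|)) ?normr_gt0 //.
  rewrite -normrM mulrBl mulrAC mulVf // mul1r [h t * s]mulrC.
  exact: hs.
have dv : derivable phi t 1 by apply/cvg_ex; exists (h t).
by split=> //; apply/cvg_lim.
Unshelve. all: by end_near. Qed.

Lemma int01_FTC_is_derive phi h : unit_continuous h ->
  (forall t : R, 0 <= t <= 1 -> is_derive t 1 phi (h t)) -> int01 h = phi 1 - phi 0.
Proof.
move=> ch id.
have ct (t : R) : 0 <= t <= 1 -> {for t, continuous phi}.
  move=> t01; apply: differentiable_continuous; apply/derivable1_diffP.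
  by case: (id t t01).
have := @continuous_FTC2 R h phi 0 1 ltr01 (unit_continuous_within ch).
rewrite /Rintegral => ->//.
- split.
  + by move=> t; rewrite in_itv /= => /andP[/ltW t0 /ltW t1]; case: (id t); rewrite ?t0.
  + by apply: cvg_at_right_filter; apply: ct; rewrite lexx ler01.
  + by apply: cvg_at_left_filter; apply: ct; rewrite lexx ler01.
- move=> t; rewrite in_itv /= => /andP[/ltW t0 /ltW t1].
  by rewrite derive1E; have [_ ->] := id t (introT andP (conj t0 t1)).
Qed.

Lemma int01_FTC phi h : unit_continuous h -> unit_derivative phi h ->
  int01 h = phi 1 - phi 0.
Proof.
by move=> ch dh; apply: int01_FTC_is_derive => // t; exact: unit_derivative_is_derive.
Qed.

End UnitIntegral.

(** * Continuity and complex derivatives along sets *)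

Section ComplexFunctions.
Context (R : realType).
Implicit Types (S : set R[i]) (f g F G : R[i] -> R[i]) (z w mu : R[i]).

Definition cts S f := forall z, S z -> forall e : R, 0 < e ->
  exists2 d : R, 0 < d & forall w, S w -> rn (w - z) < d -> rn (f w - f z) < e.

(** Increments [w] range over a full neighbourhood of [z], not only over [S] as in [cts]; so
    restriction to a segment is also differentiable at its end points. *)
Definition cderiv S F f := forall z, S z -> forall e : R, 0 < e ->
  exists2 d : R, 0 < d & forall w, rn (w - z) < d ->
    rn (F w - F z - (w - z) * f z) <= e * rn (w - z).

Lemma ctsS S S' f : S' `<=` S -> cts S f -> cts S' f.
Proof.
move=> SS cf z Sz e e0; have [d d0 hd] := cf z (SS _ Sz) e e0.
by exists d => // w Sw; apply: hd; exact: SS.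
Qed.

Lemma cts_cst S c : cts S (fun _ => c).
Proof. by move=> z _ e e0; exists 1 => // w _ _; rewrite subrr rn0. Qed.

Lemma ctsD S f g : cts S f -> cts S g -> cts S (fun z => f z + g z).
Proof.
move=> cf cg z Sz e e0; have e2 : 0 < e / 2 by rewrite divr_gt0.
have [d1 d10 h1] := cf z Sz _ e2; have [d2 d20 h2] := cg z Sz _ e2.
exists (Num.min d1 d2); first by rewrite lt_min d10.
move=> w Sw; rewrite lt_min => /andP[w1 w2].
rewrite opprD addrACA [e]splitr; apply: le_lt_trans (rnD _ _) _.
by apply: ltrD; [exact: h1 | exact: h2].
Qed.

Lemma ctsZ S c f : cts S f -> cts S (fun z => c * f z).
Proof.
move=> cf z Sz e e0; have cp : 0 < rn c + 1 by rewrite ltr_wpDl ?rn_ge0.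
have [|d d0 hd] := cf z Sz (e / (rn c + 1)); first by rewrite divr_gt0.
exists d => // w Sw wz; rewrite -mulrBr rnM.
have := hd w Sw wz; rewrite ltr_pdivlMr // => h; apply: le_lt_trans h.
by rewrite mulrC ler_wpM2l ?rn_ge0 // lerDl.
Qed.

Lemma cts_sum S I (r : seq I) (f : I -> R[i] -> R[i]) :
  (forall i, cts S (f i)) -> cts S (fun z => \sum_(i <- r) f i z).
Proof.
move=> cf; elim: r => [|i r IH].
  by under eq_fun do rewrite big_nil; exact: cts_cst.
by under eq_fun do rewrite big_cons; exact: ctsD.
Qed.

Lemma cderiv_lipschitz S F f z : cderiv S F f -> S z ->
  exists2 d : R, 0 < d & forall w, rn (w - z) < d -> rn (F w - F z) <= (rn (f z) + 1) * rn (w - z).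
Proof.
move=> dF Sz; have [d d0 hd] := dF z Sz 1 ltr01; exists d => // w wz.
rewrite -[F w - F z](subrK ((w - z) * f z)); apply: le_trans (rnD _ _) _.
rewrite rnM; have := hd w wz; nra.
Qed.

Lemma cderiv_cts S F f : cderiv S F f -> cts S F.
Proof.
move=> dF z Sz e e0; have [d d0 hd] := cderiv_lipschitz dF Sz.
have cp : 0 < rn (f z) + 1 by rewrite ltr_wpDl ?rn_ge0.
exists (Num.min d (e / (rn (f z) + 1))); first by rewrite lt_min d0 divr_gt0.
move=> w Sw; rewrite lt_min => /andP[w1 w2]; apply: le_lt_trans (hd w w1) _.
by rewrite mulrC -ltr_pdivlMr.
Qed.

Lemma cderiv_cst S c : cderiv S (fun _ => c) (fun _ => 0).
Proof.
move=> z _ e e0; exists 1 => // w _.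
by rewrite subrr mulr0 subrr rn0 mulr_ge0 ?rn_ge0 // ltW.
Qed.

Lemma cderiv_sub S mu : cderiv S (fun z => z - mu) (fun _ => 1).
Proof.
move=> z _ e e0; exists 1 => // w _.
by rewrite mulr1 opprB addrA subrK subrr rn0 mulr_ge0 ?rn_ge0 // ltW.
Qed.

Lemma cderivM S F G f g : cderiv S F f -> cderiv S G g ->
  cderiv S (fun z => F z * G z) (fun z => f z * G z + F z * g z).
Proof.
move=> dF dG z Sz e e0.
have [d1 d10 h1] := cderiv_lipschitz dF Sz.
set A := rn (f z) + 1 in h1; set B := rn (F z); set C := rn (G z); set D := rn (g z).
have A0 : 0 < A by rewrite ltr_wpDl ?rn_ge0.
have B0 : 0 <= B by exact: rn_ge0.
have C0 : 0 <= C by exact: rn_ge0.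
have D0 : 0 <= D by exact: rn_ge0.
pose M := A + B + C + A * D.
have M0 : 0 < M by rewrite /M; have := mulr_ge0 (ltW A0) D0; lra.
pose e' := e / M; have e'0 : 0 < e' by rewrite divr_gt0.
have eE : e = e' * M by rewrite /e' divfK // gt_eqF.
have [d2 d20 h2] := dF z Sz e' e'0; have [d3 d30 h3] := dG z Sz e' e'0.
exists (Num.min (Num.min d1 d2) (Num.min d3 (Num.min 1 e'))).
  by rewrite !lt_min d10 d20 d30 e'0 ltr01.
move=> w; rewrite !lt_min => /andP[/andP[w1 w2] /and3P[w3 w4 w5]].
have -> : F w * G w - F z * G z - (w - z) * (f z * G z + F z * g z) =
  (F w - F z) * (G w - G z - (w - z) * g z) + F z * (G w - G z - (w - z) * g z) +
  (F w - F z - (w - z) * f z) * G z + (F w - F z) * (w - z) * g z by ring.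
have {}h1 := h1 w w1; have {}h2 := h2 w w2; have {}h3 := h3 w w3.
apply: le_trans (rnD _ _) _; rewrite !rnM.
set t := rn (w - z) in h1 h2 h3 w4 w5 *; set X := rn (F w - F z) in h1 *.
have t0 : 0 <= t by exact: rn_ge0.
have X0 : 0 <= X by exact: rn_ge0.
apply: (@le_trans _ _ (A * t * (e' * t) + B * (e' * t) + e' * t * C + A * t * t * D)).
  apply: lerD.
    apply: le_trans (rnD _ _) _; rewrite !rnM; apply: lerD; last by rewrite ler_wpM2r.
    apply: le_trans (rnD _ _) _; rewrite !rnM; apply: lerD; last by rewrite ler_wpM2l.
    by apply: ler_pM => //; exact: rn_ge0.
  by rewrite ler_wpM2r // ler_wpM2r.
have q1 : A * t * (e' * t) <= A * (e' * t).
  by apply: ler_wpM2r; [rewrite mulr_ge0 // ltW | rewrite ler_piMr // ltW].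
have q2 : A * t * t * D <= A * (e' * t) * D.
  by apply: ler_wpM2r => //; rewrite -mulrA; apply: ler_wpM2l; [exact: ltW | apply: ler_wpM2r => //; exact: ltW].
rewrite eE /M; apply: le_trans (lerD (lerD (lerD q1 (lexx _)) (lexx _)) q2) _.
by rewrite le_eqVlt; apply/orP; left; apply/eqP; ring.
Qed.

Lemma cderiv_eq S F F' f f' : F =1 F' -> f =1 f' -> cderiv S F f -> cderiv S F' f'.
Proof. by move=> /funext <- /funext <-. Qed.

Lemma cderivZ S c F f : cderiv S F f -> cderiv S (fun z => c * F z) (fun z => c * f z).
Proof.
move=> dF; refine (cderiv_eq _ _ (cderivM (cderiv_cst (S:=S) c) dF)) => // z.
by rewrite mul0r add0r.
Qed.

Lemma cderivX S F f n : cderiv S F f ->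
  cderiv S (fun z => F z ^+ n.+1) (fun z => n.+1%:R * (F z ^+ n * f z)).
Proof.
move=> dF; elim: n => [|n IH]; first by refine (cderiv_eq _ _ dF) => z; rewrite ?expr1 // expr0 !mul1r.
refine (cderiv_eq _ _ (cderivM dF IH)) => z; rewrite ?exprS //.
by rewrite -[n.+2%:R]natr1; ring.
Qed.

Lemma cderivV S mu : ~ S mu ->
  cderiv S (fun z => (z - mu)^-1) (fun z => - (z - mu)^-1 ^+ 2).
Proof.
move=> Smu z Sz e e0.
have zm : z - mu != 0 by rewrite subr_eq0; apply/eqP => zm; apply: Smu; rewrite -zm.
have r0 : 0 < rn (z - mu) by rewrite rn_gt0.
set r := rn (z - mu) in r0.
exists (Num.min (r / 2) (e * r ^+ 3 / 2)); first by rewrite lt_min !divr_gt0 // mulr_gt0 // exprn_gt0.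
move=> w; rewrite lt_min => /andP[w1 w2].
have rw : r / 2 <= rn (w - mu).
  have := rn_dist_tri z w mu; rewrite -/r (rnBC z w); lra.
have wm : w - mu != 0 by rewrite -rn_gt0; apply: lt_le_trans rw; rewrite divr_gt0.
have -> : (w - mu)^-1 - (z - mu)^-1 - (w - z) * (- (z - mu)^-1 ^+ 2) =
   (w - z) ^+ 2 * ((w - mu)^-1 * (z - mu)^-1 ^+ 2) by field; rewrite zm wm.
rewrite rnM rnX rnM rnX !rnV -/r expr2 -mulrA mulrC ler_wpM2r ?rn_ge0 //.
set t := rn (w - z) in w1 w2 *.
apply: (@le_trans _ _ (t * ((r / 2)^-1 * r^-1 ^+ 2))).
  rewrite ler_wpM2l ?rn_ge0 // ler_wpM2r ?exprn_ge0 ?invr_ge0 ?(ltW r0) //.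
  by rewrite lef_pV2 ?posrE ?divr_gt0 // rn_gt0.
have -> : (r / 2)^-1 * r^-1 ^+ 2 = 2 / r ^+ 3 by field; rewrite gt_eqF.
rewrite mulrA ler_pdivrMr ?exprn_gt0 //; move: w2; set q := e * r ^+ 3; lra.
Qed.

Lemma cderiv_pow_inv S mu k : ~ S mu -> cderiv S
  (fun z => (- k.+1%:R^-1) * ((z - mu)^-1 ^+ k.+1)) (fun z => (z - mu)^-1 ^+ k.+2).
Proof.
move=> Smu; refine (cderiv_eq _ _ (cderivZ _ (cderivX k (cderivV Smu)))) => // z.
have k0 : k.+1%:R != 0 :> R[i] by rewrite pnatr_eq0.
by rewrite mulrA mulNr mulVf // mulN1r mulrN opprK -exprD addn2.
Qed.

Lemma cderiv_pow S mu k : cderiv S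
  (fun z => k.+1%:R^-1 * ((z - mu) ^+ k.+1)) (fun z => (z - mu) ^+ k).
Proof.
refine (cderiv_eq _ _ (cderivZ k.+1%:R^-1 (cderivX k (cderiv_sub (S:=S) mu)))) => // z.
by rewrite mulr1 mulrA mulVf ?mul1r // pnatr_eq0.
Qed.

Lemma cts_inv S mu : ~ S mu -> cts S (fun z => (z - mu)^-1).
Proof. by move=> /cderivV; exact: cderiv_cts. Qed.

Lemma cts_pow_inv S mu k : ~ S mu -> cts S (fun z => (z - mu)^-1 ^+ k.+1).
Proof. by move=> /cderivV /(cderivX k); exact: cderiv_cts. Qed.

Lemma cts_pow S mu k : cts S (fun z => (z - mu) ^+ k).
Proof.
case: k => [|k]; first by rewrite (_ : (fun z => _) = fun _ => 1); [exact: cts_cst|apply/funext => z; rewrite expr0].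
exact: cderiv_cts (cderivX k (cderiv_sub (S:=S) mu)).
Qed.

End ComplexFunctions.

Section Contours.
Context (R : realType).
Implicit Types (S : set R[i]) (f g F : R[i] -> R[i]) (a b z : R[i]) (G : seq (seq R[i])).

Local Notation int01 h := (\int[lebesgue_measure]_(t in `[0%R, 1%R]) h t).

Definition segment a b : set R[i] := [set z | exists2 t : R, 0 <= t <= 1 & z = segment_point a b t].

Lemma rn_segment_sub a b (s t : R) :
  rn (segment_point a b s - segment_point a b t) = `|s - t| * rn (b - a).
Proof.
rewrite /segment_point opprD addrACA subrr add0r -mulrBl -rmorphB /= rnM.
by rewrite rn_real.
Qed.

Lemma cts_segment (P : R[i] -> R) f a b : (forall u v, `|P u - P v| <= rn (u - v)) ->
  cts (segment a b) f -> unit_continuous (fun t => P (f (segment_point a b t))).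
Proof.
move=> hP cf t t01 e e0.
have [|d d0 hd] := cf (segment_point a b t) _ e e0; first by exists t.
have bp : 0 < rn (b - a) + 1 by rewrite ltr_wpDl ?rn_ge0.
exists (d / (rn (b - a) + 1)); first by rewrite divr_gt0.
move=> s s01 st; apply: le_lt_trans (hP _ _) _; apply: hd; first by exists s.
rewrite rn_segment_sub; move: st; rewrite ltr_pdivlMr //; apply: le_lt_trans.
by rewrite ler_wpM2l // lerDl.
Qed.

Lemma Re_lip u v : `|complex.Re u - complex.Re v| <= rn (u - v) :> R.
Proof. by rewrite -raddfB; exact: normRe_le_rn. Qed.

Lemma Im_lip u v : `|complex.Im u - complex.Im v| <= rn (u - v) :> R.
Proof. by rewrite -raddfB; exact: normIm_le_rn. Qed.

Lemma segment_integral_ext f g a b : (forall z, segment a b z -> f z = g z) ->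
  segment_integral f a b = segment_integral g a b.
Proof.
move=> fg; rewrite /segment_integral; congr (_ * (_ +i* _)%C);
by apply: eq_Rintegral => t; rewrite inE /= in_itv /= => t01; rewrite fg //; exists t.
Qed.

Lemma segment_integralD f g a b : cts (segment a b) f -> cts (segment a b) g ->
  segment_integral (fun z => f z + g z) a b = segment_integral f a b + segment_integral g a b.
Proof.
move=> cf cg; rewrite /segment_integral -mulrDr; congr (_ * _).
have hR h : (fun t => complex.Re (f (segment_point a b t) + h (segment_point a b t))) =
  fun t => complex.Re (f (segment_point a b t)) + complex.Re (h (segment_point a b t)).
  by apply/funext => t; rewrite raddfD.
have hI h : (fun t => complex.Im (f (segment_point a b t) + h (segment_point a b t))) =
  fun t => complex.Im (f (segment_point a b t)) + complex.Im (h (segment_point a b t)).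
  by apply/funext => t; rewrite raddfD.
by rewrite hR hI !int01D //; apply: cts_segment => //; (exact: Re_lip || exact: Im_lip).
Qed.

Lemma segment_integralZ c f a b : cts (segment a b) f ->
  segment_integral (fun z => c * f z) a b = c * segment_integral f a b.
Proof.
move=> cf; rewrite /segment_integral mulrCA; congr (_ * _).
have cR := cts_segment Re_lip cf; have cI := cts_segment Im_lip cf.
have cZ (k : R) h : unit_continuous h -> unit_continuous (fun t : R => k * h t).
  move=> ch t t01 e e0; have kp : 0 < `|k| + 1 by rewrite ltr_wpDl.
  have [|d d0 hd] := ch t t01 (e / (`|k| + 1)); first by rewrite divr_gt0.
  exists d => // s s01 st; rewrite -mulrBr normrM.
  have := hd s s01 st; rewrite ltr_pdivlMr // => h'; apply: le_lt_trans h'.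
  by rewrite mulrC ler_wpM2l // lerDl.
case: c => x y.
have hR : (fun t => complex.Re ((x +i* y)%C * f (segment_point a b t))) =
  fun t => x * complex.Re (f (segment_point a b t)) + (- y) * complex.Im (f (segment_point a b t)).
  by apply/funext => t; case: (f _) => u v /=; rewrite mulNr.
have hI : (fun t => complex.Im ((x +i* y)%C * f (segment_point a b t))) =
  fun t => x * complex.Im (f (segment_point a b t)) + y * complex.Re (f (segment_point a b t)).
  by apply/funext => t; case: (f _) => u v /=.
rewrite hR hI !int01D ?int01Z //; try exact: cZ.
by apply/eqP; rewrite eq_complex /= mulNr !eqxx.
Qed.

Lemma segment_integral_bound f a b (M : R) : cts (segment a b) f ->
  (forall z, segment a b z -> rn (f z) <= M) ->
  rn (segment_integral f a b) <= 2 * rn (b - a) * M.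
Proof.
move=> cf hM; rewrite /segment_integral rnM [2 * _]mulrC -mulrA ler_wpM2l ?rn_ge0 //.
apply: le_trans (rn_le_ReIm _) _ => /=; rewrite mulr_natl mulr2n; apply: lerD.
  apply: int01_bound; first exact: cts_segment Re_lip cf.
  by move=> t t01; apply: le_trans (normRe_le_rn _) _; apply: hM; exists t.
apply: int01_bound; first exact: cts_segment Im_lip cf.
by move=> t t01; apply: le_trans (normIm_le_rn _) _; apply: hM; exists t.
Qed.

Lemma segment_integral_deriv F f a b : cts (segment a b) f -> cderiv (segment a b) F f ->
  segment_integral f a b = F b - F a.
Proof.
move=> cf dF.
have ud (P : R[i] -> R) (dP : {morph P : u v / u - v}) (lP : forall u, `|P u| <= rn u)
    (PZ : forall (s : R) u, P (s%:C * u) = s * P u) :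
    unit_derivative (fun t => P (F (segment_point a b t)))
      (fun t => P ((b - a) * f (segment_point a b t))).
  move=> t t01 e e0; have bp : 0 < rn (b - a) + 1 by rewrite ltr_wpDl ?rn_ge0.
  have [||d d0 hd] := dF (segment_point a b t) _ (e / (rn (b - a) + 1)).
  - by exists t.
  - by rewrite divr_gt0.
  exists (d / (rn (b - a) + 1)); first by rewrite divr_gt0.
  move=> s; rewrite ltr_pdivlMr // => st.
  rewrite -PZ -!dP; apply: le_trans (lP _) _.
  have := hd (segment_point a b s); rewrite rn_segment_sub.
  have -> : segment_point a b s - segment_point a b t = (s - t)%:C * (b - a).
    by rewrite /segment_point opprD addrACA subrr add0r -mulrBl -rmorphB.
  rewrite mulrA => h; apply: le_trans (h _) _.
    by apply: le_lt_trans st; rewrite ler_wpM2l // lerDl.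
  rewrite mulrCA [leRHS]mulrC ler_wpM2l // mulrAC ler_pdivrMr // ler_wpM2l ?(ltW e0) //.
  by rewrite lerDl.
have cg : cts (segment a b) (fun z => (b - a) * f z) by exact: ctsZ.
have E (P : R[i] -> R) : {morph P : u v / u - v} -> (forall u, `|P u| <= rn u) ->
    (forall (s : R) u, P (s%:C * u) = s * P u) ->
    int01 (fun t => P ((b - a) * f (segment_point a b t))) = P (F b - F a).
  move=> h1 h2 h3; rewrite (int01_FTC _ (ud P h1 h2 h3)); last first.
    by apply: cts_segment cg => u v; rewrite -h1.
  rewrite h1 /segment_point rmorph1 rmorph0 mul1r mul0r addr0.
  by rewrite addrCA subrr addr0.
have := segment_integralZ (b - a) cf; have [ab|ab] := eqVneq (b - a) 0.
  by rewrite /segment_integral ab !mul0r; move/eqP: ab; rewrite subr_eq0 => /eqP ->; rewrite subrr.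
rewrite /segment_integral => /(mulfI ab) <-.
rewrite (E (@complex.Re R)); last 3 first.
- by move=> u v; rewrite raddfB.
- exact: normRe_le_rn.
- by move=> s [x y] /=; rewrite mul0r subr0.
rewrite (E (@complex.Im R)); last 3 first.
- by move=> u v; rewrite raddfB.
- exact: normIm_le_rn.
- by move=> s [x y] /=; rewrite mul0r addr0.
by case: (F b - F a).
Qed.

Lemma contour_edge_support G e : e \in contour_edges G -> segment e.1 e.2 `<=` contour_support G.
Proof. by move=> eG z [t t01 zt]; exists e => //; exists t. Qed.

Lemma contour_integral_ext G f g : (forall z, contour_support G z -> f z = g z) ->
  contour_integral G f = contour_integral G g.
Proof.
move=> fg; rewrite /contour_integral; congr (_ * _); rewrite !big_seq; apply: eq_bigr => e eG.
by apply: segment_integral_ext => z ze; apply: fg; exact: contour_edge_support ze.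
Qed.

Lemma contour_integralD G f g : cts (contour_support G) f -> cts (contour_support G) g ->
  contour_integral G (fun z => f z + g z) = contour_integral G f + contour_integral G g.
Proof.
move=> cf cg; rewrite /contour_integral -mulrDr -big_split /=; congr (_ * _).
rewrite !big_seq; apply: eq_bigr => e eG.
by rewrite segment_integralD //; [apply: ctsS cf|apply: ctsS cg]; exact: contour_edge_support.
Qed.

Lemma contour_integralZ G c f : cts (contour_support G) f ->
  contour_integral G (fun z => c * f z) = c * contour_integral G f.
Proof.
move=> cf; rewrite /contour_integral mulrCA; congr (_ * _); rewrite mulr_sumr.
rewrite !big_seq; apply: eq_bigr => e eG.
by rewrite segment_integralZ //; apply: ctsS cf; exact: contour_edge_support.
Qed.

Lemma contour_integral0 G : contour_integral G (fun _ => 0) = 0.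
Proof.
have := contour_integralZ 0 (@cts_cst R (contour_support G) 0).
by rewrite !mul0r.
Qed.

Lemma contour_integral_sum G I (r : seq I) (f : I -> R[i] -> R[i]) :
  (forall i, cts (contour_support G) (f i)) ->
  contour_integral G (fun z => \sum_(i <- r) f i z) = \sum_(i <- r) contour_integral G (f i).
Proof.
move=> cf; elim: r => [|i r IH].
  by under eq_fun do rewrite big_nil; rewrite big_nil contour_integral0.
under eq_fun do rewrite big_cons.
by rewrite big_cons contour_integralD ?IH //; exact: cts_sum.
Qed.

Lemma contour_integral_bound G : exists2 C : R, 0 <= C &
  forall f M, cts (contour_support G) f -> (forall z, contour_support G z -> rn (f z) <= M) ->
  rn (contour_integral G f) <= C * M.
Proof.
exists (rn (0 +i* (2 * pi))%C^-1 * \sum_(e <- contour_edges G) (2 * rn (e.2 - e.1))).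
  by rewrite mulr_ge0 ?rn_ge0 // sumr_ge0 // => e _; rewrite mulr_ge0 ?rn_ge0.
move=> f M cf hM; rewrite /contour_integral rnM -mulrA ler_wpM2l ?rn_ge0 //.
apply: le_trans (rn_sum _ _ _) _; rewrite mulr_suml !big_seq; apply: ler_sum => e eG.
apply: segment_integral_bound.
  by apply: ctsS cf; exact: contour_edge_support.
by move=> z ze; apply: hM; exact: contour_edge_support ze.
Qed.

(** The end points of the edges of a closed polygon are a rotation of the starting points, so the
    increments of the primitive cancel. *)
Lemma contour_integral_deriv G F f : cts (contour_support G) f ->
  cderiv (contour_support G) F f -> contour_integral G f = 0.
Proof.
move=> cf dF; rewrite /contour_integral.
have -> : \sum_(e <- contour_edges G) segment_integral f e.1 e.2 =
    \sum_(e <- contour_edges G) (F e.2 - F e.1).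
  rewrite !big_seq; apply: eq_bigr => e eG; apply: segment_integral_deriv.
    by apply: ctsS cf; exact: contour_edge_support.
  by move=> z ze; apply: dF; exact: contour_edge_support ze.
rewrite /contour_edges big_flatten big_map big1 ?mulr0 // => p _.
have s1 : size p = size (rot 1 p) by rewrite size_rot.
rewrite /polygon_edges sumrB.
have -> : \sum_(e <- zip p (rot 1 p)) F e.2 = \sum_(x <- unzip2 (zip p (rot 1 p))) F x by rewrite big_map.
have -> : \sum_(e <- zip p (rot 1 p)) F e.1 = \sum_(x <- unzip1 (zip p (rot 1 p))) F x by rewrite big_map.
rewrite unzip1_zip -?s1 // unzip2_zip -?s1 //.
by rewrite (perm_big p) ?subrr //= perm_rot.
Qed.

(** Every power of [z - mu] except the exponent -1 has a primitive. Hence only a winding number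
    survives when a resolvent expansion is integrated. *)
Lemma contour_integral_pow_inv G mu k : ~ contour_support G mu ->
  contour_integral G (fun z => (z - mu)^-1 ^+ k.+2) = 0.
Proof.
by move=> hmu; apply: contour_integral_deriv (cderiv_pow_inv k hmu); exact: cts_pow_inv.
Qed.

Lemma contour_integral_pow G mu k : contour_integral G (fun z => (z - mu) ^+ k) = 0.
Proof. by apply: contour_integral_deriv (cderiv_pow mu k); exact: cts_pow. Qed.

End Contours.

(** * The resolvent: continuity, finite expansions and integrals *)

Section Resolvent.
Context (R : realType) (H : completeNormedModType R[i]).
Context (ip : {dot H for (@Num.conj R[i])}).
Context (ip_norm : forall x : H, ip x x = `|x| ^+ 2).
Context (K : H -> H) (bK : bdd K).
Let lK := bdd_lin bK.

Lemma resolventP z : ~ spectrum K z ->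
  [/\ bdd (resolvent K z), forall x, z *: resolvent K z x - K (resolvent K z x) = x &
      forall x, resolvent K z (z *: x - K x) = x].
Proof.
move=> /contrapT [U [/bddP bU UK KU]].
have : inverse_op (fun x => z *: x - K x) !=set0.
  exists (fun x => - U x); split.
  - by apply/bddP; exact: bdd_opp.
  - apply/funext => x /=; rewrite -(opprB (K x)) (linN (bdd_lin bU)) opprK.
    by rewrite -[LHS]/((U \o shift_op K z) x) UK.
  - apply/funext => x /=; rewrite scalerN (linN lK) opprK addrC.
    by rewrite -[LHS]/((shift_op K z \o U) x) KU.
move=> /getPex [/bddP bV VK KV]; split=> // x.
  by have := congr1 (@^~ x) KV.
by have := congr1 (@^~ x) VK.
Qed.

Lemma resolvent_unique z x u : ~ spectrum K z -> z *: u - K u = x -> resolvent K z x = u.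
Proof. by move=> /resolventP [_ _ h] <-. Qed.

(** The resolvent identity [R_w = R_z - (w - z) R_z R_w] gives [rn (R_w x) <= 2 C rn x] as soon as
    [2 C rn (w - z) < 1], and then continuity. *)
Lemma cts_resolvent x y (S : set R[i]) : (forall z, S z -> ~ spectrum K z) ->
  cts S (fun z => ip (resolvent K z x) y).
Proof.
move=> hS z Sz e e0; have [bz zl _] := resolventP (hS z Sz).
have [C C0 hC] := bdd_gt0 bz; have lz := bdd_lin bz.
pose D := 2 * C ^+ 2 * rn x * rn y + 1.
have D0 : 0 < D by rewrite ltr_wpDl // !mulr_ge0 ?rn_ge0 ?exprn_ge0 ?ltW.
exists (Num.min (2 * C)^-1 (e / D)); first by rewrite lt_min invr_gt0 mulr_gt0 //= divr_gt0.
move=> w Sw; rewrite lt_min => /andP[w1 w2]; set t := rn (w - z) in w1 w2.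
have [_ wl _] := resolventP (hS w Sw).
set u := resolvent K w x.
have uE : u = resolvent K z x - (w - z) *: resolvent K z u.
  apply/esym; rewrite -(linZ lz) -(linB lz); apply: resolvent_unique (hS z Sz) _.
  by rewrite -[in RHS](wl x) -/u; vector_ring ip_norm.
have tC : t * C <= 2^-1.
  move: w1; rewrite -[X in _ < X]mul1r ltr_pdivlMr ?mulr_gt0 // => /ltW h.
  by rewrite -(ler_pM2r (_ : 0 < 2)) // mulVf // -mulrA [C * 2]mulrC.
have hu : rn u <= 2 * (C * rn x).
  have : rn u <= C * rn x + t * (C * rn u).
    rewrite {1}uE; apply: le_trans (rnB _ _) _; rewrite rnZ; apply: lerD; first exact: hC.
    by rewrite ler_wpM2l ?rn_ge0.
  have : t * (C * rn u) <= 2^-1 * rn u by rewrite mulrA ler_wpM2r ?rn_ge0.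
  lra.
rewrite -ipBl {1}/u -/u uE [X in ip X]addrAC subrr sub0r ipNl rnN ipZl rnM -/t.
have h1 : rn (ip (resolvent K z u) y) <= 2 * C ^+ 2 * rn x * rn y.
  apply: le_trans (cauchy_schwarz ip_norm _ _) _; rewrite ler_wpM2r ?rn_ge0 //.
  apply: le_trans (hC _) _; apply: le_trans (ler_wpM2l (ltW C0) hu) _.
  by rewrite le_eqVlt; apply/orP; left; apply/eqP; ring.
have t0 : 0 <= t by exact: rn_ge0.
apply: le_lt_trans (ler_wpM2l t0 h1) _.
move: w2; rewrite ltr_pdivlMr //; apply: le_lt_trans.
by rewrite /D ler_wpM2l // lerDl.
Qed.

(** A finite geometric series in [(K - mu) / (z - mu)], telescoping because
    [z - K = (z - mu) - (K - mu)]. It serves at an eigenvalue, where the remainder vanishes, and at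
    0 on the complement, where the remainder decays. *)
Lemma resolvent_expansion (mu z : R[i]) v k : z != mu ->
  let s := \sum_(j < k) (z - mu)^-1 ^+ j.+1 *: papp K (('X - mu%:P) ^+ j) v in
  z *: s - K s = v - (z - mu)^-1 ^+ k *: papp K (('X - mu%:P) ^+ k) v.
Proof.
move=> zmu s; rewrite /s {s}; have zm : z - mu != 0 by rewrite subr_eq0.
elim: k => [|k IH]; first by rewrite big_ord0 scaler0 (lin0 lK) !expr0 papp1 scale1r subr0 subrr.
rewrite big_ord_recr /= scalerDr (linD lK) opprD addrACA IH.
set p := papp K (('X - mu%:P) ^+ k) v.
have -> : papp K (('X - mu%:P) ^+ k.+1) v = K p - mu *: p by rewrite exprS pappM // papp_XsubC.
rewrite (linZ lK); set x := (z - mu)^-1 ^+ k.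
have -> : (z - mu)^-1 ^+ k.+1 = x * (z - mu)^-1 by rewrite exprSr.
apply: (ip_inj ip_norm) => u; rewrite ?(ipDl, ipNl, ipZl).
by field.
Qed.

End Resolvent.

Section RieszFormula.
Context (R : realType) (H : completeNormedModType R[i]).
Context (ip : {dot H for (@Num.conj R[i])}).
Context (ip_norm : forall x : H, ip x x = `|x| ^+ 2).
Context (K : H -> H) (d : R) (cK : compact_op H K) (d0 : 0 < d).
Context (n : nat) (e : nat -> H) (fe : schur_family ip K d n e).
Context (noev : forall z x, d <= rn z -> ocompl ip n e (K x) = z *: x -> x = 0).
Context (G : seq (seq R[i])).
Context (Gd : forall z, contour_support G z -> d <= rn z).
Context (Gs : forall z, contour_support G z -> ~ spectrum K z).

Let bK := compact_bdd cK.
Let lK := bdd_lin bK.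
Let he : orthonormal_family ip n e. Proof. by case: fe. Qed.

Local Notation Q := (ocompl ip n e).
Local Notation Kt := (tail_op ip K n e).
Local Notation ds := (diag_seq ip K n e).
Local Notation chi := (diag_poly ip K n e).
Local Notation supp := (contour_support G).
Local Notation cint x y := (contour_integral G (fun z => ip (resolvent K z x) y)).
Let lKt : linear Kt := bdd_lin (bdd_tail ip_norm cK n e).

Lemma resolvent_integralD u v y : cint (u + v) y = cint u y + cint v y.
Proof.
rewrite -contour_integralD; try exact: cts_resolvent.
apply: contour_integral_ext => z sz; have [bz _ _] := resolventP bK (Gs sz).
by rewrite (linD (bdd_lin bz)) ipDl.
Qed.

Lemma resolvent_integral_primary mu v k y : ~ supp mu ->
  papp K (('X - mu%:P) ^+ k) v = 0 -> cint v y = winding_number G mu * ip v y.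
Proof.
move=> smu hv; pose c j := ip (papp K (('X - mu%:P) ^+ j) v) y.
have -> : cint v y = contour_integral G (fun z => \sum_(j <- iota 0 k) c j * (z - mu)^-1 ^+ j.+1).
  apply: contour_integral_ext => z sz.
  have zmu : z != mu by apply/eqP => zm; apply: smu; rewrite -zm.
  have := resolvent_expansion ip_norm bK v k zmu; rewrite hv scaler0 subr0.
  move/(resolvent_unique bK (Gs sz)) => ->; rewrite ip_suml.
  have -> : iota 0 k = index_iota 0 k by rewrite /index_iota subn0.
  by rewrite big_mkord; apply: eq_bigr => j _; rewrite ipZl mulrC.
rewrite contour_integral_sum; last by move=> j; apply: ctsZ; exact: cts_pow_inv.
case: k hv => [|k] hv.
  by rewrite big_nil; rewrite expr0 papp1 in hv; rewrite hv ip0l mulr0.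
rewrite /= big_cons big_seq big1 => [|j].
  rewrite addr0 contour_integralZ; last exact: cts_pow_inv.
  by rewrite mulrC /c expr0 papp1; congr (_ * _); apply: contour_integral_ext => z _; rewrite expr1.
rewrite mem_iota => /andP[j0 _]; rewrite contour_integralZ; last exact: cts_pow_inv.
by case: j j0 => // j _; rewrite contour_integral_pow_inv ?mulr0.
Qed.

(** A Bezout identity splits [v] into a part killed by [('X - a%:P) ^+ n], on which both sides are
    multiplication by [w a], and a part killed by the remaining factors. *)
Lemma resolvent_integral_poly (w : R[i] -> bool) q s v y : uniq s ->
  (forall a, a \in s -> [/\ ~ supp a, winding_number G a = (w a)%:R &
     ('X - a%:P) ^+ n %| q - ((w a)%:R)%:P]) ->
  papp K (\prod_(a <- s) ('X - a%:P) ^+ n) v = 0 -> cint v y = ip (papp K q v) y.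
Proof.
elim: s v => [|a s IH] v /=.
  rewrite big_nil papp1 => _ _ ->; rewrite (lin0 (papp_lin lK q)) ip0l.
  rewrite -[RHS](contour_integral0 G); apply: contour_integral_ext => z sz.
  by have [bz _ _] := resolventP bK (Gs sz); rewrite (lin0 (bdd_lin bz)) ip0l.
move=> /andP[na us] hs; rewrite big_cons => hv.
have hs' b : b \in s -> [/\ ~ supp b, winding_number G b = (w b)%:R &
     ('X - b%:P) ^+ n %| q - ((w b)%:R)%:P] by move=> bs; apply: hs; rewrite inE bs orbT.
have [sa wa qa] := hs a (mem_head _ _).
have /Bezout_eq1_coprimepP [[b c] /= bc] := coprime_XsubC_prod n na.
set r := \prod_(a <- s) _ in hv bc; set l := ('X - a%:P) ^+ n in hv bc qa.
have -> : v = papp K (b * l) v + papp K (c * r) v by rewrite -pappD bc papp1.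
rewrite resolvent_integralD (linD (papp_lin lK q)) ipDl; congr (_ + _).
  apply: IH => //; rewrite -pappM //.
  by apply: (papp_dvd lK _ hv); rewrite mulrCA [r * l]mulrC dvdp_mulIr.
have kv : papp K l (papp K (c * r) v) = 0.
  rewrite -pappM //; apply: (papp_dvd lK _ hv).
  by rewrite mulrCA dvdp_mulIr.
rewrite (resolvent_integral_primary y sa kv) wa -ipZl; congr (ip _ y).
apply/esym/eqP; rewrite -subr_eq0 -(pappC K) -pappB; apply/eqP.
exact: (papp_dvd lK qa).
Qed.

Section Complement.
Context (L : H -> H) (bL : bdd L) (QLQ : forall x, Q (L (Q x)) = Q x).
Context (KL : forall p x, papp K p (L x) = L (papp Kt p x)).
Let lL := bdd_lin bL.

(** On the range of [L] the resolvent is conjugate to that of the tail and uniformly bounded along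
    the contour. In the expansion at 0 to order [J = N * q.+1] the remainder is at most a constant
    times [th ^+ q.+1], because [rn z >= d] there; the other terms leave the winding number of 0. *)
Lemma resolvent_integral_complement x y : ~ supp 0 -> cint (L x) y = winding_number G 0 * ip (L x) y.
Proof.
move=> s0.
have [c c0 low] := tail_lower_bound ip_norm cK d0 noev.
have [N [th [N0 th0 th1 hN]]] := tail_powers ip_norm cK d0 noev.
have [CL CL0 hL] := bdd_gt0 bL.
have [CG CG0 hG] := contour_integral_bound G.
have resL z u : supp z -> rn (resolvent K z (L u)) <= CL / (c * d) * rn u.
  move=> sz; have dz := Gd sz.
  have [V [bV _ VK]] := tail_shift_inverse ip_norm cK d0 noev dz.
  have lV := bdd_lin bV.
  have -> : resolvent K z (L u) = L (- V u).
    apply: (resolvent_unique bK (Gs sz)).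
    have -> : K (L (- V u)) = L (Kt (- V u)) by rewrite -(pappX K) KL pappX.
    rewrite -(linZ lL) -(linB lL); congr L.
    by rewrite scalerN (linN lKt) -opprD opprB -[RHS]VK.
  apply: le_trans (hL _) _; rewrite rnN -mulrA ler_wpM2l ?(ltW CL0) // mulrC ler_pdivlMr ?mulr_gt0 //.
  have h := low z dz (V u); rewrite rnBC -/(shift_op Kt z (V u)) VK in h.
  by apply: le_trans h; rewrite mulrC ler_wpM2r ?rn_ge0 // ler_wpM2l // ltW.
have expand z J : supp z -> (0 < J)%N -> ip (resolvent K z (L x)) y =
    \sum_(j <- iota 0 J) ip (L (iter j Kt x)) y * (z - 0)^-1 ^+ j.+1 +
    (z - 0)^-1 ^+ J * ip (resolvent K z (L (iter J Kt x))) y.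
  move=> sz J0; have zn0 : z != 0 by apply/eqP => z0; apply: s0; rewrite -z0.
  have [bz zl zr] := resolventP bK (Gs sz).
  have := resolvent_expansion ip_norm bK (L x) J zn0.
  set s := \sum_(j < J) _ => hs.
  have KLj j : papp K (('X - 0%:P) ^+ j) (L x) = L (iter j Kt x).
    by rewrite polyC0 subr0 KL papp_Xn.
  rewrite KLj in hs.
  have -> : resolvent K z (L x) = s + (z - 0)^-1 ^+ J *: resolvent K z (L (iter J Kt x)).
    apply: (resolvent_unique bK (Gs sz)); rewrite scalerDr (linD lK) (linZ lK) opprD addrACA hs.
    by rewrite scalerA mulrC -scalerA -scalerBr zl subrK.
  rewrite ipDl ipZl; congr (_ + _); rewrite /s ip_suml.
  have -> : iota 0 J = index_iota 0 J by rewrite /index_iota subn0.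
  by rewrite big_mkord; apply: eq_bigr => j _; rewrite ipZl KLj mulrC.
pose g J z := \sum_(j <- iota 0 J) ip (L (iter j Kt x)) y * (z - 0)^-1 ^+ j.+1.
have cg J : cts supp (g J) by apply: cts_sum => j; apply: ctsZ; exact: cts_pow_inv.
have intg J : (0 < J)%N -> contour_integral G (g J) = winding_number G 0 * ip (L x) y.
  move=> J0; rewrite contour_integral_sum; last by move=> j; apply: ctsZ; exact: cts_pow_inv.
  case: J J0 => // J _; rewrite /= big_cons big_seq big1 => [|j].
    rewrite addr0 contour_integralZ; last exact: cts_pow_inv.
    by rewrite mulrC; congr (_ * _); apply: contour_integral_ext => z _; rewrite expr1.
  rewrite mem_iota => /andP[j0 _]; rewrite contour_integralZ; last exact: cts_pow_inv.
  by case: j j0 => // j _; rewrite contour_integral_pow_inv ?mulr0.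
have cf : cts supp (fun z => ip (resolvent K z (L x)) y) by apply: (cts_resolvent ip_norm bK).
apply/eqP; rewrite -subr_eq0 -rn_eq0 eq_le rn_ge0 andbT.
pose A := CL / (c * d) * rn x * rn y.
apply: (le_geometric (B := CG * A) th0 th1) => q.
have J0 : (0 < N * q.+1)%N by rewrite muln_gt0 N0.
set J := (N * q.+1)%N in J0.
rewrite -(intg J J0).
have -> : cint (L x) y - contour_integral G (g J) =
    contour_integral G (fun z => ip (resolvent K z (L x)) y + (- 1) * g J z).
  by rewrite contour_integralD ?contour_integralZ ?mulN1r //; exact: ctsZ.
rewrite -mulrA; apply: hG; first by apply: ctsD => //; exact: ctsZ.
move=> z sz; rewrite (expand z J sz J0) mulN1r addrAC subrr add0r subr0 rnM rnX rnV.
have dz := Gd sz.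
have zp : 0 < rn z by apply: lt_le_trans dz.
have iterB r : rn (iter (N * r) Kt x) <= (th * d ^+ N) ^+ r * rn x.
  elim: r => [|r IH]; first by rewrite muln0 expr0 mul1r.
  rewrite mulnS iterD exprS -mulrA; apply: le_trans (hN _) _.
  by rewrite ler_wpM2l // mulr_ge0 // exprn_ge0 // ltW.
have h1 : rn (ip (resolvent K z (L (iter J Kt x))) y) <= A * (th ^+ q.+1 * d ^+ J).
  apply: le_trans (cauchy_schwarz ip_norm _ _) _.
  apply: (@le_trans _ _ (CL / (c * d) * ((th * d ^+ N) ^+ q.+1 * rn x) * rn y)).
    rewrite ler_wpM2r ?rn_ge0 //; apply: le_trans (resL z _ sz) _.
    by rewrite ler_wpM2l ?iterB // divr_ge0 // ?mulr_ge0 // ltW.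
  by rewrite exprMn -exprM -/J /A le_eqVlt; apply/orP; left; apply/eqP; ring.
have zJ : 0 <= (rn z)^-1 ^+ J by rewrite exprn_ge0 // invr_ge0 ltW.
apply: le_trans (ler_wpM2l zJ h1) _.
have A0 : 0 <= A by rewrite /A !mulr_ge0 ?rn_ge0 ?invr_ge0 ?mulr_ge0 // ltW.
rewrite mulrCA ler_wpM2l // mulrCA -[leRHS]mulr1 ler_wpM2l ?exprn_ge0 //.
rewrite exprVn mulrC ler_pdivrMr ?exprn_gt0 // mul1r.
by rewrite lerXn2r // nnegrE ltW.
Qed.

Lemma resolvent_integralE (w : R[i] -> bool) q x y : ~ supp 0 ->
  (forall a, a \in ds -> winding_number G a = (w a)%:R) ->
  winding_number G 0 = (w 0)%:R ->
  (forall a, a \in ds -> ('X - a%:P) ^+ n %| q - ((w a)%:R)%:P) ->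
  cint x y = ip (papp K q (x - L (Q x)) + (w 0)%:R *: L (Q x)) y.
Proof.
move=> s0 hw w0 hq; rewrite -{1}[x](subrK (L (Q x))) resolvent_integralD ipDl.
rewrite resolvent_integral_complement // w0 -ipZl; congr (_ + _).
apply: (resolvent_integral_poly y (undup_uniq ds)) => [a|].
  rewrite mem_undup => ha; split; [|exact: hw|exact: hq].
  move=> sa; apply: (Gs sa); apply/(spectrum_compact ip_norm cK d0 fe noev) => //.
  exact: (mem_diag_seq fe).
rewrite (complement_comb ip_norm _ QLQ); apply: (papp_dvd lK _ (diag_poly_comb cK fe _)).
by apply: dvd_prod_undup; rewrite size_mkseq.
Qed.
End Complement.

End RieszFormula.

(** * Contours: distance from 0, reflection, and an explicit square *)

Section ContourGeometry.
Context (R : realType).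
Implicit Types (G : seq (seq R[i])) (z a b : R[i]).

Lemma contour_support_away G : ~ contour_support G 0 ->
  exists2 d : R, 0 < d & forall z, contour_support G z -> d <= rn z.
Proof.
move=> h0.
suff away (E : seq (R[i] * R[i])) : (forall e, e \in E -> ~ segment e.1 e.2 0) ->
    exists2 d : R, 0 < d & forall e, e \in E -> forall z, segment e.1 e.2 z -> d <= rn z.
  have [e eG s0|d d0 hd] := away (contour_edges G).
    by apply: h0; exact: contour_edge_support s0.
  by exists d => // z [e eG [t t01 zt]]; apply: (hd e eG); exists t.
elim: E => [|[a b] E IH] hE; first by exists 1.
have [e eE|d d0 hd] := IH; first by apply: hE; rewrite inE eE orbT.
have cf : {within `[0%R, 1%R], continuous (fun t => rn (segment_point a b t))}.
  apply: unit_continuous_within.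
  apply: (@cts_segment R (fun z => rn z) id a b) => [u v|].
    by rewrite ler_norml rn_sub_le andbT lerNl opprB rnBC rn_sub_le.
  by move=> z _ e e0; exists e.
have [c c01 hc] := EVT_min ler01 cf.
have cp : 0 < rn (segment_point a b c).
  rewrite rn_gt0; apply/eqP => s0; apply: (hE (a, b)); first exact: mem_head.
  by exists c => //; move: c01; rewrite in_itv.
exists (Num.min d (rn (segment_point a b c))); first by rewrite lt_min d0.
move=> e; rewrite inE => /orP[/eqP -> z [t t01 ->]|eE z ze]; rewrite ge_min.
  by rewrite hc ?orbT // in_itv.
by rewrite (hd e).
Qed.

Definition opp_contour G : seq (seq R[i]) := map (map -%R) G.

Lemma segment_point_opp a b t : segment_point (- a) (- b) t = - segment_point a b t.
Proof. by rewrite /segment_point -opprB -opprD mulrN opprD opprK; ring. Qed.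

Lemma segment_integral_opp f a b :
  segment_integral f (- a) (- b) = - segment_integral (fun z => f (- z)) a b.
Proof.
rewrite /segment_integral -mulNr; congr (_ * (_ +i* _)%C); first by ring.
  by apply: eq_Rintegral => t _; rewrite segment_point_opp.
by apply: eq_Rintegral => t _; rewrite segment_point_opp.
Qed.

Lemma contour_edges_opp G :
  contour_edges (opp_contour G) = [seq (- e.1, - e.2) | e <- contour_edges G].
Proof.
rewrite /contour_edges /opp_contour map_flatten -!map_comp; congr flatten.
apply: eq_map => p /=; rewrite /polygon_edges -map_rot.
by elim: p (rot 1 p) => [|x p IH] [|y q] //=; rewrite IH.
Qed.

Lemma contour_support_opp G z : contour_support (opp_contour G) z <-> contour_support G (- z).
Proof.
rewrite /contour_support /= contour_edges_opp; split.
  move=> [_ /mapP [e eG ->] [t t01 ->]]; exists e => //; exists t => //=.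
  by rewrite segment_point_opp opprK.
move=> [e eG [t t01 zt]]; exists (- e.1, - e.2); first by apply/mapP; exists e.
by exists t => //=; rewrite segment_point_opp -zt opprK.
Qed.

(** Reflection in 0 is a rotation by a half turn, so orientation is preserved. *)
Lemma winding_number_opp G a : ~ contour_support G a ->
  winding_number (opp_contour G) (- a) = winding_number G a.
Proof.
move=> sa; rewrite /winding_number /contour_integral contour_edges_opp big_map.
congr (_ * _); rewrite !big_seq; apply: eq_bigr => e eG /=; rewrite segment_integral_opp.
have ca : cts (segment e.1 e.2) (fun z => (z - a)^-1).
  by apply: cts_inv => h; apply: sa; exact: contour_edge_support h.
rewrite -mulN1r -segment_integralZ; last first.
  apply: (@ctsS _ (segment e.1 e.2)) => //.
  have : cts (segment e.1 e.2) (fun z => -1 * (z - a)^-1) by exact: ctsZ.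
  by congr cts; apply/funext => z; rewrite mulN1r -invrN opprK opprB addrC.
apply: segment_integral_ext => z _.
by rewrite opprK mulN1r -invrN opprD !opprK.
Qed.

End ContourGeometry.

Section DiamondDerivatives.
Context (R : realType).

Lemma is_derive_diamond_sq (t : R) : is_derive t 1 (fun t : R => (1 - t) ^+ 2 + t ^+ 2) (4 * t - 2).
Proof.
have d1 : is_derive t 1 (fun t : R => 1 - t) (0 - 1) := is_deriveB (is_derive_cst (1:R) (t:R) (1:R)) (is_derive_id (t:R) (1:R)).
have d2 := @is_deriveX _ _ _ 2 _ _ _ d1.
have d3 := @is_deriveX _ _ _ 2 _ _ _ (is_derive_id (t:R) (1:R)).
have d4 := is_deriveD d2 d3.
apply: (@is_derive_eq _ _ _ _ _ _ _ _ d4).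
rewrite /GRing.scale /= ?exprfctE ?expr1 /id; ring.
Qed.
Lemma is_derive_half_ln (D : R -> R) (t D' : R) : 0 < D t -> is_derive t 1 D D' ->
  is_derive t 1 (fun t => 2^-1 * ln (D t)) (2^-1 * ((D t)^-1 * D')).
Proof.
move=> Dt dD.
have d1 := @is_derive1_comp _ (@ln R) D t _ _ (is_derive1_ln Dt) dD.
have d2 := is_deriveZ 2^-1 d1.
exact: (@is_derive_eq _ _ _ _ _ _ _ _ d2).
Qed.
Lemma is_derive_diamond_atan (t : R) : is_derive t 1 (fun t => atan (2 * t - 1)) (2 / (1 + (2 * t - 1) ^+ 2)).
Proof.
have d1 : is_derive t 1 (fun t : R => 2 * t - 1) (2 * 1 - 0) := is_deriveB (is_deriveZ 2 (is_derive_id (t:R) (1:R))) (is_derive_cst (1:R) (t:R) (1:R)).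
have d2 := @is_derive1_comp _ (@atan R) _ t _ _ (is_derive1_atan _) d1.
apply: (@is_derive_eq _ _ _ _ _ _ _ _ d2).
rewrite /GRing.scale /=; ring.
Qed.
End DiamondDerivatives.

Section Diamond.
Context (R : realType) (c : R[i]) (r : R) (r0 : 0 < r).

(** A square with vertices on the axes through [c]: its edges are the images of one edge under the
    fourth roots of unity. *)
Definition diamond : seq (seq R[i]) :=
  [:: [:: c + r%:C; c + r%:C * 'i%C; c - r%:C; c - r%:C * 'i%C]].

Lemma diamond_edgesE (e : R[i] * R[i]) : e \in contour_edges diamond ->
  exists2 u : R[i], u ^+ 4 = 1 & e = (c + r%:C * u, c + r%:C * (u * 'i%C)).
Proof.
have i2 : 'i%C * 'i%C = -1 :> R[i] by rewrite -expr2 sqr_i.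
rewrite /contour_edges /= /polygon_edges /= !inE => /or4P [] /eqP ->.
- by exists 1; rewrite ?expr1n // mulr1 mul1r.
- exists 'i%C; first by rewrite (exprM _ 2 2) sqr_i sqrrN expr1n.
  by rewrite i2 mulrN1.
- by exists (-1); [rewrite (exprM _ 2 2) sqrrN !expr1n | rewrite mulrN1 mulN1r mulrN].
- exists (- 'i%C); first by rewrite (exprM _ 2 2) sqrrN sqr_i sqrrN expr1n.
  by rewrite mulNr i2 opprK mulr1 mulrN.
Qed.

Lemma diamond_segment_point (u : R[i]) (t : R) :
  segment_point (c + r%:C * u) (c + r%:C * (u * 'i%C)) t =
  c + r%:C * u * ((1 - t) +i* t)%C.
Proof.
rewrite /segment_point (_ : ((1 - t) +i* t)%C = 1 - t%:C + t%:C * 'i%C); first by ring.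
by apply/eqP; rewrite eq_complex /=; apply/andP; split; apply/eqP; ring.
Qed.

Lemma rn_root4 (u : R[i]) : u ^+ 4 = 1 -> rn u = 1.
Proof.
move=> u4; apply/eqP; rewrite -(@pexpr_eq1 _ _ 4) ?rn_ge0 //.
by rewrite -rnX u4 rn1.
Qed.

Lemma rn_diamond_weight (t : R) : 0 <= t <= 1 -> 0 < rn ((1 - t) +i* t)%C <= 1.
Proof.
move=> /andP[t0 t1]; have E : rn ((1 - t) +i* t)%C = Num.sqrt ((1 - t) ^+ 2 + t ^+ 2).
  by rewrite /rn normc_def.
have Q : (1 - t) ^+ 2 + t ^+ 2 = (1 + (2 * t - 1) ^+ 2) / 2 by field.
rewrite E; apply/andP; split.
  by rewrite sqrtr_gt0 Q divr_gt0 // ltr_pwDl // sqr_ge0.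
rewrite -[leRHS]sqrtr1 ler_wsqrtr //.
have -> : (1 - t) ^+ 2 + t ^+ 2 = 1 - 2 * (t * (1 - t)) by ring.
by rewrite gerBl mulr_ge0 // mulr_ge0 // subr_ge0.
Qed.

Lemma diamond_support z : contour_support diamond z -> 0 < rn (z - c) <= r.
Proof.
move=> [e /diamond_edgesE [u u4 ->] [t t01 ->]] /=.
rewrite diamond_segment_point [X in rn X]addrAC subrr add0r !rnM rn_real gtr0_norm //.
rewrite rn_root4 // mulr1; have /andP[h1 h2] := rn_diamond_weight t01.
by rewrite mulr_gt0 //= ger_pMr.
Qed.

(** With [D t = (1 - t) ^+ 2 + t ^+ 2], the integrand is [((2 * t - 1) + i) / D t], with primitives
    [ln (D t) / 2] and [atan (2 * t - 1)]; the first takes the same value at both ends. *)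
Lemma diamond_edge_integral (u : R[i]) : u ^+ 4 = 1 ->
  segment_integral (fun z => (z - c)^-1) (c + r%:C * u) (c + r%:C * (u * 'i%C)) =
  (0 +i* (pi / 2))%C.
Proof.
move=> u4; have u0 : u != 0 by rewrite -rn_gt0 rn_root4.
have rc0 : r%:C != 0 :> R[i] by rewrite -rn_gt0 rn_real normr_gt0 gt_eqF.
have cg : cts (segment (c + r%:C * u) (c + r%:C * (u * 'i%C))) (fun z => (z - c)^-1).
  apply: cts_inv => -[t t01]; rewrite diamond_segment_point.
  move/eqP; rewrite -subr_eq0 opprD addrA subrr add0r oppr_eq0 !mulf_eq0.
  rewrite (negPf u0) (negPf rc0) /= => /eqP h.
  by have := rn_diamond_weight t01; rewrite h rn0 ltxx.
have := segment_integralZ (c + r%:C * (u * 'i%C) - (c + r%:C * u)) cg.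
have d0 : c + r%:C * (u * 'i%C) - (c + r%:C * u) != 0.
  have -> : c + r%:C * (u * 'i%C) - (c + r%:C * u) = r%:C * u * ('i%C - 1) by ring.
  rewrite !mulf_neq0 // subr_eq0; apply/eqP => /(congr1 (@complex.Re R)) /= /eqP.
  by rewrite eq_sym oner_eq0.
rewrite {1}/segment_integral => /(mulfI d0) <-.
pose D (t : R) := (1 - t) ^+ 2 + t ^+ 2.
have D0 t : 0 < D t by rewrite /D; nra.
have E (t : R) : (c + r%:C * (u * 'i%C) - (c + r%:C * u)) *
    (segment_point (c + r%:C * u) (c + r%:C * (u * 'i%C)) t - c)^-1 =
    ((2 * t - 1) / D t +i* (D t)^-1)%C.
  rewrite diamond_segment_point [c + _ - c]addrAC subrr add0r.
  have -> : c + r%:C * (u * 'i%C) - (c + r%:C * u) = r%:C * u * ('i%C - 1) by ring.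
  rewrite -[(r%:C * u * _)^-1]/(_) invfM [X in X = _]mulrACA mulfV ?mulf_neq0 // mul1r.
  apply/eqP; rewrite eq_complex /= /D; apply/andP; split; apply/eqP; field;
  by rewrite gt_eqF //; exact: D0.
have cE : cts (segment (c + r%:C * u) (c + r%:C * (u * 'i%C)))
    (fun z => (c + r%:C * (u * 'i%C) - (c + r%:C * u)) * (z - c)^-1) by exact: ctsZ.
have cR := cts_segment (@Re_lip R) cE; have cI := cts_segment (@Im_lip R) cE.
have eR : (fun t => complex.Re ((c + r%:C * (u * 'i%C) - (c + r%:C * u)) *
    (segment_point (c + r%:C * u) (c + r%:C * (u * 'i%C)) t - c)^-1)) =
    fun t => (2 * t - 1) / D t by apply/funext => t; rewrite E.
have eI : (fun t => complex.Im ((c + r%:C * (u * 'i%C) - (c + r%:C * u)) *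
    (segment_point (c + r%:C * u) (c + r%:C * (u * 'i%C)) t - c)^-1)) =
    fun t => (D t)^-1 by apply/funext => t; rewrite E.
rewrite eR in cR *; rewrite eI in cI *.
have dR (t : R) : 0 <= t <= 1 -> is_derive t 1 (fun t => 2^-1 * ln (D t)) ((2 * t - 1) / D t).
  move=> _; have := is_derive_half_ln (D0 t) (is_derive_diamond_sq t).
  by congr is_derive; field; rewrite gt_eqF.
have dI (t : R) : 0 <= t <= 1 -> is_derive t 1 (fun t => atan (2 * t - 1)) (D t)^-1.
  move=> _; have := is_derive_diamond_atan t; congr is_derive.
  have -> : D t = (1 + (2 * t - 1) ^+ 2) / 2 by rewrite /D; field.
  by rewrite invf_div.
rewrite (int01_FTC_is_derive cR dR) (int01_FTC_is_derive cI dI).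
have -> : D 1 = 1 by rewrite /D subrr expr0n add0r expr1n.
have -> : D 0 = 1 by rewrite /D subr0 expr1n expr0n addr0.
rewrite subrr mulr1 mulr0 sub0r atanN opprK (_ : 2 - 1 = 1 :> R); last by ring.
by rewrite atan1; congr (_ +i* _)%C; field.
Qed.

Lemma diamond_winding_center : winding_number diamond c = 1.
Proof.
have i2 : 'i%C * 'i%C = -1 :> R[i] by rewrite -expr2 sqr_i.
have E (u : R[i]) a b : u ^+ 4 = 1 -> a = c + r%:C * u -> b = c + r%:C * (u * 'i%C) ->
    segment_integral (fun z => (z - c)^-1) a b = (0 +i* (pi / 2))%C.
  by move=> u4 -> ->; exact: diamond_edge_integral.
rewrite /winding_number /contour_integral /contour_edges /= /polygon_edges /=.
rewrite !big_cons big_nil /=.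
rewrite (E 1) ?expr1n ?mulr1 ?mul1r //.
rewrite (E 'i%C) ?i2 ?mulrN1 //; last by rewrite (exprM _ 2 2) sqr_i sqrrN expr1n.
rewrite (E (-1)) ?mulrN1 ?mulN1r ?mulrN //; last by rewrite (exprM _ 2 2) sqrrN !expr1n.
rewrite (E (- 'i%C)) ?mulNr ?i2 ?opprK ?mulr1 ?mulrN //; last first.
  by rewrite (exprM _ 2 2) sqrrN sqr_i sqrrN expr1n.
have -> : (0 +i* (pi / 2))%C + ((0 +i* (pi / 2))%C + ((0 +i* (pi / 2))%C + ((0 +i* (pi / 2))%C + 0))) =
   (0 +i* (2 * pi))%C :> R[i].
  by apply/eqP; rewrite eq_complex /= !addr0 eqxx /=; apply/eqP; field.
by rewrite mulVf // eq_complex /= eqxx /= mulf_neq0 // gt_eqF ?pi_gt0.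
Qed.

(** On the contour [(z - a)^-1] is a geometric series in [(z - c) / (a - c)] of ratio at most 1/2.
    Its partial sums are polynomials in [z - c], with integral 0. *)
Lemma diamond_winding_outside a : 2 * r <= rn (a - c) -> winding_number diamond a = 0.
Proof.
move=> ha; have a0 : 0 < rn (a - c) by apply: lt_le_trans ha; rewrite mulr_gt0.
have ac : a - c != 0 by rewrite -rn_gt0.
have sa : ~ contour_support diamond a.
  by move=> /diamond_support /andP[_ h]; lra.
have [C C0 hC] := contour_integral_bound diamond.
apply/eqP; rewrite -rn_eq0 eq_le rn_ge0 andbT.
apply: (@le_geometric _ _ (C * r^-1) 2^-1); rewrite ?invr_ge0 //.
  by rewrite invf_lt1 // ltr1n.
move=> q; pose g z := \sum_(j <- iota 0 q.+1) - (a - c)^-1 ^+ j.+1 * (z - c) ^+ j.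
have cg : cts (contour_support diamond) g by apply: cts_sum => j; apply: ctsZ; exact: cts_pow.
have g0 : contour_integral diamond g = 0.
  rewrite contour_integral_sum; last by move=> j; apply: ctsZ; exact: cts_pow.
  rewrite big1 // => j _; rewrite contour_integralZ; last exact: cts_pow.
  by rewrite contour_integral_pow mulr0.
have cf := @cts_inv _ (contour_support diamond) a sa.
have -> : winding_number diamond a =
    contour_integral diamond (fun z => (z - a)^-1 + (- 1) * g z).
  by rewrite contour_integralD ?contour_integralZ ?g0 ?mulr0 ?addr0 //; exact: ctsZ.
rewrite -mulrA; apply: hC; first by apply: ctsD => //; exact: ctsZ.
move=> z sz; have /andP[z0 zr] := diamond_support sz.
have za : z - a != 0 by rewrite subr_eq0; apply/eqP => zE; apply: sa; rewrite -zE.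
have gE k : \sum_(j <- iota 0 k) - (a - c)^-1 ^+ j.+1 * (z - c) ^+ j =
    (z - a)^-1 - ((a - c)^-1 * (z - c)) ^+ k * (z - a)^-1.
  elim: k => [|k IH]; first by rewrite big_nil expr0 mul1r subrr.
  rewrite -addn1 iotaD big_cat /= IH big_cons big_nil addr0 add0n addn1.
  rewrite !exprMn [(z - c) ^+ k.+1]exprSr [(a - c)^-1 ^+ k.+1]exprSr.
  set X := (a - c)^-1 ^+ k; set Y := (z - c) ^+ k.
  by field; rewrite ac za.
rewrite /g gE mulN1r opprB addrCA subrr addr0 rnM rnX rnM !rnV mulrC.
have rza : r <= rn (z - a).
  have := rn_dist_tri a z c; rewrite (rnBC a z); lra.
have rzp : 0 < rn (z - a) by apply: lt_le_trans rza.
apply: ler_pM; rewrite ?invr_ge0 ?rn_ge0 ?exprn_ge0 ?mulr_ge0 ?invr_ge0 ?rn_ge0 //.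
  by rewrite lef_pV2 ?posrE.
rewrite lerXn2r ?nnegrE ?mulr_ge0 ?invr_ge0 ?rn_ge0 //.
rewrite mulrC ler_pdivrMr // mulrC ler_pdivlMr //; lra.
Qed.

End Diamond.

(** * Riesz spaces and balance *)

Section RieszDimension.
Context (R : realType) (H : completeNormedModType R[i]).
Context (ip : {dot H for (@Num.conj R[i])}).
Context (ip_norm : forall x : H, ip x x = `|x| ^+ 2).
Context (Hinf : infinite_dimensional H).
Context (K : H -> H) (cK : compact_op H K).
Implicit Types (Omega : set R[i]) (G : seq (seq R[i])).

Let bK := compact_bdd cK.
Let lK := bdd_lin bK.

Definition negset Omega : set R[i] := [set - z | z in Omega].

Lemma negsetE Omega a : negset Omega a <-> Omega (- a).
Proof.
split=> [[z Oz <-]|Oa]; first by rewrite opprK.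
by exists (- a) => //; rewrite opprK.
Qed.

Lemma riesz_formula Omega G d n e : separating_contour K Omega G ->
  0 < d -> (forall z, contour_support G z -> d <= rn z) ->
  schur_family ip K d n e ->
  (forall z x, d <= rn z -> ocompl ip n e (K x) = z *: x -> x = 0) ->
  exists q L, [/\ bdd L, forall x, ocompl ip n e (L (ocompl ip n e x)) = ocompl ip n e x,
   forall a, a \in diag_seq ip K n e -> ('X - a%:P) ^+ n %| q - (`[< Omega a >]%:R)%:P &
   forall x y, ip (papp K q (x - L (ocompl ip n e x)) +
      `[< Omega 0 >]%:R *: L (ocompl ip n e x)) y =
     contour_integral G (fun z => ip (resolvent K z x) y)].
Proof.
move=> [Gs G1 G0] d0 Gd fe noev.
have nos z : contour_support G z -> ~ spectrum K z.
  by move=> sz sp; have : (contour_support G `&` spectrum K) z by []; rewrite Gs.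
have s0 : ~ contour_support G 0 by move=> /nos; apply; exact: (spectrum_zero ip_norm cK fe).
have [L [bL QLQ KL]] := complement_exists ip_norm cK d0 fe noev.
have [q hq] := chinese_poly n (fun a => `[< Omega a >]%:R) (undup_uniq (diag_seq ip K n e)).
have {}hq a : a \in diag_seq ip K n e -> ('X - a%:P) ^+ n %| q - (`[< Omega a >]%:R)%:P.
  by rewrite -mem_undup; exact: hq.
have wn a : spectrum K a -> winding_number G a = `[< Omega a >]%:R.
  by move=> sa; case: asboolP => Oa; [exact: G1 | exact: G0].
exists q, L; split=> // x y.
apply/esym; apply: (@resolvent_integralE R H ip ip_norm K d cK d0 n e fe noev G Gd nos L bL QLQ KL
  (fun a => `[< Omega a >])) => //.
  move=> a ha; apply: wn; apply/(spectrum_compact ip_norm cK d0 fe noev) => //.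
  exact: (mem_diag_seq fe).
by apply: wn; exact: (spectrum_zero ip_norm cK fe).
Qed.

Lemma separating_away Omega G : separating_contour K Omega G ->
  exists2 d : R, 0 < d & forall z, contour_support G z -> d <= rn z.
Proof.
move=> [Gs _ _]; apply: contour_support_away => s0.
have [n [e [fe _]]] := schur_family_exists ip_norm cK ltr01.
have : (contour_support G `&` spectrum K) 0 by split=> //; exact: (spectrum_zero ip_norm cK fe).
by rewrite Gs.
Qed.

Lemma infinite_orthonormal_extension n e k : orthonormal_family ip n e ->
  exists f, orthonormal_family ip (n + k) f /\ forall i, (i < n)%N -> f i = e i.
Proof.
move=> he; elim: k => [|k [f [hf fe]]]; first by exists e; rewrite addn0.
have [x [x1 xo]] := infinite_orthogonal Hinf hf.
exists (fun i => if i == (n + k)%N then x else f i); rewrite addnS; split.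
  exact: (orthonormal_rcons ip_norm).
by move=> i hi; rewrite ltn_eqF ?fe // ltn_addr.
Qed.

(** By [riesz_formula] the idempotent is a spectral projection on the span of [e], plus the whole
    complement if 0 lies in [Omega]. The conclusion holds for all small [d], so that two sets can be
    compared through one Schur basis. *)
Lemma riesz_space_dim Omega : (exists G, separating_contour K Omega G) ->
  exists2 d0 : R, 0 < d0 & forall d n e, 0 < d -> d <= d0 -> schur_family ip K d n e ->
  (forall z x, d <= rn z -> ocompl ip n e (K x) = z *: x -> x = 0) ->
  subspace_dim (riesz_space ip Omega K) =
  if `[< Omega 0 >] then +oo%E
  else (count (fun a => `[< Omega a >]) (diag_seq ip K n e))%:R%:E.
Proof.
move=> [G sG].
have ex : [set E | exists2 G, separating_contour K Omega G &
    forall x y, ip (E x) y =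
      contour_integral G (fun z => ip (resolvent K z x) y)] !=set0.
  have [d d0 Gd] := separating_away sG.
  have [n [e [fe noev]]] := schur_family_exists ip_norm cK d0.
  have [q [L [_ _ _ hE]]] := riesz_formula sG d0 Gd fe noev.
  exists (fun x => papp K q (x - L (ocompl ip n e x)) + `[< Omega 0 >]%:R *: L (ocompl ip n e x)).
  by exists G.
(* The operator chosen by [get] comes with some contour [G'], possibly other than [G]; [d0] is taken
   from [G']. *)
have [G' sG' EE] := getPex ex.
rewrite -/(riesz_idempotent ip K Omega) in EE.
have [d0 d00 Gd0] := separating_away sG'.
exists d0 => // d n e dp dd fe noev.
have Gd z : contour_support G' z -> d <= rn z by move/Gd0; exact: le_trans.
have [q [L [bL QLQ hq hE]]] := riesz_formula sG' dp Gd fe noev.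
have he : orthonormal_family ip n e by case: fe.
have E x : riesz_idempotent ip K Omega x = papp K q (x - L (ocompl ip n e x)) +
    `[< Omega 0 >]%:R *: L (ocompl ip n e x).
  by apply: (ip_inj ip_norm) => y; rewrite EE hE.
have lL := bdd_lin bL; have lQ := bdd_lin (bdd_ocompl ip_norm n e).
case: (asboolP (Omega 0)) => O0; last first.
  apply: (dim_weight_space ip_norm cK fe hq) => x; split.
    move=> [y _ <-]; exists (coords ip n e (y - L (ocompl ip n e y))).
    rewrite E (asboolF O0) scale0r addr0; congr (papp K q _).
    by apply: ocompl_eq0; rewrite (linB lQ) QLQ subrr.
  move=> [u ->]; exists (comb e u) => //.
  by rewrite E (ocompl_comb fe) (lin0 lL) scaler0 addr0 subr0.
apply: subspace_dim_pinfty => k.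
have [f [hf fE]] := infinite_orthonormal_extension k he.
pose g (j : 'I_k) := f (n + j)%N.
have hg j : ocompl ip n e (g j) = g j.
  rewrite /ocompl oprojE big1 ?subr0 // => i _.
  rewrite -fE // hf ?ltn_add2l ?ltn_ord //; last by rewrite ltn_addr.
  by rewrite gtn_eqF ?scale0r // ltn_addr.
exists (fun j => L (g j)); last first.
  move=> j; exists (L (g j)) => //; rewrite E.
  have QL : ocompl ip n e (L (g j)) = g j by rewrite -{1}(hg j) QLQ hg.
  by rewrite QL subrr (lin0 (papp_lin lK q)) add0r asboolT // scale1r.
move=> a sa i.
have : \sum_j a j *: g j = 0.
  have := congr1 (ocompl ip n e) sa; rewrite (lin_sum lQ) (lin0 lQ) => h0; rewrite -[RHS]h0.
  apply: eq_bigr => j _; rewrite (linZ lQ); congr (_ *: _).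
  by rewrite -{2}(hg j) QLQ hg.
move/(congr1 (fun x => ip x (g i))); rewrite ip0l ip_suml (bigD1 i) //= ipZl.
rewrite hf ?ltn_add2l ?ltn_ord // eqxx mulr1 big1 ?addr0 // => j ji.
rewrite ipZl hf ?ltn_add2l ?ltn_ord // eqn_add2l.
by rewrite (_ : (j == i :> nat) = false) ?mulr0 //; apply/negbTE.
Qed.

(** Without separating contours [get] is applied to the empty set, and its value is the same for
    both sets. *)
Lemma riesz_space_empty Omega Omega' :
  ~ (exists G, separating_contour K Omega G) -> ~ (exists G, separating_contour K Omega' G) ->
  riesz_space ip Omega K = riesz_space ip Omega' K.
Proof.
move=> h h'; rewrite /riesz_space /riesz_idempotent.
have e0 O : ~ (exists G, separating_contour K O G) ->
  [set E | exists2 G, separating_contour K O G &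
    forall x y, ip (E x) y = contour_integral G (fun z => ip (resolvent K z x) y)] = set0.
  by move=> hO; rewrite -subset0 => E [G sG _]; apply: hO; exists G.
by rewrite !e0.
Qed.

Lemma spectrum_opp z : spectrum (- K) z <-> spectrum K (- z).
Proof.
have inv (T : H -> H) w : linear T -> ~ spectrum T w -> ~ spectrum (- T) (- w).
  move=> lT /contrapT [U [/bddP bU UK KU]]; apply; exists (fun x => - U x).
  have E x : shift_op (- T) (- w) x = - shift_op T w x.
    by rewrite /shift_op opprB scaleNr opprK addrC.
  split; first by apply/bddP; exact: bdd_opp.
    apply/funext => x /=; rewrite E (linN (bdd_lin bU)) opprK.
    by rewrite -[LHS]/((U \o shift_op T w) x) UK.
  apply/funext => x /=; rewrite E; have := congr1 (@^~ (- - U x)) KU.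
  rewrite /shift_op (linN lT) scalerN -opprB !opprK => _.
  by rewrite addrC -[LHS]/((shift_op T w \o U) x) KU.
split=> h; apply: contrapT => /inv k.
  have := k lK; rewrite opprK; exact.
by have := k (bdd_lin (bdd_opp bK)); rewrite opprK; exact.
Qed.

Lemma separating_opp Omega G : spectrum K = spectrum (- K) ->
  separating_contour K Omega G -> separating_contour K (negset Omega) (opp_contour G).
Proof.
move=> sK [Gs G1 G0].
have sN z : spectrum K z -> spectrum K (- z) by rewrite {1}sK => /spectrum_opp.
have ns z : spectrum K z -> ~ contour_support G (- z).
  move=> /sN sz cz; have : (contour_support G `&` spectrum K) (- z) by [].
  by rewrite Gs.
split.
- by rewrite -subset0 => z [/contour_support_opp cz /ns].
- move=> z sz /negsetE Oz; rewrite -[z]opprK winding_number_opp; last exact: ns.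
  by apply: G1 => //; exact: sN.
- move=> z sz nOz; rewrite -[z]opprK winding_number_opp; last exact: ns.
  by apply: G0; [exact: sN | move=> Oz; apply: nOz; apply/negsetE].
Qed.

Lemma separating_opp_iff Omega : spectrum K = spectrum (- K) ->
  (exists G, separating_contour K (negset Omega) G) -> exists G, separating_contour K Omega G.
Proof.
move=> sK [G /(separating_opp sK) h]; exists (opp_contour G).
suff <- : negset (negset Omega) = Omega by [].
by apply/seteqP; split=> z; rewrite !negsetE opprK.
Qed.

Lemma balanced_of_eigenspaces :
  (forall l, l != 0 -> subspace_dim (gen_eigenspace K l) = subspace_dim (gen_eigenspace K (- l))) ->
  balanced ip K.
Proof.
move=> hl.
have cnt d n e : 0 < d -> schur_family ip K d n e ->
    (forall z x, d <= rn z -> ocompl ip n e (K x) = z *: x -> x = 0) ->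
    forall l, count_mem l (diag_seq ip K n e) = count_mem (- l) (diag_seq ip K n e).
  by move=> d0 fe noev; exact: (count_diag_seq_opp ip_norm cK d0 fe noev hl).
have sK : spectrum K = spectrum (- K).
  apply/seteqP; suff S z : spectrum K z -> spectrum K (- z).
    split=> z; first by move=> /S /spectrum_opp.
    by move=> /spectrum_opp /S; rewrite opprK.
  have [->|z0] := eqVneq z 0; first by rewrite oppr0.
  have rz : 0 < rn z by rewrite rn_gt0.
  have [n [e [fe noev]]] := schur_family_exists ip_norm cK rz.
  move=> /(spectrum_compact ip_norm cK rz fe noev) => /(_ (lexx _)) h.
  apply/(spectrum_compact ip_norm cK rz fe noev); first by rewrite rnN.
  by rewrite -has_pred1 has_count -(cnt _ _ _ rz fe noev) -has_count has_pred1.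
split=> //.
- by apply/bddP.
- move=> O1 O2 _ _ _ _; rewrite -/(negset O1).
  have [ex|nex] := pselect (exists G, separating_contour K O1 G); last first.
    by rewrite (@riesz_space_empty O1 (negset O1)) // => /(separating_opp_iff sK).
  have [d1 d10 h1] := riesz_space_dim ex.
  have [|d2 d20 h2] := @riesz_space_dim (negset O1).
    by have [G /(separating_opp sK) sG] := ex; exists (opp_contour G).
  pose d := Num.min d1 d2; have d0 : 0 < d by rewrite lt_min d10.
  have [n [e [fe noev]]] := schur_family_exists ip_norm cK d0.
  rewrite (h1 d n e) ?ge_min ?lexx // (h2 d n e) ?ge_min ?lexx ?orbT //.
  have -> : `[< negset O1 0 >] = `[< O1 0 >].
    by apply: asbool_equiv_eq; rewrite negsetE oppr0.
  case: ifP => // _; congr (_%:R%:E).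
  have p : perm_eq (diag_seq ip K n e) (map -%R (diag_seq ip K n e)).
    apply/allP => a _ /=; apply/eqP; rewrite count_map (cnt _ _ _ d0 fe noev).
    by apply: eq_count => b /=; rewrite eqr_oppLR.
  rewrite (permP p) count_map; apply: eq_count => a /=.
  by apply: asbool_equiv_eq; rewrite negsetE.
- move=> alpha; have [->|a0] := eqVneq alpha 0; first by rewrite oppr0.
  have [s1 i1] := compact_shift_fredholm ip_norm cK a0.
  have [s2 i2] : semi_Fredholm ip (shift_op K (- alpha)) /\ Fredholm_index ip (shift_op K (- alpha)) = 0%E.
    by apply: compact_shift_fredholm => //; rewrite oppr_eq0.
  by split=> [//|_]; rewrite i1 i2.
Qed.

(** Balance is applied to a disc around [l] and the exterior of its closure: the disc meets the
    spectrum at most in [l], its negative at most in [- l], and the two Riesz dimensions are the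
    multiplicities. *)
Lemma eigenspaces_of_balanced l : balanced ip K -> l != 0 ->
  subspace_dim (gen_eigenspace K l) = subspace_dim (gen_eigenspace K (- l)).
Proof.
move=> [_ sK bal _] l0; have rl : 0 < rn l by rewrite rn_gt0.
pose d := rn l / 2; have d0 : 0 < d by rewrite divr_gt0.
have [n [e [fe noev]]] := schur_family_exists ip_norm cK d0.
(* The condition [4 * r <= rn l] keeps 0 out of the disc and puts every spectral point of modulus
   below [d = rn l / 2] at distance at least [2 * r] from [l]; the finitely many others are handled
   by [hr]. *)
have [r r0 [rd hr]] : exists2 r : R, 0 < r & 4 * r <= rn l /\
    forall a, a \in diag_seq ip K n e -> a != l -> 2 * r <= rn (a - l).
  elim: (diag_seq ip K n e) => [|a s [r r0 [rd hr]]].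
    by exists (rn l / 4); [rewrite divr_gt0 | split=> //; lra].
  have [al|al] := eqVneq a l.
    exists r => //; split=> // b; rewrite inE => /orP[/eqP ->|]; last exact: hr.
    by rewrite al eqxx.
  have ral : 0 < rn (a - l) by rewrite rn_gt0 subr_eq0.
  exists (Num.min r (rn (a - l) / 2)); first by rewrite lt_min r0 divr_gt0.
  have m1 : Num.min r (rn (a - l) / 2) <= r by rewrite ge_min lexx.
  have m2 : Num.min r (rn (a - l) / 2) <= rn (a - l) / 2 by rewrite ge_min lexx orbT.
  split; first lra.
  move=> b; rewrite inE => /orP[/eqP -> _|bs bl]; first lra.
  by have := hr b bs bl; lra.
have iso z : spectrum K z -> z != l -> 2 * r <= rn (z - l).
  move=> sz zl; have [dz|zd] := leP d (rn z).
    by apply: hr => //; apply/(spectrum_compact ip_norm cK d0 fe noev).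
  have := rn_sub_le l z; rewrite rnBC; move: zd; rewrite /d; lra.
have far t : 2 * r <= t -> r < t by move=> h; apply: lt_le_trans h; lra.
pose O1 : set R[i]^o := [set z | rn (z - l) < r].
pose O2 : set R[i]^o := [set z | r < rn (z - l)].
have o1 : open O1.
  have -> : O1 = ball (l : R[i]^o) r%:C.
    apply/seteqP; split=> z; rewrite -ball_normE /= lt_rn rnBC //.
  exact: ball_open.
have o2 : open O2.
  rewrite openE => z /= zr; exists (rn (z - l) - r)%:C; first by rewrite /= ltcR subr_gt0.
  move=> w; rewrite /= lt_rn => h; have := rn_dist_tri z w l; rewrite /O2 /=; lra.
have sG : separating_contour K O1 (diamond l r).
  split.
  - rewrite -subset0 => z [/(diamond_support r0) /andP[z0 zr] sz].
    have zl : z != l by rewrite -subr_eq0 -rn_gt0.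
    by have := far _ (iso z sz zl); rewrite ltNge zr.
  - move=> z sz; rewrite /O1 /= => zr.
    have [->|/(iso z sz)] := eqVneq z l; first exact: diamond_winding_center.
    by move/far; rewrite ltNge (ltW zr).
  - move=> z sz; rewrite /O1 /= => zr; apply: diamond_winding_outside => //.
    by apply: iso => //; apply/eqP => zl; apply: zr; rewrite zl subrr rn0.
have disj : O1 `&` O2 = set0.
  by rewrite -subset0 => z []; rewrite /O1 /O2 /= => /ltW; rewrite leNgt => /negP.
have cov : spectrum K `<=` O1 `|` O2.
  move=> z sz; have [->|/(iso z sz) h] := eqVneq z l.
    by left; rewrite /O1 /= subrr rn0.
  by right; exact: far.
have := bal O1 O2 o1 o2 disj cov; rewrite -/(negset O1).
have [d1 d10 h1] := riesz_space_dim (ex_intro _ _ sG).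
have [d2 d20 h2] := riesz_space_dim (ex_intro _ _ (separating_opp sK sG)).
pose d' := Num.min (rn l) (Num.min d1 d2).
have d'0 : 0 < d' by rewrite !lt_min rl d10.
have dl : d' <= rn l by rewrite /d' ge_min lexx.
have [n' [e' [fe' noev']]] := schur_family_exists ip_norm cK d'0.
have l0O : ~ O1 0.
  rewrite /O1 /= sub0r rnN; apply/negP; rewrite -leNgt; lra.
have l0O' : ~ negset O1 0 by rewrite negsetE oppr0.
rewrite (h1 d' n' e') ?(h2 d' n' e') ?(asboolF l0O) ?(asboolF l0O') //.
- rewrite !(dim_gen_eigenspace ip_norm cK fe' noev') ?rnN // => -[/eqP].
  rewrite eqr_nat => /eqP E; congr (_%:R%:E).
  have inS a : a \in diag_seq ip K n' e' -> spectrum K a.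
    move=> ha; apply/(spectrum_compact ip_norm cK d'0 fe' noev') => //.
    exact: (mem_diag_seq fe').
  have OE a : spectrum K a -> `[< O1 a >] = (a == l).
    move=> sa; have [->|al] := eqVneq a l.
      by apply: asboolT; rewrite /O1 /= subrr rn0.
    by apply: asboolF; rewrite /O1 /=; apply/negP; rewrite -leNgt; apply/ltW/far/iso.
  transitivity (count (fun a => `[< O1 a >]) (diag_seq ip K n' e')).
    by apply: eq_in_count => a /inS /OE ->.
  rewrite E; apply: eq_in_count => a /inS sa /=.
  have sNa : spectrum K (- a) by move: sa; rewrite {1}sK => /spectrum_opp.
  have -> : `[< negset O1 a >] = `[< O1 (- a) >] by apply: asbool_equiv_eq; exact: negsetE.
  by rewrite OE // eqr_oppLR.
- by rewrite /d' !ge_min lexx !orbT.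
- by rewrite /d' !ge_min lexx !orbT.
Qed.

End RieszDimension.

(** * Limits of commutators of idempotents *)

Section OperatorNorm.
Context (R : realType) (H : completeNormedModType R[i]).

Lemma op_norm_le (T : H -> H) (c : R) : 0 <= c -> (forall x, rn (T x) <= c * rn x) -> op_norm T <= c.
Proof.
move=> c0 hc; apply: sup_le_ub.
  by exists (rn (T 0)), 0 => //=; rewrite normr0.
move=> _ [x /= x1 <-]; apply: le_trans (hc x) _.
by rewrite -[leRHS]mulr1 ler_wpM2l // -le_rn.
Qed.

Lemma op_norm_ge (T : H -> H) x : bdd T -> rn (T x) <= op_norm T * rn x.
Proof.
move=> [lT [c c0 hc]].
have [->|x0] := eqVneq x 0; first by rewrite (lin0 lT) !rn0 mulr0.
have rx : 0 < rn x by rewrite rn_gt0.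
rewrite -ler_pdivrMr //.
have -> : rn (T x) / rn x = rn (T ((rn x)^-1%:C *: x)).
  by rewrite (linZ lT) rnZ rn_real gtr0_norm ?invr_gt0 // mulrC.
apply: ub_le_sup; last first.
  exists ((rn x)^-1%:C *: x) => //=; rewrite -[1]/(1%:C) le_rn rnZ rn_real.
  by rewrite gtr0_norm ?invr_gt0 // mulVf ?gt_eqF.
exists c => _ [y /= y1 <-]; apply: le_trans (hc y) _.
by rewrite -[leRHS]mulr1 ler_wpM2l // -le_rn.
Qed.

Lemma op_norm_lt (T : H -> H) (e : R) : bdd T -> op_norm T < e -> forall x, rn (T x) <= e * rn x.
Proof.
move=> bT Te x; apply: le_trans (op_norm_ge x bT) _.
by rewrite ler_wpM2r ?rn_ge0 // ltW.
Qed.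

Lemma papp_continuity (K : H -> H) p : bdd K -> exists2 M : R, 0 <= M &
  forall (T : H -> H) (t : R), linear T -> 0 <= t -> t <= 1 ->
  (forall x, rn (T x - K x) <= t * rn x) ->
  forall x, rn (papp T p x - papp K p x) <= M * t * rn x.
Proof.
move=> bK; have lK := bdd_lin bK; have [c c0 hc] := bdd_gt0 bK.
elim/poly_ind: p => [|p a [M M0 hM]].
  by exists 0 => // T t _ _ _ _ x; rewrite !papp0 subrr rn0 !mul0r.
have [d d0 hd] := bdd_gt0 (bdd_papp p bK).
exists (M * (c + 1) + d); first by rewrite addr_ge0 ?mulr_ge0 ?addr_ge0 // ltW.
move=> T t lT t0 t1 hT x; rewrite !pappD !papp_mulX !pappC opprD addrACA subrr addr0.
have -> : papp T p (T x) - papp K p (K x) =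
    (papp T p (T x) - papp K p (T x)) + papp K p (T x - K x).
  by rewrite (linB (papp_lin lK p)) addrA subrK.
have hTx : rn (T x) <= (c + 1) * rn x.
  have := rn_sub_le (T x) (K x); have := hT x; have := hc x.
  have : t * rn x <= 1 * rn x by rewrite ler_wpM2r ?rn_ge0.
  lra.
apply: le_trans (rnD _ _) _; rewrite !mulrDl; apply: lerD.
  apply: le_trans (hM T t lT t0 t1 hT _) _.
  apply: (@le_trans _ _ (M * t * ((c + 1) * rn x))); first by rewrite ler_wpM2l ?mulr_ge0.
  by rewrite le_eqVlt; apply/orP; left; apply/eqP; ring.
apply: le_trans (hd _) _; rewrite -mulrA ler_wpM2l ?(ltW d0) //.
Qed.

End OperatorNorm.

Lemma rn_near (R : realType) (V : normedZmodType R[i]) (a b : V) (k l n : R) :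
  0 <= n -> k <= 1 -> rn (a - b) <= k * n -> rn b <= l * n -> rn a <= (l + 1) * n.
Proof.
move=> n0 k1 h1 h2; have h3 := rn_sub_le a b.
have h4 : k * n <= 1 * n by rewrite ler_wpM2r.
by rewrite mulrDl; move: h1 h2 h3 h4; set p := k * n; set q := l * n; lra.
Qed.

(** * Improving approximate idempotents *)

Section Polishing.
Context (R : realType) (H : completeNormedModType R[i]).
Context (ip : {dot H for (@Num.conj R[i])}).
Context (ip_norm : forall x : H, ip x x = `|x| ^+ 2).

(** The McWeeny purification step: it fixes 0 and 1 and has derivative 0 at both. *)
Definition polish (p : {poly R[i]}) := 3 *: p ^+ 2 - 2 *: p ^+ 3.

Lemma polish_comp p q : polish p \Po q = polish (p \Po q).
Proof. by rewrite /polish comp_polyB !comp_polyZ !rmorphXn. Qed.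

Lemma iter_polish_comp j p q : iter j polish p \Po q = iter j polish (p \Po q).
Proof. by elim: j => //= j IH; rewrite polish_comp IH. Qed.

(* Iterating q -> 3 q^2 - 2 q^3 turns an approximate idempotent p(T) close to P into *)
(* better and better ones while staying close to P.                                *)
Lemma polishP (T P : H -> H) (p : {poly R[i]}) (c : R) : bdd T -> 1 <= c ->
  linear P -> (forall x, P (P x) = P x) -> (forall x, rn (P x) <= c * rn x) ->
  (forall x, rn (papp T p x - P x) <= (128 * (c + 2) ^+ 3)^-1 * rn x) ->
  forall j, (forall x, rn (papp T (iter j polish p) x - P x) <= (8 * (c + 2))^-1 * rn x) /\
   (forall x, rn (papp T (iter j polish p ^+ 2 - iter j polish p) x) <= (2 ^+ j)^-1 * rn x).
Proof.
move=> bT c1 lP PP hP hp.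
have lT := bdd_lin bT.
(* Chosen so that the initial idempotency defect [e0 = (2 * c + 2) * eta] is at most 1/8 and the
   total drift away from [P] stays below [(8 * (c + 2))^-1]. *)
set eta := (128 * (c + 2) ^+ 3)^-1 in hp.
have c2 : 0 < c + 2 by apply: ltr_wpDl => //; apply: le_trans c1.
have eta0 : 0 < eta by rewrite invr_gt0 mulr_gt0 // exprn_gt0.
have etaE : eta * (c + 2) ^+ 3 = 128^-1.
  by rewrite /eta; field; rewrite gt_eqF.
pose Q j := papp T (iter j polish p).
pose E j := papp T (iter j polish p ^+ 2 - iter j polish p).
pose e0 := (2 * c + 2) * eta.
have eta1 : eta <= 1.
  apply: (@le_trans _ _ (128^-1)); last by rewrite invf_le1 // ler1n.
  rewrite -etaE ler_peMr ?(ltW eta0) // exprn_ege1 //; lra.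
have e00 : 0 <= e0 by rewrite /e0 mulr_ge0 ?(ltW eta0) //; lra.
have e08 : e0 <= 8^-1.
  have h : eta * (c + 2) <= 128^-1.
    rewrite -etaE ler_wpM2l ?(ltW eta0) // ler_eXnr //; lra.
  rewrite /e0; nra.
have drift : eta + (2 * c + 3) * e0 * 2 <= (8 * (c + 2))^-1.
  have -> : (8 * (c + 2))^-1 = 16 * eta * (c + 2) ^+ 2.
    have -> : 16 * eta * (c + 2) ^+ 2 = 16 * (eta * (c + 2) ^+ 3) / (c + 2) by field; rewrite gt_eqF.
    by rewrite etaE; field; rewrite gt_eqF.
  rewrite /e0.
  have -> : 16 * eta * (c + 2) ^+ 2 = eta * (16 * (c + 2) ^+ 2) by ring.
  have -> : eta + (2 * c + 3) * ((2 * c + 2) * eta) * 2 = eta * (1 + (2 * c + 3) * (2 * c + 2) * 2) by ring.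
  rewrite ler_wpM2l ?(ltW eta0) //; nra.
have half j : 0 < (2 ^+ j)^-1 :> R by rewrite invr_gt0 exprn_gt0.
have half1 j : (2 ^+ j)^-1 <= 1 :> R by rewrite invf_le1 ?exprn_gt0 // exprn_ege1 // ler1n.
have hD x : rn (P x) <= c * rn x by [].
have lQ j : linear (Q j) by exact: papp_lin.
have main j : (forall x, rn (E j x) <= e0 * (2 ^+ j)^-1 * rn x) /\
    (forall x, rn (Q j x - P x) <= (eta + (2 * c + 3) * e0 * (2 - 2 * (2 ^+ j)^-1)) * rn x).
  elim: j => [|j [IHE IHQ]].
    rewrite expr0 invr1 !mulr1; split=> x; last first.
      rewrite subrr mulr0 addr0; exact: hp.
    have -> : E 0%N x = Q 0%N (Q 0%N x - P x) + (Q 0%N (P x) - P (P x)) - (Q 0%N x - P x).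
      rewrite /E pappB expr2 pappM // -/(Q 0%N) (linB (lQ 0%N)) PP.
      by vector_ring ip_norm.
    have h1 : rn (Q 0%N (Q 0%N x - P x)) <= (c + 1) * (eta * rn x).
      have h : forall y, rn (Q 0%N y) <= (c + 1) * rn y.
        by move=> y; exact: rn_near (rn_ge0 y) eta1 (hp y) (hP y).
      by apply: le_trans (h _) _; apply: ler_wpM2l; [lra | exact: hp].
    have h2 : rn (Q 0%N (P x) - P (P x)) <= eta * (c * rn x).
      by apply: le_trans (hp _) _; rewrite ler_wpM2l // ltW.
    have h3 := hp x; rewrite -/(Q 0%N x) in h3.
    apply: le_trans (rnB _ _) _.
    apply: le_trans (lerD (le_trans (rnD _ _) (lerD h1 h2)) h3) _.
    by rewrite /e0 le_eqVlt; apply/orP; left; apply/eqP; ring.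
  set b := e0 * (2 ^+ j)^-1 in IHE; have b0 : 0 <= b by rewrite mulr_ge0 // ltW.
  have b8 : b <= 8^-1 by apply: le_trans e08; rewrite ler_piMr.
  have q0 : 0 <= 2 * c + 3 by lra.
  have hQ x : rn (Q j x) <= (c + 1) * rn x.
    apply: rn_near (rn_ge0 x) _ (IHQ x) (hP x).
    apply: (@le_trans _ _ (8 * (c + 2))^-1); last by rewrite invf_le1; lra.
    apply: le_trans drift; rewrite lerD2l; apply: ler_wpM2l; first by rewrite mulr_ge0.
    by have := half j; lra.
  have sE : 2 ^+ j.+1 = 2 * 2 ^+ j :> R by rewrite exprS.
  set p' := iter j polish p in IHE IHQ hQ *; set v := p' ^+ 2 - p'.
  split=> x.
    (* For [v = p' ^+ 2 - p'] the new defect is [v ^+ 2 * (4 v - 3)]; being quadratic in [v], it is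
       at least halved. *)
    have -> : E j.+1 x = E j (E j (4 *: E j x - 3 *: x)).
      rewrite /E /= -/p' -/v.
      have -> : polish p' ^+ 2 - polish p' = v * (v * (4 *: v - 3%:P)).
        by rewrite /polish /v -!mul_polyC; ring.
      by rewrite !pappM // (pappB T (4 *: v)) pappZ pappC.
    apply: le_trans (IHE _) _; apply: le_trans (ler_wpM2l b0 (IHE _)) _.
    have h : rn (4 *: E j x - 3 *: x) <= (4 * b + 3) * rn x.
      apply: le_trans (rnB _ _) _; rewrite !rnZ !(rn_nat R).
      by have := IHE x; lra.
    apply: le_trans (ler_wpM2l b0 (ler_wpM2l b0 h)) _.
    have -> : e0 / 2 ^+ j.+1 = b * 2^-1 by rewrite sE invfM mulrA mulrAC.
    have hb : b * (4 * b + 3) <= 2^-1 by nra.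
    have hx : b * (b * (4 * b + 3)) * rn x <= b * 2^-1 * rn x.
      by apply: ler_wpM2r; [exact: rn_ge0 | exact: ler_wpM2l].
    by apply: le_trans hx; rewrite le_eqVlt; apply/orP; left; apply/eqP; ring.
  (* One step moves the polynomial by [v - 2 p' v], proportional to the defect, so the total motion
     is a convergent geometric sum. *)
  have -> : Q j.+1 x - P x = (Q j x - P x) + (E j x - 2 *: Q j (E j x)).
    have -> : Q j.+1 x = papp T (p' + (v - 2 *: (p' * v))) x.
      by rewrite /Q /= -/p' /polish /v -!mul_polyC; congr papp; ring.
    by rewrite pappD pappB pappZ pappM // addrAC.
  apply: le_trans (rnD _ _) _.
  have h : rn (E j x - 2 *: Q j (E j x)) <= (2 * c + 3) * b * rn x.
    apply: le_trans (rnB _ _) _; rewrite rnZ (rn_nat R).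
    have := hQ (E j x); have := IHE x => h1 h2.
    have h3 : (c + 1) * rn (E j x) <= (c + 1) * (b * rn x) by rewrite ler_wpM2l //; lra.
    apply: (@le_trans _ _ (b * rn x + 2 * ((c + 1) * (b * rn x)))); first lra.
    by rewrite le_eqVlt; apply/orP; left; apply/eqP; ring.
  apply: le_trans (lerD (IHQ x) h) _.
  rewrite -mulrDl sE invfM /b le_eqVlt; apply/orP; left; apply/eqP.
  by field; rewrite expf_neq0.
move=> j; have [hE hQ] := main j; split=> x.
  apply: le_trans (hQ x) _; rewrite ler_wpM2r ?rn_ge0 //; apply: le_trans drift.
  rewrite lerD2l; apply: ler_wpM2l; first by rewrite mulr_ge0 //; lra.
  by have := half j; lra.
apply: le_trans (hE x) _; rewrite ler_wpM2r ?rn_ge0 //.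
rewrite ler_piMl ?(ltW (half j)) //; apply: le_trans e08 _.
by rewrite invf_le1 // ler1n.
Qed.

End Polishing.

Section PolynomialReflection.
Context (F : fieldType).
Implicit Types (p f : {poly F}).

Lemma dvdp_comp_opp b k f : ('X - b%:P) ^+ k %| f -> ('X - (- b)%:P) ^+ k %| f \Po (- 'X).
Proof.
move=> /dvdpP [g ->]; rewrite comp_polyM dvdp_mull // rmorphXn /= comp_polyB comp_polyX comp_polyC.
have -> : - 'X - b%:P = - ('X - (- b)%:P) :> {poly F} by rewrite polyCN opprK opprD.
by rewrite exprNn dvdp_mull.
Qed.

Lemma dvd_one_sub_exp (y : {poly F}) k : y %| 1 - (1 - y) ^+ k.
Proof.
have -> : 1 - (1 - y) ^+ k = - ((1 - y) ^+ k - 1) by rewrite opprB.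
have -> : (1 - y) ^+ k - 1 = - y * \sum_(i < k) (1 - y) ^+ i by rewrite subrX1; congr (_ * _); ring.
by rewrite mulNr opprK dvdp_mulr.
Qed.

End PolynomialReflection.

(** * Riesz projections as limits of polynomials without constant term *)

Section ApproximateProjection.
Context (R : realType) (H : completeNormedModType R[i]).
Context (ip : {dot H for (@Num.conj R[i])}).
Context (ip_norm : forall x : H, ip x x = `|x| ^+ 2).

Lemma papp_one_sub_exp (T : H -> H) y (eta : R) k : linear T -> 0 <= eta -> eta <= 1 ->
  (forall x, rn (papp T y x) <= eta * rn x) ->
  forall x, rn (papp T (1 - (1 - y) ^+ k) x) <= 2 ^+ k * eta * rn x.
Proof.
move=> lT eta0 eta1 hy.
have h2 i x : rn (papp T ((1 - y) ^+ i) x) <= 2 ^+ i * rn x.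
  elim: i x => [|i IH] x; first by rewrite !expr0 papp1 mul1r.
  rewrite exprSr pappM //; apply: le_trans (IH _) _.
  rewrite [2 ^+ i.+1]exprSr -mulrA ler_wpM2l ?exprn_ge0 // pappB papp1.
  apply: le_trans (rnB _ _) _.
  rewrite mulr_natl mulr2n lerD2l; apply: le_trans (hy x) _.
  by rewrite -[leRHS]mul1r ler_wpM2r ?rn_ge0.
elim: k => [|k IH] x.
  by rewrite expr0 subrr papp0 rn0 !mulr_ge0 ?rn_ge0.
have -> : 1 - (1 - y) ^+ k.+1 = (1 - (1 - y) ^+ k) + (1 - y) ^+ k * y.
  by rewrite exprSr; ring.
rewrite pappD pappM //; apply: le_trans (rnD _ _) _.
have b1 := IH x; have b2 := le_trans (h2 k _) (ler_wpM2l (exprn_ge0 k (ler0n R 2)) (hy x)).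
apply: le_trans (lerD b1 b2) _.
by rewrite exprS le_eqVlt; apply/orP; left; apply/eqP; ring.
Qed.

Context (K : H -> H) (d : R) (cK : compact_op H K) (d0 : 0 < d).
Context (n : nat) (e : nat -> H) (fe : schur_family ip K d n e).
Context (noev : forall z x, d <= rn z -> ocompl ip n e (K x) = z *: x -> x = 0).

Let bK := compact_bdd cK.
Let lK := bdd_lin bK.
Let he : orthonormal_family ip n e. Proof. by case: fe. Qed.
Local Notation Q := (ocompl ip n e).
Local Notation Kt := (tail_op ip K n e).
Local Notation ds := (diag_seq ip K n e).
Let lKt : linear Kt := bdd_lin (bdd_tail ip_norm cK n e).
Let bQ : bdd Q := bdd_ocompl ip_norm n e.
Let lQ := bdd_lin bQ.

Context (L : H -> H) (bL : bdd L) (QLQ : forall x, Q (L (Q x)) = Q x).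
Context (KL : forall p x, papp K p (L x) = L (papp Kt p x)).
Let lL := bdd_lin bL.

(** [x - L (Q x)] is the component of [x] in the span of [e]; for [q] congruent to an indicator this
    is the Riesz projection of the selected eigenvalues. *)
Definition weight_projection q x := papp K q (x - L (Q x)).

Lemma bdd_weight_projection q : bdd (weight_projection q).
Proof.
apply: (bdd_comp (bdd_papp q bK)); apply: bdd_sub; first exact: bdd_id.
exact: (bdd_comp bL bQ).
Qed.

Lemma weight_projection_comb q (u : 'rV_n) :
  weight_projection q (comb e u) = comb e (u *m compress ip K n e q).
Proof.
rewrite /weight_projection (ocompl_comb fe) (lin0 lL) subr0.
exact: (papp_comb ip_norm cK fe).
Qed.

Lemma weight_projectionE q x : weight_projection q x =
  comb e (coords ip n e (x - L (Q x)) *m compress ip K n e q).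
Proof.
rewrite /weight_projection (complement_comb ip_norm _ QLQ).
by rewrite (papp_comb ip_norm cK fe) -(complement_comb ip_norm _ QLQ).
Qed.

(** The rank is given in the two forms used to compare projections: independent fixed vectors, from
    the row base of the matrix, and a factorization through a space of coordinates, from its column
    base. *)
Lemma weight_projection_data (w : R[i] -> bool) q :
  (forall a, a \in ds -> ('X - a%:P) ^+ n %| q - ((w a)%:R)%:P) ->
  let P := weight_projection q in
  [/\ forall x, P (P x) = P x,
    exists v : 'I_(count w ds) -> H, lin_indep v /\ forall i, P (v i) = v i &
    exists cf : H -> 'rV[R[i]]_(count w ds), linear cf /\ forall x, cf x = 0 -> P x = 0].
Proof.
move=> hq P; have AA := compress_idempotent ip_norm cK fe hq.
have rA := rank_compress ip_norm cK fe hq; rewrite -rA.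
set A := compress ip K n e q in AA rA *.
split.
- by move=> x; rewrite /P (weight_projectionE q x) weight_projection_comb -mulmxA AA.
- exists (fun i => comb e (row i (row_base A))); split.
    move=> a sa i.
    have : (\row_i a i) *m row_base A = 0.
      rewrite -(coords_comb (_ *m _) he) -[RHS](lin0 (coords_lin ip n e)); congr coords.
      rewrite -[RHS]sa mulmx_sum_row (lin_sum (@comb_lin _ _ n e)).
      by apply: eq_bigr => j _; rewrite (linZ (@comb_lin _ _ n e)) mxE.
    rewrite -(mul0mx _ (row_base A)) => /(row_free_inj (row_base_free A)).
    by move/rowP/(_ i); rewrite !mxE.
  move=> i; rewrite /P weight_projection_comb.
  have /submxP [u ->] : (row i (row_base A) <= A)%MS by rewrite -(eq_row_base A) row_sub.
  by rewrite -mulmxA AA.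
- exists (fun x => coords ip n e (x - L (Q x)) *m col_base A); split.
    move=> a x y; rewrite scalemxAl -mulmxDl; congr (_ *m _).
    rewrite lQ lL -(coords_lin ip n e); congr coords.
    by rewrite scalerBr opprD addrACA.
  move=> x h; rewrite /P weight_projectionE -/A -(mulmx_base A) mulmxA h mul0mx.
  exact: (lin0 (@comb_lin _ _ n e)).
Qed.

(** Both polynomials agree modulo [chi], hence on the span of [e]; the whole error sits on the
    tail. *)
Lemma papp_sub_weight_projection w q p :
  (forall a, a \in ds -> ('X - a%:P) ^+ n %| q - ((w a : bool)%:R)%:P) ->
  (forall a, a \in ds -> ('X - a%:P) ^+ n %| p - ((w a)%:R)%:P) ->
  forall x, papp K p x - weight_projection q x = L (papp Kt p (Q x)).
Proof.
move=> hq hp x.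
have -> : weight_projection q x = papp K p (x - L (Q x)).
  apply/eqP; rewrite -subr_eq0 /weight_projection -pappB; apply/eqP.
  rewrite (complement_comb ip_norm _ QLQ); apply: (papp_dvd lK _ (diag_poly_comb cK fe _)).
  apply: dvd_diag_poly => a ha.
  have -> : q - p = (q - ((w a)%:R)%:P) - (p - ((w a)%:R)%:P) by ring.
  by apply: dvdp_sub; [exact: hq | exact: hp].
by rewrite (linB (papp_lin lK p)) subKr KL.
Qed.

Lemma tail_power_small (r r' : {poly R[i]}) (l : R[i]) (eta : R) : d <= rn l -> 0 < eta ->
  exists2 M, (0 < M)%N & forall c, rn c = (rn l)^-1 -> forall x,
    rn (papp Kt (c ^+ M *: ('X^M * r)) x) <= eta * rn x /\
    rn (papp Kt (c ^+ M *: ('X^M * r')) x) <= eta * rn x.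
Proof.
move=> dl eta0; have rl : 0 < rn l by apply: lt_le_trans dl.
have bKt := bdd_tail ip_norm cK n e.
have [N [th [N0 th0 th1 hN]]] := tail_powers ip_norm cK d0 noev.
have [C C0 hC] := bdd_gt0 (bdd_papp r bKt).
have [C' C'0 hC'] := bdd_gt0 (bdd_papp r' bKt).
have [q hq] : exists q, (C + C') * th ^+ q.+1 < eta.
  apply: contrapT => hn; have : eta <= 0; last by rewrite leNgt eta0.
  apply: (@le_geometric R eta (C + C') th th0 th1) => q.
  by rewrite leNgt; apply/negP => h; apply: hn; exists q.
exists (N * q.+1)%N; first by rewrite muln_gt0 N0.
set M := (N * q.+1)%N => c hc x.
have iterB k y : rn (iter (N * k) Kt y) <= (th * d ^+ N) ^+ k * rn y.
  elim: k => [|k IH]; first by rewrite muln0 expr0 mul1r.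
  rewrite mulnS iterD exprS -mulrA; apply: le_trans (hN _) _.
  by rewrite ler_wpM2l // mulr_ge0 // exprn_ge0 // ltW.
have key (s : {poly R[i]}) (D : R) : 0 < D -> D <= C + C' -> (forall y, rn (papp Kt s y) <= D * rn y) ->
    rn (papp Kt (c ^+ M *: ('X^M * s)) x) <= eta * rn x.
  move=> D0 DC hD; rewrite pappZ pappM // papp_Xn // rnZ rnX hc.
  have h1 : rn (iter M Kt (papp Kt s x)) <= th ^+ q.+1 * d ^+ M * (D * rn x).
    apply: le_trans (iterB _ _) _; rewrite exprMn -exprM -/M.
    by rewrite ler_wpM2l // mulr_ge0 ?exprn_ge0 // ltW.
  have h2 : (rn l)^-1 ^+ M * d ^+ M <= 1.
    rewrite -exprMn; apply: exprn_ile1; last by rewrite mulrC ler_pdivrMr // mul1r.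
    by rewrite mulr_ge0 ?invr_ge0 ?rn_ge0 // ltW.
  have i0 : 0 <= (rn l)^-1 ^+ M by rewrite exprn_ge0 // invr_ge0 ltW.
  apply: le_trans (ler_wpM2l i0 h1) _.
  have -> : (rn l)^-1 ^+ M * (th ^+ q.+1 * d ^+ M * (D * rn x)) =
     ((rn l)^-1 ^+ M * d ^+ M) * (D * th ^+ q.+1 * rn x) by ring.
  have D1 : 0 <= D * th ^+ q.+1 * rn x by rewrite !mulr_ge0 ?rn_ge0 ?exprn_ge0 // ltW.
  apply: le_trans (ler_wpM2r D1 h2) _; rewrite mul1r ler_wpM2r ?rn_ge0 //.
  by apply: le_trans (ltW hq); rewrite ler_wpM2r // exprn_ge0.
split; [apply: (key r C) | apply: (key r' C')] => //.
  by rewrite lerDl ltW.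
by rewrite lerDr ltW.
Qed.

(** Take [y = ('X / l) ^+ M * r] with [r.[l] = 1] and [r] vanishing to high order at the other
    relevant points. On the tail [y] is small for large [M], because the powers of [Kt] decay faster
    than those of [d <= rn l], and [p = 1 - (1 - y) ^+ k] inherits this smallness. *)
Lemma approx_projections (l : R[i]) : l != 0 -> d <= rn l ->
  exists P P' : H -> H, exists m m' : nat, exists v : 'I_m -> H, exists cf : H -> 'rV[R[i]]_m',
  [/\ [/\ bdd P, bdd P', forall x, P (P x) = P x & forall x, P' (P' x) = P' x],
      [/\ subspace_dim (gen_eigenspace K l) = m%:R%:E,
          subspace_dim (gen_eigenspace K (- l)) = m'%:R%:E,
          lin_indep v, forall i, P (v i) = v i & linear cf],
      forall x, cf x = 0 -> P' x = 0 &
      forall eps : R, 0 < eps -> exists p : {poly R[i]}, [/\ 'X %| p,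
        forall x, rn (papp K p x - P x) <= eps * rn x &
        forall x, rn (papp K (p \Po (- 'X)) x - P' x) <= eps * rn x]].
Proof.
move=> l0 dl.
have [q hq] := chinese_poly n (fun a => (pred1 l a)%:R) (undup_uniq ds).
have {}hq a : a \in ds -> ('X - a%:P) ^+ n %| q - ((pred1 l a)%:R)%:P.
  by rewrite -mem_undup; exact: hq.
have [q' hq'] := chinese_poly n (fun a => (pred1 (- l) a)%:R) (undup_uniq ds).
have {}hq' a : a \in ds -> ('X - a%:P) ^+ n %| q' - ((pred1 (- l) a)%:R)%:P.
  by rewrite -mem_undup; exact: hq'.
have [PP [v [vi Pv]] _] := weight_projection_data hq.
have [PP' _ [cf [lcf hcf]]] := weight_projection_data hq'.
exists (weight_projection q), (weight_projection q'), (count (pred1 l) ds), (count (pred1 (- l)) ds), v, cf.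
split=> //.
- by split=> //; exact: bdd_weight_projection.
- by split=> //; apply: (dim_gen_eigenspace ip_norm cK fe noev) => //; rewrite rnN.
move=> eps eps0; have [CL CL0 hL] := bdd_gt0 bL.
(* The negatives of the eigenvalues are included because [p] composed with [- 'X] must have the
   right values at the eigenvalues too. *)
pose k := n.+1; pose s := undup (l :: ds ++ map -%R ds).
pose r0 := \prod_(a <- rem l s) ('X - a%:P) ^+ k.
have us : uniq s by exact: undup_uniq.
have r0l : r0.[l] != 0.
  rewrite /r0 horner_prod prodf_seq_neq0; apply/allP => a /=.
  rewrite (mem_rem_uniq _ us) inE => /andP[al _].
  by rewrite horner_exp hornerXsubC expf_neq0 // subr_eq0 eq_sym.
pose r := r0.[l]^-1 *: r0.
pose eta := Num.min 1 (eps / (CL * 2 ^+ k)).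
have eta0 : 0 < eta by rewrite lt_min ltr01 divr_gt0 // mulr_gt0 // exprn_gt0.
have [M M0 hM] := tail_power_small r (r \Po (- 'X)) dl eta0.
pose y := l^-1 ^+ M *: ('X^M * r).
(* The power [k] turns the simple equality [y.[l] = 1] into [p] congruent to 1 to order [k] at [l],
   and preserves the zeros of [y], among them 0. *)
pose p := 1 - (1 - y) ^+ k.
have yE : y \Po (- 'X) = (- l^-1) ^+ M *: ('X^M * (r \Po (- 'X))).
  rewrite /y comp_polyZ comp_polyM rmorphXn /= comp_polyX.
  rewrite exprNn [(- l^-1) ^+ M]exprNn -(signr_odd {poly R[i]} M) -(signr_odd R[i] M).
  by case: (odd M); rewrite ?expr1 ?expr0 ?mulN1r ?mul1r ?mulNr ?scalerN ?scaleNr.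
have c1 : (1 : {poly R[i]}) \Po (- 'X) = 1 by rewrite -polyC1 comp_polyC.
have pE : p \Po (- 'X) = 1 - (1 - (y \Po (- 'X))) ^+ k.
  by rewrite /p !comp_polyB rmorphXn /= comp_polyB c1.
have yl : ('X - l%:P) ^+ k %| p - 1.
  have -> : p - 1 = - (1 - y) ^+ k by rewrite /p; ring.
  rewrite dvdpNr.
  apply: dvdp_exp2r; rewrite dvdp_XsubCl rootE hornerD hornerN hornerZ hornerM hornerXn.
  by rewrite hornerZ mulVf // mulr1 -exprMn mulVf // expr1n hornerC subrr.
have yr a : a \in s -> a != l -> ('X - a%:P) ^+ k %| p.
  move=> sa al; apply: dvdp_trans (dvd_one_sub_exp y k).
  rewrite /y dvdpZr ?expf_neq0 ?invr_eq0 // dvdp_mull // /r dvdpZr ?invr_eq0 //.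
  have ar : a \in rem l s by rewrite (mem_rem_uniq _ us) inE al.
  by rewrite /r0 (big_rem a ar) dvdp_mulr.
have kn b (f : {poly R[i]}) : ('X - b%:P) ^+ k %| f -> ('X - b%:P) ^+ n %| f.
  by apply: dvdp_trans; rewrite dvdp_exp2l.
have hp a : a \in ds -> ('X - a%:P) ^+ n %| p - ((pred1 l a)%:R)%:P.
  rewrite /=; move=> ha; have [->|al] := eqVneq a l; first by rewrite polyC1; apply: kn.
  by rewrite polyC0 subr0; apply/kn/yr => //; rewrite mem_undup inE mem_cat ha orbT.
have hp' a : a \in ds -> ('X - a%:P) ^+ n %| (p \Po (- 'X)) - ((pred1 (- l) a)%:R)%:P.
  rewrite /=; move=> ha; have [->|al] := eqVneq a (- l).
    have -> : p \Po - 'X - 1%:P = (p - 1) \Po (- 'X).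
      by rewrite [RHS]comp_polyB c1 polyC1.
    by apply: kn; apply: dvdp_comp_opp.
  rewrite polyC0 subr0; apply: kn; rewrite -[a]opprK; apply: dvdp_comp_opp; apply: yr.
    by rewrite mem_undup inE mem_cat map_f ?orbT.
  by rewrite eqr_oppLR.
have eta1 : eta <= 1 by rewrite /eta ge_min lexx.
have etaC : CL * (2 ^+ k * eta) <= eps.
  have : eta <= eps / (CL * 2 ^+ k) by rewrite /eta ge_min lexx orbT.
  by rewrite ler_pdivlMr ?mulr_gt0 ?exprn_gt0 // mulrC -mulrA.
have fin (f : {poly R[i]}) : (forall x, rn (papp Kt f x) <= eta * rn x) ->
    forall x, rn (L (papp Kt (1 - (1 - f) ^+ k) (Q x))) <= eps * rn x.
  move=> hf x; apply: le_trans (hL _) _.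
  have h := papp_one_sub_exp k lKt (ltW eta0) eta1 hf (Q x).
  apply: le_trans (ler_wpM2l (ltW CL0) h) _; rewrite mulrA.
  have c0 : 0 <= CL * (2 ^+ k * eta) by rewrite !mulr_ge0 ?exprn_ge0 ?ltW.
  apply: le_trans (ler_wpM2l c0 (rn_sub_oproj ip_norm x he)) _.
  by rewrite ler_wpM2r ?rn_ge0.
exists p; split.
- apply: dvdp_trans (dvd_one_sub_exp y k); rewrite /y dvdpZr ?expf_neq0 ?invr_eq0 //.
  by rewrite dvdp_mulr // -(prednK M0) exprS dvdp_mulr.
- move=> x; have -> := @papp_sub_weight_projection (pred1 l) q p hq hp x.
  by rewrite /p; apply: fin => z; have [h _] := hM l^-1 (rnV _) z.
- move=> x; have -> := @papp_sub_weight_projection (pred1 (- l)) q' _ hq' hp' x.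
  rewrite pE; apply: fin => z.
  by have [_] := hM (- l^-1) (etrans (rnN _) (rnV _)) z; rewrite -yE.
Qed.

End ApproximateProjection.

Section ClosureOfCommutators.
Context (R : realType) (H : completeNormedModType R[i]).
Context (ip : {dot H for (@Num.conj R[i])}).
Context (ip_norm : forall x : H, ip x x = `|x| ^+ 2).

(* With A = E - F and B = 1 - E - F, a commutator C = EF - FE of idempotents       *)
(* satisfies C = BA and AC = -CA.                                                 *)
Lemma commutator_factor (C : H -> H) : idempotent_commutator H C -> bdd C /\
  exists A B, [/\ bdd A, bdd B, forall x, B (A x) = C x & forall x, A (C x) = - C (A x)].
Proof.
move=> [E [F [[/bddP bE EE] [/bddP bF FF] CE]]].
have lE := bdd_lin bE; have lF := bdd_lin bF.
have {}EE x : E (E x) = E x by rewrite -[LHS]/((E \o E) x) EE.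
have {}FF x : F (F x) = F x by rewrite -[LHS]/((F \o F) x) FF.
have CE' x : C x = E (F x) - F (E x) by rewrite CE.
split.
  have -> : C = (E \o F) \- (F \o E) by apply/funext => x; rewrite CE'.
  by apply: bdd_sub; exact: bdd_comp.
exists (fun x => E x - F x), (fun x => x - E x - F x); split.
- exact: bdd_sub.
- by apply: bdd_sub => //; apply: bdd_sub => //; exact: bdd_id.
- move=> x; rewrite CE' !(linD lE, linN lE, linD lF, linN lF, EE, FF).
  by vector_ring ip_norm.
- move=> x; rewrite !CE' !(linD lE, linN lE, linD lF, linN lF, EE, FF).
  by vector_ring ip_norm.
Qed.

(** Suppose [m > m'], and take a commutator [C = BA] close to [K]. Some nonzero [x] fixed by [P] has
    [P' u = 0] for [u = A (pj(C) x)]. By anticommutation [u] is also almost fixed by [pjN(C)], which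
    is close to [P']; so [u] is tiny. As [p] has no constant term, [p(C) pj(C) x = g(C) B u] is tiny
    as well, yet it is close to [x]. *)
Lemma rank_le_of_closure (K P P' : H -> H) (m m' : nat) (v : 'I_m -> H) (cf : H -> 'rV[R[i]]_m') :
  bdd K -> norm_closure (idempotent_commutator H) K ->
  bdd P -> bdd P' -> (forall x, P (P x) = P x) -> (forall x, P' (P' x) = P' x) ->
  lin_indep v -> (forall i, P (v i) = v i) -> linear cf -> (forall x, cf x = 0 -> P' x = 0) ->
  (forall eps : R, 0 < eps -> exists p : {poly R[i]}, [/\ 'X %| p,
        forall x, rn (papp K p x - P x) <= eps * rn x &
        forall x, rn (papp K (p \Po (- 'X)) x - P' x) <= eps * rn x]) ->
  (m <= m')%N.
Proof.
move=> bK [_ hcl] bP bP' PP PP' vi Pv lcf hcf happ; rewrite leqNgt; apply/negP => mm'.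
have lP := bdd_lin bP; have lP' := bdd_lin bP'.
have [c1 c10 h1] := bdd_gt0 bP; have [c2 c20 h2] := bdd_gt0 bP'.
pose c := 1 + c1 + c2.
have cge1 : 1 <= c by rewrite /c; lra.
have hP x : rn (P x) <= c * rn x.
  by apply: le_trans (h1 x) _; rewrite ler_wpM2r ?rn_ge0 // /c; lra.
have hP' x : rn (P' x) <= c * rn x.
  by apply: le_trans (h2 x) _; rewrite ler_wpM2r ?rn_ge0 // /c; lra.
have c2p : 0 < c + 2 by lra.
set eta := (128 * (c + 2) ^+ 3)^-1.
have eta0 : 0 < eta by rewrite invr_gt0 mulr_gt0 // exprn_gt0.
have [|p [Xp hp hpN]] := happ (eta / 2); first by rewrite divr_gt0.
have [M1 M10 cont1] := papp_continuity p bK.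
have [M2 M20 cont2] := papp_continuity (p \Po (- 'X)) bK.
pose t := Num.min 1 (eta / 2 / (M1 + M2 + 1)).
have MM : 0 < M1 + M2 + 1 by lra.
have t0 : 0 < t by rewrite lt_min ltr01 !divr_gt0.
have t1 : t <= 1 by rewrite ge_min lexx.
have tM : t * (M1 + M2 + 1) <= eta / 2.
  by rewrite -ler_pdivlMr // ge_min lexx orbT.
have [C cC KC] := hcl t t0.
have [bC [A [B [bA bB BA AC]]]] := commutator_factor cC.
have lC := bdd_lin bC; have lA := bdd_lin bA; have lB := bdd_lin bB.
have hC x : rn (C x - K x) <= t * rn x.
  rewrite rnBC; apply: (@op_norm_lt _ _ (K \- C)) => //; exact: bdd_sub.
have near (q : {poly R[i]}) (S : H -> H) M : 0 <= M -> M <= M1 + M2 + 1 ->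
    (forall x, rn (papp C q x - papp K q x) <= M * t * rn x) ->
    (forall x, rn (papp K q x - S x) <= eta / 2 * rn x) ->
    forall x, rn (papp C q x - S x) <= eta * rn x.
  move=> M0 MM' hq1 hq2 x; apply: le_trans (rn_dist_tri _ (papp K q x) _) _.
  apply: le_trans (lerD (hq1 x) (hq2 x)) _; rewrite -mulrDl ler_wpM2r ?rn_ge0 //.
  have : M * t <= eta / 2 by apply: le_trans tM; rewrite mulrC ler_wpM2l // ltW.
  lra.
have c1p := near p P M1 M10 _ (cont1 C t lC (ltW t0) t1 hC) hp.
have c2p' := near (p \Po - 'X) P' M2 M20 _ (cont2 C t lC (ltW t0) t1 hC) hpN.
have pol := polishP ip_norm bC cge1 lP PP hP (c1p _).
have polN := polishP ip_norm bC cge1 lP' PP' hP' (c2p' _).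
have /dvdpP [g pg] := Xp.
have [cA cA0 hA] := bdd_gt0 bA; have [cB cB0 hB] := bdd_gt0 bB.
have [cg cg0 hg] := bdd_gt0 (bdd_papp g bC).
(* The bounds of [A], [B] and [g(C)] depend on [C] and may be huge; the number of polishing steps is
   chosen after them, while the closeness to [P] and [P'] is uniform in [j]. *)
have [j hj] : exists j : nat, cg * (cB * (2 * cA)) * 2 <= 2 ^+ j.
  exists (Num.truncn (cg * (cB * (2 * cA)) * 2)).+1; apply: ltW.
  apply: lt_le_trans (truncnS_gt _) _.
  by rewrite -natrX ler_nat ltnW // ltn_expl.
have M1le : M1 <= M1 + M2 + 1 by lra.
have M2le : M2 <= M1 + M2 + 1 by lra.
have [Qj1 Qj2] := pol M1le j; have [Q01 _] := pol M1le 0%N.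
have [QN1 QN2] := polN M2le j.
set pj := iter j (@polish R) p in Qj1 Qj2.
set pjN := iter j (@polish R) (p \Po - 'X) in QN1 QN2.
have AQ x : A (papp C pj x) = papp C pjN (A x).
  by rewrite (papp_anticommute lC _ _ lA AC) iter_polish_comp.
pose W := \matrix_(i < m) cf (A (papp C pj (v i))).
(* [W] has [m] rows and [m' < m] columns, so the [m'] conditions ensuring [P' u = 0] have a
   nontrivial solution. *)
have /rowV0Pn [a /sub_kermxP aW a0] : kermx W != 0.
  rewrite -mxrank_eq0 mxrank_ker subn_eq0 -ltnNge.
  exact: leq_ltn_trans (rank_leq_col W) mm'.
pose x := \sum_(i < m) a 0 i *: v i.
have x0 : x != 0.
  apply: contra a0 => /eqP x0; apply/eqP/rowP => i.
  by rewrite mxE; apply: (vi (fun i => a 0 i)).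
have Px : P x = x.
  by rewrite /x (lin_sum lP); apply: eq_bigr => i _; rewrite (linZ lP) Pv.
set u := A (papp C pj x).
have Pu : P' u = 0.
  apply: hcf; rewrite /u /x (lin_sum (papp_lin lC pj)) (lin_sum lA) (lin_sum lcf).
  rewrite -[RHS]aW mulmx_sum_row; apply: eq_bigr => i _.
  by rewrite (linZ (papp_lin lC pj)) (linZ lA) (linZ lcf) rowK.
have rx : 0 < rn x by rewrite rn_gt0.
set h := (2 ^+ j)^-1 in Qj2 QN2.
have h0 : 0 < h by rewrite invr_gt0 exprn_gt0.
have u_small : rn u <= 2 * cA * h * rn x.
  have e1 : rn (papp C pjN u - u) <= cA * (h * rn x).
    have -> : papp C pjN u - u = A (papp C (pj ^+ 2 - pj) x).
      by rewrite /u -AQ -(linB lA) pappB expr2 pappM.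
    by apply: le_trans (hA _) _; rewrite ler_wpM2l ?(ltW cA0).
  have e2 := QN1 u; rewrite Pu subr0 in e2.
  have e3 := rn_sub_le u (papp C pjN u); rewrite rnBC in e3.
  have e4 : (8 * (c + 2))^-1 * rn u <= 2^-1 * rn u.
    by rewrite ler_wpM2r ?rn_ge0 // lef_pV2 ?posrE ?mulr_gt0 //; lra.
  have -> : 2 * cA * h * rn x = 2 * (cA * (h * rn x)) by ring.
  move: e1 e2 e3 e4; set q1 := rn u; set q2 := rn (papp _ _ _); set q3 := rn (_ - _).
  set q4 := cA * _; set q5 := _^-1 * q1; lra.
have small : rn (papp C p (papp C pj x)) <= 2^-1 * rn x.
  rewrite pg pappM // pappX -BA -/u.
  apply: le_trans (hg _) _; apply: le_trans (ler_wpM2l (ltW cg0) (hB _)) _.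
  apply: le_trans (ler_wpM2l (ltW cg0) (ler_wpM2l (ltW cB0) u_small)) _.
  have -> : cg * (cB * (2 * cA * h * rn x)) = (cg * (cB * (2 * cA)) * 2) * h * (2^-1 * rn x).
    by field.
  rewrite ler_piMl ?mulr_ge0 ?rn_ge0 ?invr_ge0 //.
  by rewrite /h ler_pdivrMr ?exprn_gt0 // mul1r.
have close : rn (papp C p (papp C pj x) - x) <= 4^-1 * rn x.
  have -> : papp C p (papp C pj x) - x = papp C p (papp C pj x - P x) + (papp C p x - P x).
    by rewrite (linB (papp_lin lC p)) Px addrA subrK.
  have b1 := Qj1 x; have b2 := Q01 x.
  have b3 y : rn (papp C p y) <= (c + 1) * rn y.
    apply: rn_near (rn_ge0 y) _ (Q01 y) (hP y).
    rewrite invf_le1; lra.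
  apply: le_trans (rnD _ _) _; apply: le_trans (lerD (b3 _) b2) _.
  have c10' : 0 <= c + 1 by lra.
  apply: le_trans (lerD (ler_wpM2l c10' b1) (lexx _)) _.
  rewrite mulrA -mulrDl ler_wpM2r ?rn_ge0 //.
  have -> : (c + 1) * (8 * (c + 2))^-1 + (8 * (c + 2))^-1 = 8^-1 by field; rewrite gt_eqF.
  by rewrite lef_pV2 ?posrE // ler_nat.
have := rn_sub_le x (papp C p (papp C pj x)); rewrite rnBC.
move: small close rx; set q1 := rn x; set q2 := rn (_ - _); set q3 := rn _ => s1 s2 s3 s4.
have : q1 <= 2^-1 * q1 + 4^-1 * q1.
  by move: s4; rewrite lerBlDr => /le_trans; apply; rewrite addrC lerD.
by rewrite leNgt => /negP; apply; lra.
Qed.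

Lemma eigenspaces_of_closure (K : H -> H) l : compact_op H K ->
  norm_closure (idempotent_commutator H) K -> l != 0 ->
  subspace_dim (gen_eigenspace K l) = subspace_dim (gen_eigenspace K (- l)).
Proof.
move=> cK hK l0.
have le (a : R[i]) : a != 0 -> (subspace_dim (gen_eigenspace K a) <= subspace_dim (gen_eigenspace K (- a)))%E.
  move=> a0; have ra : 0 < rn a by rewrite rn_gt0.
  have [n [e [fe noev]]] := schur_family_exists ip_norm cK ra.
  have [L [bL QLQ KL]] := complement_exists ip_norm cK ra fe noev.
  have [P [P' [m [m' [v [cf [[bP bP' PP PP'] [d1 d2 vi Pv lcf] hcf happ]]]]]]] :=
    approx_projections ip_norm cK ra fe noev bL QLQ KL a0 (lexx _).
  rewrite d1 d2 lee_fin ler_nat.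
  exact: (rank_le_of_closure (compact_bdd cK) hK bP bP' PP PP' vi Pv lcf hcf happ).
apply/eqP; rewrite eq_le le //=.
by have := le (- l); rewrite opprK oppr_eq0; apply.
Qed.

End ClosureOfCommutators.

(** * Compact operators with symmetric eigenvalues *)

Section SymmetricPerturbation.
Context (R : realType).
Implicit Types (s t u : seq R[i]) (a : R[i]).

Lemma exists_near_notin s a (d : R) : 0 < d -> exists2 z, rn (z - a) <= d & z \notin s.
Proof.
move=> d0; pose v (k : nat) : R[i] := a + (d / k.+1%:R)%:C.
have vi : injective v.
  move=> k l /addrI /(@complexI R) /(mulfI (lt0r_neq0 d0)) /invr_inj /eqP.
  by rewrite eqr_nat => /eqP [].
have [h|] := boolP (all (fun k => v k \in s) (iota 0 (size s).+1)).
  have /(uniq_leq_size _) : {subset map v (iota 0 (size s).+1) <= s}.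
    by move=> y /mapP; case=> k /(allP h) vk ->.
  by rewrite map_inj_uniq ?iota_uniq // size_map size_iota ltnn => /(_ isT).
rewrite -has_predC => /hasP[k _ /= vs]; exists (v k) => //.
rewrite /v addrC addKr rn_real ger0_norm ?divr_ge0 ?(ltW d0) //.
by rewrite ler_pdivrMr ?ltr0n // ler_peMr ?(ltW d0) // ler1n.
Qed.

Lemma opp_uniq_perturbation t (d : R) : 0 < d -> exists u,
  [/\ size u = size t, forall i, rn (u`_i - t`_i) <= d,
      uniq (u ++ map -%R u) & 0 \notin u].
Proof.
move=> d0; elim: t => [|a t [u [ut ud uu u0]]].
  by exists [::]; split=> // i; rewrite subrr rn0 ltW.
have [w wa] := exists_near_notin (0 :: u ++ map -%R u) a d0.
rewrite inE negb_or => /andP[w0 wu]; exists (w :: u); split=> [||/=|].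
- by rewrite /= ut.
- by case=> [|i] //=; exact: ud.
- have wN : - w \notin u ++ map -%R u.
    have e1 : (- w \in u) = (w \in map -%R u) by rewrite -(mem_map oppr_inj) opprK.
    by rewrite mem_cat e1 (mem_map oppr_inj) orbC -mem_cat.
  rewrite mem_cat inE orbCA -mem_cat negb_or wu andbT -subr_eq0 opprK -mulr2n mulrn_eq0 /= w0.
  by rewrite -cat1s uniq_catCA /= wN uu.
- by rewrite inE eq_sym negb_or w0.
Qed.

Lemma perm_opp_cat s : (forall l, count_mem l s = count_mem (- l) s) -> 0 \notin s ->
  exists t, perm_eq s (t ++ map -%R t).
Proof.
(* A lexicographic sign, selecting exactly one of [a] and [- a] when [a != 0]. *)
move=> sym s0; pose pos a := (0 < complex.Re a) || (complex.Re a == 0) && (0 < complex.Im a).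
exists (seq.filter pos s); apply/allP => a _ /=; apply/eqP.
rewrite count_cat count_map [X in (_ + X)%N](_ : _ = count_mem (- a) (seq.filter pos s)); last first.
  by apply: eq_count => b /=; rewrite eqr_oppLR.
have cf b : count_mem b (seq.filter pos s) = (pos b * count_mem b s)%N.
  rewrite count_filter; case: (boolP (pos b)) => pb; last first.
    rewrite mul0n; apply/eqP; rewrite -leqn0 leqNgt -has_count; apply/hasPn => c _ /=.
    by apply/negP => /andP[/eqP ->]; rewrite (negPf pb).
  rewrite mul1n; apply: eq_count => c /=.
  by case: eqVneq => // ->; rewrite pb.
rewrite !cf -sym -mulnDl; have [a0|a0] := eqVneq a 0.
  by rewrite a0 (count_memPn s0) muln0.
suff -> : (pos a + pos (- a) = 1)%N by rewrite mul1n.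
have : (complex.Re a != 0) || (complex.Im a != 0).
  rewrite -negb_and; apply: contra a0 => /andP[/eqP h1 /eqP h2].
  by case: a h1 h2 {sym cf} => x y /= -> ->.
rewrite /pos; case: a {a0 cf} => x y /=; rewrite !oppr_gt0 oppr_eq0.
by case: (ltgtP 0 x) => //=; case: (ltgtP 0 y).
Qed.

(** The list is a permutation of [t'] followed by its negatives, so only [t'] is perturbed. The
    index permutation from [perm_iotaP] carries the result back to the original positions, which are
    fixed by the triangular matrix. *)
Lemma symmetric_perturbation s q (d : R) : 0 < d ->
  (forall l, count_mem l s = count_mem (- l) s) -> 0 \notin s ->
  exists u, [/\ size u = (size s + q.*2)%N,
    forall i, rn (u`_i - (s ++ nseq q.*2 0)`_i) <= d,
    uniq u, 0 \notin u & forall a, a \in u -> - a \in u].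
Proof.
move=> d0 sym s0; have [t pt] := perm_opp_cat sym s0.
have [t' et'] : exists t', t' = t ++ nseq q (0 : R[i]) by eexists.
have [v [vt vd vu v0]] := opp_uniq_perturbation t' d0.
have p : perm_eq (s ++ nseq q.*2 0) (t' ++ map -%R t').
  apply/permP => P; rewrite et' !count_cat map_cat !count_cat (permP pt) !count_cat.
  rewrite map_nseq oppr0 -addnn !count_nseq; lia.
have szt : size (t' ++ map -%R t') = size (v ++ map -%R v).
  by rewrite [LHS]size_cat [RHS]size_cat !size_map vt.
have [I pI eI] := perm_iotaP 0 p.
have sz : size I = (size s + q.*2)%N.
  by rewrite -(size_map (nth 0 (t' ++ map -%R t'))) -eI size_cat size_nseq.
have pu : perm_eq (map (nth 0 (v ++ map -%R v)) I) (v ++ map -%R v).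
  by rewrite -[X in perm_eq _ X](mkseq_nth 0) /mkseq -szt; apply: perm_map.
exists (map (nth 0 (v ++ map -%R v)) I); split.
- by rewrite size_map.
- move=> i; rewrite eI; have [iI|Ii] := ltnP i (size I); last first.
    by rewrite !nth_default ?size_map // subrr rn0 ltW.
  rewrite !(nth_map 0%N) // !nth_cat vt.
  move: (nth 0%N I i) => k.
  case: ifP => // h; have [h1|h1] := ltnP (k - size t') (size t').
    by rewrite !(nth_map 0) ?vt // -opprD rnN.
    by rewrite !nth_default ?size_map ?vt // subrr rn0 ltW.
- by rewrite (perm_uniq pu).
- by rewrite (perm_mem pu) mem_cat negb_or v0 -oppr0 (mem_map oppr_inj).
- move=> a; rewrite !(perm_mem pu) !mem_cat (mem_map oppr_inj).
  by rewrite -[- a \in v](mem_map oppr_inj) opprK orbC.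
Qed.

End SymmetricPerturbation.

Section MatrixCommutator.
Context (C : numClosedFieldType) (m : nat).
Implicit Types (A : 'M[C]_m).

Lemma quartic_root (c : C) : c != 0 ->
  let t := sqrtC (sqrtC (4^-1 + c ^+ 2) + 2^-1) in t != 0 /\ t ^+ 4 - t ^+ 2 = c ^+ 2.
Proof.
move=> c0 t; have hw : t ^+ 4 - t ^+ 2 = c ^+ 2.
  rewrite (exprM t 2 2) !sqrtCK.
  rewrite sqrrD sqrtCK; set q := sqrtC _.
  by field.
split=> //; apply: contra_neq c0 => t0; apply/eqP.
by rewrite -sqrf_eq0 -hw t0 !expr0n subrr.
Qed.

(** [E] and [F] solve [E - F = A] and [1 - E - F = B], reversing the factorization in
    [commutator_factor]. *)
Lemma anticommuting_commutator A B : A *m A + B *m B = 1%:M -> A *m B = - (B *m A) ->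
  exists E F : 'M[C]_m, [/\ E *m E = E, F *m F = F & B *m A = E *m F - F *m E].
Proof.
move=> A2B2 AB.
have mul2 (X Y : 'M[C]_m) a b a' b' : (a *: X + b *: Y) *m (a' *: X + b' *: Y) =
    (a * a') *: (X *m X) + (b * b') *: (Y *m Y) + (a * b') *: (X *m Y) + (b * a') *: (Y *m X).
  rewrite mulmxDl !mulmxDr -!scalemxAl -!scalemxAr !scalerA.
  move: (X *m X) (Y *m Y) (X *m Y) (Y *m X) => X1 X2 X3 X4.
  by apply/matrixP => i j; rewrite !mxE; ring.
pose U : 'M[C]_m := 1%:M - B.
have UU : U *m U + A *m A = 2 *: U.
  rewrite /U mulmxBl mul1mx mulmxBr mulmx1.
  rewrite -[A *m A](addrK (B *m B)) A2B2 scalerBr !scaler_nat !mulr2n.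
  by apply/matrixP => i j; rewrite !mxE; ring.
have UA : U *m A + A *m U = 2 *: A.
  rewrite /U mulmxBl mulmxBr mul1mx mulmx1 AB scaler_nat mulr2n.
  by apply/matrixP => i j; rewrite !mxE; ring.
exists (2^-1 *: U + 2^-1 *: A), (2^-1 *: U + (- 2^-1) *: A); split.
- rewrite mul2 -!scalerDr -addrA UU UA -!scalerDr scalerA.
  by congr (_ *: _); field.
- rewrite mul2 mulrNN mulrN mulNr -scalerDr -addrA -scalerDr UU UA !scalerA.
  by congr (_ *: _ + _ *: _); field.
- rewrite !mul2.
  have -> : B *m A = 2^-1 *: (A *m U - U *m A).
    rewrite /U mulmxBl mulmxBr mul1mx mulmx1 AB.
    by move: (B *m A) => X; apply/matrixP => i j; rewrite !mxE; field.
  move: (U *m U) (A *m A) (U *m A) (A *m U) => X1 X2 X3 X4.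
  by apply/matrixP => i j; rewrite !mxE; field.
Qed.

(* With A_(i, s i) = t_i and B_(i, s i) = c_i / t_i, where s is the involution     *)
(* c_(s i) = - c_i and t_i ^ 4 - t_i ^ 2 = c_i ^ 2, one has A^2 + B^2 = 1 and       *)
(* AB + BA = 0, so that (1 + A - B) / 2 and (1 - A - B) / 2 are idempotents with    *)
(* commutator BA = diag c.                                                        *)
Lemma diag_commutator (c : 'I_m -> C) : injective c -> (forall i, c i != 0) ->
  (forall i, exists j, c j = - c i) ->
  exists E F : 'M[C]_m, [/\ E *m E = E, F *m F = F &
    diag_mx (\row_i c i) = E *m F - F *m E].
Proof.
move=> ci c0 /choice [s hs].
have ss i : s (s i) = i by apply: ci; rewrite !hs opprK.
pose t i := sqrtC (sqrtC (4^-1 + c i ^+ 2) + 2^-1).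
have ht i : t i != 0 /\ t i ^+ 4 - t i ^+ 2 = c i ^+ 2 := quartic_root (c0 i).
have ts i : t (s i) = t i by rewrite /t hs sqrrN.
pose W (u : 'I_m -> C) := \matrix_(i, j) (u i *+ (j == s i)).
have WW u v : W u *m W v = diag_mx (\row_i (u i * v (s i))).
  apply/matrixP => i j; rewrite !mxE (bigD1 (s i)) //= !mxE eqxx mulr1n ss big1 ?addr0.
    by rewrite mulrnAr eq_sym.
  by move=> k ks; rewrite !mxE (negPf ks) mul0r.
pose A := W t; pose B := W (fun i => c i / t i).
have BA : B *m A = diag_mx (\row_i c i).
  by rewrite WW; congr diag_mx; apply/rowP => i; rewrite !mxE ts divfK //; case: (ht i).
have AB : A *m B = - (B *m A).
  rewrite BA WW; apply/matrixP => i j; rewrite !mxE -mulNrn ts hs; congr (_ *+ _).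
  by rewrite mulrC divfK //; case: (ht i).
have A2B2 : A *m A + B *m B = 1%:M.
  rewrite !WW; apply/matrixP => i j; rewrite !mxE -mulrnDl ts hs; congr (_ *+ _).
  have [t0 ht4] := ht i; apply: (mulfI (expf_neq0 2 t0)).
  have -> : t i ^+ 2 * (t i * t i + c i / t i * (- c i / t i)) = t i ^+ 4 - c i ^+ 2 by field.
  by rewrite -ht4 subKr mulr1.
by have [E [F [EE FF EF]]] := anticommuting_commutator A2B2 AB; exists E, F; rewrite -BA.
Qed.

Lemma trig_eigenvector A i : is_trig_mx A ->
  exists v : 'rV[C]_m, v *m A = A i i *: v /\ v != 0.
Proof.
move=> /is_trig_mxP tA.
have : \det (A - (A i i)%:M) = 0.
  rewrite det_trig; last first.
    apply/is_trig_mxP => j k jk; rewrite !mxE tA // sub0r.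
    by rewrite -val_eqE /= (ltn_eqF jk) oppr0.
  by rewrite (bigD1 i) //= !mxE eqxx subrr mul0r.
move=> /eqP /det0P [v v0 h]; exists v; split=> //.
by apply/eqP; rewrite -subr_eq0 -mul_mx_scalar -mulmxBr h.
Qed.

(** The rows of [S] are eigenvectors for pairwise distinct eigenvalues, whose eigenspaces form a
    direct sum. *)
Lemma trig_diagonalizable A : is_trig_mx A -> injective (fun i => A i i) ->
  exists2 S : 'M[C]_m, S \in unitmx & S *m A = diag_mx (\row_i A i i) *m S.
Proof.
move=> tA Ai.
have ev i := trig_eigenvector i tA.
have [v hv] := choice ev.
exists (\matrix_i v i); last first.
  apply/row_matrixP => i; rewrite !row_mul rowK (proj1 (hv i)) row_diag_mx mxE.
  by rewrite -scalemxAl -rowE rowK.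
rewrite -row_free_unit -kermx_eq0; apply/rowV0P => u /sub_kermxP hu.
have dx : mxdirect (\sum_(i < m | predT i) eigenspace A (A i i)).
  by apply: mxdirect_sum_eigenspace => i j _ _; exact: Ai.
have vE i : (v i <= eigenspace A (A i i))%MS by apply/eigenspaceP; case: (hv i).
apply/rowP => i; rewrite mxE; apply/eqP.
have : (u 0 i *: v i <= (eigenspace A (A i i) :&: \sum_(j < m | predT j && (j != i)) eigenspace A (A j j)))%MS.
  rewrite sub_capmx scalemx_sub //=.
  move: hu; rewrite mulmx_sum_row (bigD1 i) //= rowK => /eqP; rewrite addr_eq0 => /eqP ->.
  rewrite eqmx_opp; apply: summx_sub => j ji; rewrite rowK scalemx_sub //.
  by apply: (sumsmx_sup j).
move/mxdirect_sumsP: dx => ->//; rewrite submx0 scaler_eq0.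
by case: (hv i) => _ /negPf ->; rewrite orbF.
Qed.

Lemma trig_commutator A : is_trig_mx A -> injective (fun i => A i i) ->
  (forall i, A i i != 0) -> (forall i, exists j, A j j = - A i i) ->
  A \in unitmx /\ exists E F : 'M[C]_m, [/\ E *m E = E, F *m F = F & A = E *m F - F *m E].
Proof.
move=> tA Ai A0 As; have [S uS SA] := trig_diagonalizable tA Ai.
split; first by rewrite unitmxE unitfE det_trig // prodf_seq_neq0; apply/allP => i _; exact: A0.
have [E [F [EE FF EF]]] := diag_commutator Ai A0 As.
pose J M := invmx S *m M *m S.
have JM M N : J M *m J N = J (M *m N).
  by rewrite /J !mulmxA mulmxK.
exists (J E), (J F); split; rewrite ?JM ?EE ?FF //.
have -> : J (E *m F) - J (F *m E) = J (E *m F - F *m E) by rewrite /J mulmxBr mulmxBl.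
by rewrite -EF /J -mulmxA -SA mulKmx.
Qed.

End MatrixCommutator.

Section Rotation.
Local Open Scope sesquilinear_scope.
Context (R : realType) (H : completeNormedModType R[i]).
Context (ip : {dot H for (@Num.conj R[i])}).
Context (ip_norm : forall x : H, ip x x = `|x| ^+ 2).

Lemma orthonormal_extend n e k : infinite_dimensional H -> orthonormal_family ip n e ->
  exists f, orthonormal_family ip (n + k) f /\ forall i, (i < n)%N -> f i = e i.
Proof.
move=> Hinf he; elim: k => [|k [f [hf fe]]]; first by exists e; rewrite addn0.
have [x [x1 xo]] := infinite_orthogonal Hinf hf.
exists (fun i => if i == (n + k)%N then x else f i); split.
  by rewrite addnS; exact: orthonormal_rcons.
by move=> i hi; rewrite ltn_eqF ?fe // ltn_addr.
Qed.

Lemma comb_row_mx n p (e f : nat -> H) (a : 'rV_n) (b : 'rV_p) : (forall i, (i < n)%N -> f i = e i) ->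
  comb f (row_mx a b) = comb e a + comb f (row_mx (0 : 'rV_n) b).
Proof.
move=> fe; rewrite -[a in LHS]addr0 -[b in LHS]add0r -add_row_mx (linD (@comb_lin _ _ _ f)).
congr (_ + _); rewrite /comb big_split_ord /= [X in _ + X]big1 ?addr0.
  by apply: eq_bigr => i _; rewrite row_mxEl fe.
by move=> i _; rewrite row_mxEr mxE scale0r.
Qed.

Context (m : nat) (f : nat -> H) (hf : orthonormal_family ip m f).

Lemma ip_comb_comb (u v : 'rV_m) : ip (comb f u) (comb f v) = (u *m v ^t*) 0 0.
Proof.
rewrite ip_sumr mxE; apply: eq_bigr => j _.
have /rowP/(_ j) := coords_comb u hf; rewrite ipZr !mxE => ->.
by rewrite mulrC.
Qed.

Definition rotate (U : 'M[R[i]]_m) (i : nat) : H :=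
  if insub i is Some j then comb f (row j U) else 0.

Lemma rotateE U (j : 'I_m) : rotate U j = comb f (row j U).
Proof. by rewrite /rotate valK. Qed.

Lemma comb_rotate U (u : 'rV_m) : comb (rotate U) u = comb f (u *m U).
Proof.
rewrite mulmx_sum_row (lin_sum (@comb_lin _ _ _ f)); apply: eq_bigr => i _.
by rewrite rotateE (linZ (@comb_lin _ _ _ f)).
Qed.

Context (U : 'M[R[i]]_m) (uU : U *m U ^t* = 1%:M).

Lemma orthonormal_rotate : orthonormal_family ip m (rotate U).
Proof.
move=> i j hi hj; rewrite (rotateE U (Ordinal hi)) (rotateE U (Ordinal hj)) ip_comb_comb.
have /matrixP/(_ (Ordinal hi) (Ordinal hj)) := uU; rewrite !mxE => <-.
by apply: eq_bigr => l _; rewrite !mxE.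
Qed.

Lemma coords_rotate x : coords ip m (rotate U) x = coords ip m f x *m U ^t*.
Proof.
apply/rowP => j; rewrite !mxE rotateE ip_sumr; apply: eq_bigr => i _.
by rewrite ipZr !mxE mulrC.
Qed.

Lemma oproj_rotate x : oproj ip m (rotate U) x = oproj ip m f x.
Proof. by rewrite /oproj comb_rotate coords_rotate -mulmxA (mulmx1C uU) mulmx1. Qed.

End Rotation.

(** * Triangular finite sections of a compact operator *)

Section TriangularSection.
Local Open Scope sesquilinear_scope.
Context (R : realType) (H : completeNormedModType R[i]).
Context (ip : {dot H for (@Num.conj R[i])}).
Context (ip_norm : forall x : H, ip x x = `|x| ^+ 2).
Context (Hinf : infinite_dimensional H).
Context (K : H -> H) (cK : compact_op H K).
Let bK := compact_bdd cK.
Let lK := bdd_lin bK.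

Definition section_mx m (f : nat -> H) : 'M[R[i]]_m := \matrix_(i, j) ip (K (f i)) (f j).

Lemma coords_section m f (u : 'rV_m) : coords ip m f (K (comb f u)) = u *m section_mx m f.
Proof.
apply/rowP => j; rewrite !mxE (lin_sum lK) ip_suml; apply: eq_bigr => i _.
by rewrite (linZ lK) ipZl mxE.
Qed.

Lemma section_rotate m f (U : 'M[R[i]]_m) : section_mx m (rotate f U) = U *m section_mx m f *m U ^t*.
Proof.
apply/row_matrixP => i; rewrite !row_mul -coords_section -coords_rotate -rotateE.
by apply/rowP => j; rewrite !mxE.
Qed.

Lemma finite_section n (e : nat -> H) (eta : R) : orthonormal_family ip n e -> 0 < eta ->
  exists p f, [/\ (0 < p)%N, ~~ odd p, orthonormal_family ip (n + p) f,
    forall i, (i < n)%N -> f i = e i &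
    forall x, rn (K x - oproj ip (n + p) f (K x)) <= eta * rn x].
Proof.
move=> he eta0; have [m [f [nm hf fe hK]]] := compact_approx ip_norm cK he eta0.
(* Adding one or two vectors makes [p] even, so that the remaining entries can be paired, and
   positive, as the Schur decomposition requires. *)
pose k := (2 - odd (m - n))%N.
have [g [hg gf]] := orthonormal_extend ip_norm k Hinf hf.
have mE : (n + (m - n + k))%N = (m + k)%N by rewrite addnA subnKC.
exists (m - n + k)%N, g; rewrite mE; split=> //.
- by rewrite addn_gt0 orbC /k; case: (odd _).
- by rewrite oddD /k; case: (odd (m - n)).
- by move=> i hi; rewrite gf ?fe // (leq_trans hi).
- move=> x; apply: le_trans (hK x).
  have [v e1] := comb_widen (coords ip m f (K x)) gf (leq_addr k m).
  rewrite [oproj ip m f _]e1.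
  exact: (oproj_best ip_norm).
Qed.

Context (d : R) (d0 : 0 < d) (n : nat) (e : nat -> H) (fe : schur_family ip K d n e).
Context (noev : forall z x, d <= rn z -> ocompl ip n e (K x) = z *: x -> x = 0).

(** An eigenvector of the lower right block gives a vector [x] orthogonal to [e] that the tail
    operator maps to within [eta * rn x] of [z *: x]; for [rn z >= d] this contradicts the lower
    bound, as [eta < c * d]. *)
Lemma tail_eigenvalue_small (c eta : R) p f z (u : 'rV[R[i]]_p) :
  (forall z, d <= rn z -> forall x, c * rn z * rn x <= rn (z *: x - tail_op ip K n e x)) ->
  0 < c -> eta < c * d ->
  orthonormal_family ip (n + p) f -> (forall i, (i < n)%N -> f i = e i) ->
  (forall x, rn (K x - oproj ip (n + p) f (K x)) <= eta * rn x) ->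
  u != 0 -> u *m drsubmx (section_mx (n + p) f) = z *: u -> rn z < d.
Proof.
move=> low c0 etac hf fE hK u0 uz; rewrite ltNge; apply/negP => dz.
have [he _ _] := fe; have lQ := bdd_lin (bdd_ocompl ip_norm n e).
pose x := comb f (row_mx (0 : 'rV_n) u).
have x0 : 0 < rn x.
  rewrite rn_gt0; apply: contra u0 => /eqP x0.
  have := coords_comb (row_mx (0 : 'rV_n) u) hf; rewrite -/x x0 (lin0 (coords_lin ip _ f)).
  by rewrite -row_mx0 => /eq_row_mx [_ <-].
have Qtail (b : 'rV_p) : ocompl ip n e (comb f (row_mx (0 : 'rV_n) b)) = comb f (row_mx (0 : 'rV_n) b).
  rewrite /ocompl oprojE big1 ?subr0 // => i _; rewrite -fE //.
  have /rowP/(_ (lshift p i)) := coords_comb (row_mx (0 : 'rV_n) b) hf.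
  by rewrite !mxE => ->; rewrite (unsplitK (inl i)) mxE scale0r.
have QP : ocompl ip n e (oproj ip (n + p) f (K x)) = z *: x.
  rewrite /oproj coords_section -[section_mx _ _]submxK mul_row_block !mul0mx !add0r uz.
  rewrite (comb_row_mx _ _ fE) (linD lQ) (ocompl_comb fe) add0r Qtail.
  rewrite -(linZ (@comb_lin _ _ _ f)); congr comb.
  by rewrite scale_row_mx scaler0.
have : rn (z *: x - tail_op ip K n e x) <= eta * rn x.
  rewrite rnBC -QP /tail_op -(linB lQ).
  exact: le_trans (rn_sub_oproj ip_norm _ he) (hK x).
apply/negP; rewrite -ltNge; apply: lt_le_trans (low z dz x).
rewrite ltr_pM2r //; apply: lt_le_trans etac _.
by rewrite ler_pM2l.
Qed.

(** The vectors of [e] are kept, since they already triangularize their invariant span, and only the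
    complementary block is rotated by a unitary Schur matrix. Rotation leaves the projection onto
    the span unchanged. *)
Lemma triangular_section (eta : R) : 0 < eta -> exists p f,
  [/\ ~~ odd p, orthonormal_family ip (n + p) f,
    forall x, rn (K x - oproj ip (n + p) f (K x)) <= eta * rn x,
    is_trig_mx (section_mx (n + p) f) &
    (forall i : 'I_n, section_mx (n + p) f (lshift p i) (lshift p i) = diag_entry ip K e i) /\
    forall i : 'I_p, rn (section_mx (n + p) f (rshift n i) (rshift n i)) < d].
Proof.
move=> eta0; have [c c0 low] := tail_lower_bound ip_norm cK d0 noev.
have [he hKe _] := fe.
pose eta' := Num.min eta (c * d / 2).
have cd : 0 < c * d by rewrite mulr_gt0.
have e0 : 0 < eta' by rewrite lt_min eta0 divr_gt0.
have e1 : eta' < c * d.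
  by rewrite gt_min; apply/orP; right; rewrite ltr_pdivrMr // ltr_pMr // ltr1n.
have [p [g [p0 po hg ge hK]]] := finite_section he e0.
have [P uP tP] := Schur (drsubmx (section_mx (n + p) g)) p0.
pose U : 'M[R[i]]_(n + p) := block_mx 1%:M 0 0 P.
have UtE : U ^t* = block_mx 1%:M 0 0 (P ^t*).
  by rewrite tr_block_mx map_block_mx !trmx0 !map_mx0 trmx1 map_mx1.
have uU : U *m U ^t* = 1%:M.
  rewrite UtE mulmx_block !(mulmx0, mul0mx, addr0, add0r, mul1mx).
  by rewrite (unitarymxP uP) -scalar_mx_block.
pose f := rotate g U.
have hf : orthonormal_family ip (n + p) f by exact: orthonormal_rotate.
have fE i : (i < n)%N -> f i = e i.
  move=> hi; rewrite -ge // -(comb_delta g (lshift p (Ordinal hi))).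
  rewrite /f (rotateE g U (lshift p (Ordinal hi))); congr comb.
  apply/rowP => j; rewrite [LHS]mxE; case: (split_ordP j) => k ->.
    by rewrite /U block_mxEul !mxE eq_shift /= eq_sym.
  by rewrite /U block_mxEur !mxE eq_shift.
have KfP x : rn (K x - oproj ip (n + p) f (K x)) <= eta' * rn x by rewrite oproj_rotate.
have drE : drsubmx (section_mx (n + p) f) = P *m drsubmx (section_mx (n + p) g) *m P ^t*.
  rewrite section_rotate UtE -{1}[section_mx _ g]submxK /U !mulmx_block block_mxKdr.
  by rewrite !(mulmx0, mul0mx, addr0, add0r, mul1mx, mulmx1).
have tdr : is_trig_mx (drsubmx (section_mx (n + p) f)).
  by rewrite drE -conjymx //; case/and3P: tP.
exists p, f; split=> //.
- by move=> x; apply: le_trans (KfP x) _; rewrite ler_wpM2r ?rn_ge0 // ge_min lexx.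
- rewrite -[section_mx _ _]submxK is_trig_block_mx // tdr andbT; apply/andP.
  have low0 (i : 'I_n) (j : 'I_(n + p)) : (i < j)%N -> ip (K (f i)) (f j) = 0.
    move=> ij; rewrite fE // hKe // ip_suml big1 // => k _.
    have kn : (k < n)%N by apply: leq_trans (ltn_ord k) _.
    rewrite ipZl -(fE k) // (hf k j (ltn_addr p kn) (ltn_ord j)).
    by rewrite ltn_eqF ?mulr0 // (leq_trans (ltn_ord k)).
  split; last by apply/is_trig_mxP => i j ij; rewrite !mxE low0.
  apply/eqP/matrixP => i j; rewrite !mxE low0 //=.
  by rewrite (leq_trans (ltn_ord i)) ?leq_addr.
- split=> i; first by rewrite mxE /= fE.
  have [v [hv v0]] := trig_eigenvector i tdr.
  have := tail_eigenvalue_small low c0 e1 hf fE KfP v0 hv.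
  by rewrite !mxE.
Qed.

End TriangularSection.

(** * Approximation by commutators when the eigenvalues are symmetric *)

Section ClosureOfSymmetric.
Context (R : realType) (H : completeNormedModType R[i]).
Context (ip : {dot H for (@Num.conj R[i])}).
Context (ip_norm : forall x : H, ip x x = `|x| ^+ 2).
Context (Hinf : infinite_dimensional H).
Context (K : H -> H) (cK : compact_op H K).
Let bK := compact_bdd cK.
Let lK := bdd_lin bK.

Lemma bdd_comb_coords_mulmx m f (N : 'M[R[i]]_m) : bdd (fun x => comb f (coords ip m f x *m N)).
Proof.
have -> : (fun x => comb f (coords ip m f x *m N)) =
    fun x => \sum_(i < m) ip x (f i) *: comb f (row i N).
  apply/funext => x; rewrite mulmx_sum_row (lin_sum (@comb_lin _ _ _ f)).
  by apply: eq_bigr => i _; rewrite (linZ (@comb_lin _ _ _ f)) mxE.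
by apply: bdd_sum => i; apply: bdd_rank1; exact: bdd_ip.
Qed.

(** The operator [P K], not [P K P], corrected so that its matrix on the span of [f] is [A]; in this
    form it is close to [K] on the whole space. *)
Definition perturbed_section m f (A : 'M[R[i]]_m) (x : H) : H :=
  comb f (coords ip m f (K x) + coords ip m f x *m (A - section_mx ip K m f)).

(* The map x |-> (coordinates of perturbed_section A x) A^-1 is a left inverse of  *)
(* comb f, so M |-> comb f (phi x M) turns matrix products into compositions.     *)
Lemma perturbed_section_commutator m f (A E F : 'M[R[i]]_m) : orthonormal_family ip m f ->
  A \in unitmx -> E *m E = E -> F *m F = F -> A = E *m F - F *m E ->
  idempotent_commutator H (perturbed_section f A).
Proof.
move=> hf uA EE FF AE.
pose phi x := (coords ip m f (K x) + coords ip m f x *m (A - section_mx ip K m f)) *m invmx A.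
pose Phi (M : 'M[R[i]]_m) x := comb f (phi x *m M).
have phiK u : phi (comb f u) = u.
  by rewrite /phi (coords_section ip cK) (coords_comb u hf) mulmxBr addrC subrK mulmxK.
have bPhi M : bdd (Phi M).
  have -> : Phi M = (fun x => comb f (coords ip m f (K x) *m (invmx A *m M))) \+
      (fun x => comb f (coords ip m f x *m ((A - section_mx ip K m f) *m invmx A *m M))).
    apply/funext => x; rewrite /Phi /phi /= -(linD (@comb_lin _ _ _ f)); congr comb.
    by rewrite -[LHS]mulmxA mulmxDl -!mulmxA.
  apply: bdd_add; last exact: bdd_comb_coords_mulmx.
  exact: (bdd_comp (bdd_comb_coords_mulmx f (invmx A *m M)) bK).
have PhiM M N x : Phi M (Phi N x) = Phi (N *m M) x by rewrite /Phi phiK mulmxA.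
(* Matrices act on row vectors, so composition reverses products and the two idempotents change
   places. *)
exists (Phi F), (Phi E); split.
- by split; [exact/bddP | apply/funext => x /=; rewrite PhiM FF].
- by split; [exact/bddP | apply/funext => x /=; rewrite PhiM EE].
- apply/funext => x; transitivity (Phi F (Phi E x) - Phi E (Phi F x)); last by [].
  rewrite !PhiM /Phi -(linB (@comb_lin _ _ _ f)) -mulmxBr -AE /perturbed_section.
  by rewrite /phi mulmxKV.
Qed.

Lemma rn_comb_diag m f (c : 'rV[R[i]]_m) (b : R) x : orthonormal_family ip m f -> 0 <= b ->
  (forall i, rn (c 0 i) <= b) -> rn (comb f (coords ip m f x *m diag_mx c)) <= b * rn x.
Proof.
move=> hf b0 hc; apply: (@le_trans _ _ (b * rn (oproj ip m f x))); last first.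
  by rewrite ler_wpM2l // (rn_oproj ip_norm).
rewrite -(ler_pXn2r (_ : (0 < 2)%N)) ?nnegrE ?mulr_ge0 ?rn_ge0 //.
rewrite exprMn !(rn_comb_sq ip_norm _ hf) mulr_sumr; apply: ler_sum => i _.
rewrite mul_mx_diag mxE rnM exprMn mulrC ler_wpM2r ?exprn_ge0 ?rn_ge0 //.
by rewrite lerXn2r ?nnegrE ?rn_ge0.
Qed.

(** Condition (S) makes the large diagonal entries of a triangular section symmetric; the others are
    replaced by small values in opposite pairs, and [trig_commutator] applies to the new matrix. *)
Lemma closure_of_eigenspaces :
  (forall l, l != 0 -> subspace_dim (gen_eigenspace K l) = subspace_dim (gen_eigenspace K (- l))) ->
  norm_closure (idempotent_commutator H) K.
Proof.
move=> hl; split; first exact/bddP.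
(* The error is at most [3 * d]: [d] for replacing [K] by [P K], and [2 * d] for the diagonal, where
   an entry of modulus below [d] is replaced by one of modulus at most [d]. *)
move=> eps eps0; pose d := eps / 4; have d0 : 0 < d by rewrite divr_gt0.
have [n [e [fe noev]]] := schur_family_exists ip_norm cK d0.
have [p [f [po hf hK tA [Al Ar]]]] := triangular_section ip_norm Hinf cK d0 fe noev d0.
set A := section_mx ip K (n + p) f in tA Al Ar.
have sds := count_diag_seq_opp ip_norm cK d0 fe noev hl.
have ds0 : 0 \notin diag_seq ip K n e.
  by apply/negP => /(mem_diag_seq fe); rewrite rn0 leNgt d0.
have [u [su ud uu u0 uN]] := symmetric_perturbation p./2 d0 sds ds0.
have p2 : p./2.*2 = p by rewrite -[RHS]odd_double_half (negPf po).
rewrite p2 size_mkseq in su; rewrite p2 in ud.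
pose c := \row_(i < n + p) (u`_i - A i i).
pose A' := A + diag_mx c.
have A'ii i : A' i i = u`_i by rewrite !mxE eqxx mulr1n addrC subrK.
have tA' : is_trig_mx A'.
  apply/is_trig_mxP => i j ij; have /is_trig_mxP tA0 := tA.
  by rewrite [LHS]mxE tA0 // add0r mxE -val_eqE ltn_eqF.
have A'i : injective (fun i => A' i i).
  by move=> i j; rewrite !A'ii => /eqP; rewrite nth_uniq ?su // => /eqP /val_inj.
have A'0 i : A' i i != 0.
  by rewrite A'ii; apply: contraNneq u0 => <-; rewrite mem_nth // su.
have A'N i : exists j, A' j j = - A' i i.
  have : - u`_i \in u by apply: uN; rewrite mem_nth // su.
  by move=> /(nthP 0) [j]; rewrite su => hj ej; exists (Ordinal hj); rewrite !A'ii.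
have [uA [E [F [EE FF EF]]]] := trig_commutator tA' A'i A'0 A'N.
exists (perturbed_section f A'); first exact: (perturbed_section_commutator hf uA EE FF EF).
have hc i : rn (c 0 i) <= d + d.
  rewrite mxE; case: (split_ordP i) => k ->.
    rewrite Al; have := ud k; rewrite nth_cat size_mkseq ltn_ord nth_mkseq // => h.
    by apply: le_trans h _; rewrite lerDl ltW.
  apply: le_trans (rnB _ _) _; apply: lerD; last exact: ltW.
  have := ud (n + k)%N; rewrite nth_cat size_mkseq ltnNge leq_addr addKn /= nth_nseq if_same.
  by rewrite subr0.
apply: (@le_lt_trans _ _ (3 * d)); last by rewrite /d; lra.
apply: op_norm_le; first by rewrite mulr_ge0 // ltW.
move=> x; rewrite [X in rn X](_ : _ = (K x - oproj ip (n + p) f (K x)) - 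
    comb f (coords ip (n + p) f x *m diag_mx c)); last first.
  rewrite -addrA -opprD; congr (_ - _).
  rewrite /oproj -(linD (@comb_lin _ _ _ f)); congr comb; congr (_ + _ *m _).
  by rewrite /A' addrC addKr.
apply: le_trans (rnB _ _) _; apply: le_trans (lerD (hK x) (rn_comb_diag x hf _ hc)) _.
  by rewrite addr_ge0 // ltW.
by rewrite -mulrDl ler_wpM2r ?rn_ge0 //; lra.
Qed.

End ClosureOfSymmetric.

Theorem corollary4p7 (R : realType) (H : completeNormedModType R[i])
    (ip : {dot H for (@Num.conj R[i])})
    (ip_norm : forall x : H, ip x x = `|x| ^+ 2)
    (H_infinite : infinite_dimensional H)
    (H_separable : separable_space H) :
  compact_op H `&` balanced ip =
  compact_op H `&` norm_closure (idempotent_commutator H).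
Proof.
apply/seteqP; split=> K [cK hK]; split=> //.
  apply: (closure_of_eigenspaces ip_norm H_infinite cK) => l.
  exact: (eigenspaces_of_balanced ip_norm H_infinite cK hK).
apply: (balanced_of_eigenspaces ip_norm H_infinite cK) => l.
exact: (eigenspaces_of_closure ip_norm cK hK).
Qed.
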